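(* Let $\Delta=A_h$ and fix $\nu$ with $1<\nu<h$. For $1\le i_1\le\nu\le i_2\le h$ let $e_{i_1,i_2}$ be the element of degree $\delta_{i_1}+\delta_{i_1+1}+\dots+\delta_{i_2}$ of $F_\Delta(\mathcal E,\tau)$ given by $$e_{i_1,i_2}=\frac{\prod_{i_1\le\varphi<\nu}\theta\bigl(x_{1,\varphi}-x_{1,\varphi+1}+\sum_{i_1\le\alpha\le\varphi}u_\alpha-\tau\bigr)\prod_{\nu\le\psi<i_2}\theta\bigl(x_{1,\psi}-x_{1,\psi+1}-\sum_{\psi<\alpha\le i_2}u_\alpha+\tau\bigr)}{\prod_{i_1\le p<i_2}\theta(x_{1,p}-x_{1,p+1})}\;\theta\Bigl(x_{1,\nu}+\sum_{i_1\le\alpha\le i_2}u_\alpha-2\tau\Bigr).$$ Let $v_i=u_i+u_{i+1}+\dots+u_\nu$ for $1\le i\le\nu$, $w_i=u_\nu+u_{\nu+1}+\dots+u_i$ for $\nu\le i\le h$, and put $q(j,j')=e^{2\pi i\tau}$ for $j<j'$, $q(j,j')=e^{-2\pi i\tau}$ for $j>j'$, $q(j,j)=1$ (here $i=\sqrt{-1}$ in the exponents). Then the elements $\{e_{i_1,i_2},v_{i_1},w_{i_2};\ 1\le i_1\le\nu\le i_2\le h\}$ satisfy the following commutation relations: $$e_{i_1,i_2}e_{i_1',i_2'}=\frac{\theta(v_{i_1}-v_{i_1'}-2\tau)\,\theta(w_{i_2'}-w_{i_2})\,q(i_1',i_1)\,q(i_2',i_2)}{\theta(v_{i_1}-v_{i_1'})\,\theta(w_{i_2'}-w_{i_2}-2\tau)}\,e_{i_1',i_2'}e_{i_1,i_2}+\frac{\theta(-2\tau)\,q(i_2',i_2)\,\theta(w_{i_2'}-w_{i_2}-v_{i_1}+v_{i_1'})}{\theta(v_{i_1'}-v_{i_1})\,\theta(w_{i_2'}-w_{i_2}-2\tau)}\,e_{i_1,i_2'}e_{i_1',i_2}\quad\text{for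 } i_1\ne i_1',\ i_2\ne i_2';$$ $$e_{i_1,i_2}e_{i_1',i_2}=q(i_1',i_1)\,e_{i_1',i_2}e_{i_1,i_2},\qquad e_{i_1,i_2}e_{i_1,i_2'}=q(i_2',i_2)\,e_{i_1,i_2'}e_{i_1,i_2};$$ $$e_{i_1,i_2}v_{i_1'}=v_{i_1'}e_{i_1,i_2}\ \text{ for } i_1\ne i_1',\qquad e_{i_1,i_2}w_{i_2'}=w_{i_2'}e_{i_1,i_2}\ \text{ for } i_2\ne i_2';$$ $$e_{i_1,i_2}v_{i_1}=(v_{i_1}-2\tau)e_{i_1,i_2},\qquad e_{i_1,i_2}w_{i_2}=(w_{i_2}-2\tau)e_{i_1,i_2};$$ $$[v_{i_1},v_{i_1'}]=[w_{i_2},w_{i_2'}]=[v_{i_1},w_{i_2}]=0.$$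
   Context: $\Delta=A_h$ has simple roots $\delta_1,\dots,\delta_h$ with $(\delta_i,\delta_i)=2$, $(\delta_i,\delta_{i+1})=-1$, $(\delta_i,\delta_j)=0$ for $|i-j|>1$. $L^+=\{\sum_i l_i\delta_i:\ l_i\ge0\}$. $\mathcal E=\mathbb C/\Gamma$, $\Gamma=\mathbb Z+\mathbb Z\eta$, $\mathrm{Im}\,\eta>0$, $\theta(z)=\sum_{\alpha\in\mathbb Z}(-1)^\alpha e^{2\pi i(\alpha z+\frac{\alpha(\alpha-1)}2\eta)}$, $\tau\in\mathbb C$. $F_\Delta(\mathcal E,\tau)=\bigoplus_{l\in L^+}F_l$ is the associative algebra in which, for $l=\sum_i l_i\delta_i$, $F_l$ is the space of everywhere meromorphic functions $f(x_{1,1},\dots,x_{l_1,1};\dots;x_{1,h},\dots,x_{l_h,h};u_1,\dots,u_h)$ symmetric in each group $\{x_{1,i},\dots,x_{l_i,i}\}$, and for $f\in F_l$, $g\in F_{l'}$ the product $f*g\in F_{l+l'}$ (written $fg$ in the claim) is $$\frac{1}{\prod_i l_i!\,l'_i!}\sum_{\sigma_i\in S_{l_i+l'_i},\,1\le i\le h} f(\{x_{\sigma_i(\alpha),i}\}_{1\le\alpha\le l_i};u_1,\dots,u_h)\, g(\{x_{\sigma_i(\beta),i}\}_{l_i<\beta\le l_i+l'_i};u_1-2(l,\delta_1)\tau,\dots,u_h-2(l,\delta_h)\tau)\prod_{\substack{1\le i,j\le h\\1\le\alpha\le l_i\\ l_j<\beta\le l_j+l'_j}}\frac{\theta(x_{\sigma_i(\alpha),i}-x_{\sigma_j(\beta),j}-(\delta_i,\delta_j)\tau)}{\theta(x_{\sigma_i(\alpha),i}-x_{\sigma_j(\beta),j})}.$$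 Functions of $u_1,\dots,u_h$ only (such as the $v_i$, $w_i$ and the coefficients in the relations) are elements of $F_0$.
   Formalization: The relations moving e_{i_1,i_2} past v (resp. w) hold as printed only if i_2≠ν (resp. i_1≠ν); if i_2=ν (resp. i_1=ν) every shift is larger by 2τ: e v_{i_1'}=(v_{i_1'}-2τ)e for i_1'≠i_1 and e v_{i_1}=(v_{i_1}-4τ)e, likewise for w. *)

(* Defs.v *)
From HB Require Import structures.
From mathcomp Require Import all_boot all_order all_algebra all_fingroup.
From mathcomp Require Import all_classical all_reals all_analysis.
From mathcomp Require Import complex.

Set Implicit Arguments.
Unset Strict Implicit.
Unset Printing Implicit Defensive.

Import Order.TTheory GRing.Theory Num.Theory.
Import numFieldNormedType.Exports.

Local Open Scope classical_set_scope.
Local Open Scope ring_scope.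
Local Open Scope complex_scope.

Section Theta.
Context {R : realType}.
Implicit Types z eta : R[i].

Definition cexp z : R[i] :=
  (expR (complex.Re z) * cos (complex.Im z)) +i*
  (expR (complex.Re z) * sin (complex.Im z)).

Definition twopii : R[i] := 0 +i* (2 * pi).

Definition theta_term eta z (a : int) : R[i] :=
  (-1) ^ a * cexp (twopii * (a%:~R * z + (a * (a - 1))%:~R / 2 * eta)).

(* The sum over Z, split into the indices 0, 1, 2, ... and -1, -2, ...       *)
Definition theta eta z : R[i] :=
  limn (series (fun n => theta_term eta z (Posz n)) : nat -> R[i]^o) +
  limn (series (fun n => theta_term eta z (Negz n)) : nat -> R[i]^o).

End Theta.

(* A meromorphic function is represented by a total function which is        *)
(* locally g / h at the points where h does not vanish; its values on the    *)
(* (nowhere dense) rest carry no information.  Accordingly two               *)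
(* representatives define the same meromorphic function when they agree on   *)
(* a dense open set.  Differentiability is over the field R[i].              *)
Section Meromorphic.
Context {R : realType} {V : normedModType R[i]}.
Implicit Types f g h : V -> R[i]^o.

Definition holomorphic_on (U : set V) f := forall p, U p -> differentiable f p.

Definition meromorphic f := forall p, exists (U : set V) g h,
  [/\ open U /\ U p, holomorphic_on U g, holomorphic_on U h,
      U `<=` closure [set x | h x != 0] &
      forall x, U x -> h x != 0 -> f x = g x / h x].

Definition mero_eq f g :=
  exists D : set V, [/\ open D, dense D & forall x, D x -> f x = g x].

End Meromorphic.

(* Simple roots are indexed by 'I_h, hence from 0 to h - 1.                  *)
Section RootLattice.
Context {h : nat}.

Definition cartan (i j : 'I_h) : int :=
  if i == j then 2 else if (i.+1 == j) || (j.+1 == i) then -1 else 0.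

Definition Lplus := 'I_h -> nat.

Definition Ladd (l l' : Lplus) : Lplus := fun i => (l i + l' i)%N.

Definition Lsub (l l' : Lplus) : Lplus := fun i => (l i - l' i)%N.

Definition Lzero : Lplus := fun=> 0%N.

(* delta_i1 + delta_(i1 + 1) + ... + delta_i2 *)
Definition segment (i1 i2 : 'I_h) : Lplus := fun k => (i1 <= k <= i2)%N.

(* (l, delta_j) *)
Definition pairing (l : Lplus) (j : 'I_h) : int :=
  \sum_(i < h) (l i)%:Z * cartan i j.

Lemma Ladd_sub (L : Lplus) (l : {dffun forall i : 'I_h, 'I_(L i).+1}) :
  L = Ladd (fun i => l i) (Lsub L (fun i => l i)).
Proof. by apply/funext => i; rewrite /Ladd /Lsub subnKC // -ltnS. Qed.

End RootLattice.
Arguments Lplus : clear implicits.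

Section Algebra.
Context {R : realType} {h : nat}.
Implicit Types (l : Lplus h) (eta tau : R[i]) (u : 'rV[R[i]]_h).

(* The space of the variables (x; u) of the functions of degree l: the       *)
(* coordinates x_(1,i), ..., x_(l_i,i) form the i-th block of the first      *)
(* component.                                                                *)
Definition vars l := ('rV[R[i]]_(\sum_(i < h) l i) * 'rV[R[i]]_h)%type.

Definition xvar l (p : vars l) (i : 'I_h) (a : 'I_(l i)) : R[i] :=
  submxrow p.1 i 0 a.

Definition mkvars l (x : forall i : 'I_h, 'I_(l i) -> R[i]) u : vars l :=
  (\mxrow_(i < h) (\row_(a < l i) x i a), u).

Definition castvars l l' (E : l = l') (p : vars l) : vars l' :=
  eq_rect l vars p l' E.

Definition symmetric_fun l (f : vars l -> R[i]) :=
  forall s : (forall i : 'I_h, 'S_(l i)),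
    mero_eq (fun p => f (mkvars (fun i a => xvar p (s i a)) p.2)) f.

Definition inF_ l (f : vars l -> R[i]) := meromorphic f /\ symmetric_fun f.

(* The product F_l x F_l' -> F_(l + l').                                     *)
Definition star eta tau l l' (f : vars l -> R[i]) (g : vars l' -> R[i])
    (p : vars (Ladd l l')) : R[i] :=
  (\prod_(i < h) ((l i)`! * (l' i)`!))%:R^-1 *
  \sum_(s : {dffun forall i : 'I_h, 'S_(l i + l' i)})
    let xl i a := xvar p (s i (lshift (l' i) a)) in
    let xr i b := xvar p (s i (rshift (l i) b)) in
    f (mkvars xl p.2) *
    g (mkvars xr (\row_(i < h) (p.2 0 i - 2 * (pairing l i)%:~R * tau))) *
    \prod_(i < h) \prod_(j < h) \prod_(a < l i) \prod_(b < l' j)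
      (theta eta (xl i a - xr j b - (cartan i j)%:~R * tau) /
       theta eta (xl i a - xr j b)).

(* Elements of the direct sum are represented by the family of their         *)
(* homogeneous components; inF singles out the families that do represent    *)
(* an element, eqF is equality in the direct sum.                            *)
Definition gradedfam := forall l, vars l -> R[i].
Implicit Types a b : gradedfam.

Definition eqF a b := forall l, mero_eq (a l) (b l).

Definition zeroF : gradedfam := fun _ _ => 0.

Definition inF a :=
  (forall l, inF_ (a l)) /\
  exists N : nat, forall l, (N < \sum_(i < h) l i)%N -> mero_eq (a l) (@zeroF l).

Definition addF a b : gradedfam := fun l p => a l p + b l p.

Definition scaleF (c : R[i]) a : gradedfam := fun l p => c * a l p.

(* The component of degree L collects the products of components of degrees  *)
(* l and L - l for 0 <= l <= L.                                              *)
Definition mulF eta tau a b : gradedfam := fun L p =>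
  \sum_(l : {dffun forall i : 'I_h, 'I_(L i).+1})
    star eta tau (a (fun i => l i)) (b (Lsub L (fun i => l i)))
      (castvars (Ladd_sub l) p).

Definition commF eta tau a b : gradedfam :=
  addF (mulF eta tau a b) (scaleF (-1) (mulF eta tau b a)).

Definition homF l (f : vars l -> R[i]) : gradedfam := fun l' p =>
  if pselect (l' = l) is left E then f (castvars E p) else 0.

(* Functions of u_1, ..., u_h as elements of degree 0.                       *)
Definition funF (c : 'rV[R[i]]_h -> R[i]) : gradedfam :=
  homF (fun p : vars Lzero => c p.2).

(* x_(1,i); the default value is not used when l i > 0.                      *)
Definition x1 l (p : vars l) (i : 'I_h) : R[i] :=
  oapp (xvar p (i := i)) 0 (insub 0%N).

End Algebra.
Arguments gradedfam : clear implicits.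

Section Generators.
Context {R : realType} {h : nat}.
Variables (eta tau : R[i]) (nu : 'I_h).
Implicit Types u : 'rV[R[i]]_h.

Definition vfun (i : 'I_h) u : R[i] := \sum_(k < h | (i <= k <= nu)%N) u 0 k.

Definition wfun (i : 'I_h) u : R[i] := \sum_(k < h | (nu <= k <= i)%N) u 0 k.

(* ordS i is the index i + 1, as i < h - 1 in all the factors below.         *)
Definition efun (i1 i2 : 'I_h) (p : vars (segment i1 i2)) : R[i] :=
  let x := x1 p in let u := p.2 0 in
  (\prod_(i < h | (i1 <= i < nu)%N)
      theta eta (x i - x (ordS i) + \sum_(a < h | (i1 <= a <= i)%N) u a - tau)) *
  (\prod_(i < h | (nu <= i < i2)%N)
      theta eta (x i - x (ordS i) - \sum_(a < h | (i < a <= i2)%N) u a + tau)) /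
  (\prod_(i < h | (i1 <= i < i2)%N) theta eta (x i - x (ordS i))) *
  theta eta (x nu + \sum_(a < h | (i1 <= a <= i2)%N) u a - 2 * tau).

Definition qfac (j j' : 'I_h) : R[i] :=
  if (j < j')%N then cexp (twopii * tau)
  else if (j' < j)%N then cexp (- (twopii * tau)) else 1.

End Generators.

Notation "a =F b" := (eqF a b) (at level 70, no associativity).

(* Main.v *)
From HB Require Import structures.
Require Import Defs.
From mathcomp Require Import all_boot all_order all_algebra all_fingroup.
From mathcomp Require Import all_classical all_reals all_analysis.
From mathcomp Require Import complex ring lra zify.

Set Implicit Arguments.
Unset Strict Implicit.
Unset Printing Implicit Defensive.

Import Order.TTheory GRing.Theory Num.Theory.
Import numFieldNormedType.Exports.

Local Open Scope ring_scope.
Local Open Scope complex_scope.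

(** The product of two generators is a symmetrisation over at most two variables
    of each colour, so that it is a sum over the choices, at each colour, of the
    variable that goes to the first factor.  The kernel of the product couples
    only equal and adjacent colours, and the generators couple only adjacent
    ones: the sum is a transfer-matrix sum along the diagram (star_normal,
    summandE, transfer).  Cut at the colour nu, it becomes
    [pairing_sum z A B T], the sum over c of A c * kap (z c) (z (~~ c)) * T c * B c,
    where z c and z (~~ c) are the two variables of colour nu, the function A
    comes from the colours below nu and depends only on i1 and i1', the function
    B comes from the colours above nu and depends only on i2 and i2', and T is
    the product of the two theta factors of colour nu (star_efun).  The claim
    compares such sums for permuted end points.

    The functions A attached to (i1, i1') and to (i1', i1) are related by an
    exchange operator with parameter V = v_i1 - v_i1', a two by two matrix with
    theta-quotients as entries (exch).  The relation holds at the colour where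
    the second segment starts (base_lt, base_gt), and it propagates to nu because
    the exchange operator commutes with the passage from one colour to the next
    (intertwine).  The same holds for B, read from the other end of the diagram.
    The exchange operator is self-adjoint for the pairing (exch_self_adjoint), so
    that it can be moved onto T, where one more theta identity finishes the proof
    (top_exch and top_same, used in exchange_pair and exchange_same).  When the
    two starting points coincide, A is symmetric instead (chain_symm).

    Each of the theta identities is an instance of one three-term identity.  Up to
    an exponential factor theta is an odd function sigma, and
    sigma (x + y) * sigma (x - y) = P x * Q y - Q x * P y for two functions P, Q:
    split the double series according to the parity of the sum of the indices
    (zsum_mul, theta_mul).  The three-term identity is the Pluecker relation
    between the four vectors (P, Q) at four points (sigma_three_term).

    All this takes place at points where no denominator vanishes, and equality of
    meromorphic functions only asks for a dense open set of such points.  Hence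
    theta has to be holomorphic and not identically zero on any disc.  It is a
    Fourier series with rapidly decreasing coefficients; if such a series
    vanished on a disc, so would its derivatives, and hence the series with
    coefficients P m * c m for each polynomial P in m ^ 2.  The polynomials
    [cutoff n] are 1 at 0, vanish at the other integers of absolute value at most
    n, and grow at most exponentially in m, uniformly in n; in the limit the
    coefficient of index 0 is zero (fourier_ball_eq0), whereas that of theta is 1.

    The relations between e, v and w only express the shift of u in the product:
    functions of u alone multiply pointwise from the left, and moving e past
    such a function shifts its argument. *)

(** * Transfer-matrix sums over two-valued configurations *)
Section Transfer.
Variable K : comPzRingType.
Variables (N : nat -> bool -> K) (W : nat -> bool -> bool -> K).

Fixpoint lsum k c : K :=
  if k is j.+1 then \sum_(d : bool) lsum j d * N j d * W j d c else 1.

Fixpoint rsum k r c : K :=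
  if r is t.+1 then \sum_(d : bool) W k c d * N k.+1 d * rsum k.+1 t d else 1.

(** Configurations are indexed by nat, in order that neighbouring nodes are k and
    k.+1 without casts; the default value false is also the only value that
    carries weight at a node with at most one variable. *)
Definition bext n (b : {ffun 'I_n -> bool}) k := oapp b false (insub k).

Lemma bextE n (b : {ffun 'I_n -> bool}) (i : 'I_n) : bext b i = b i.
Proof. by rewrite /bext valK. Qed.

Definition bsnoc n (bc : {ffun 'I_n -> bool} * bool) : {ffun 'I_n.+1 -> bool} :=
  [ffun i : 'I_n.+1 => if (i < n)%N then bext bc.1 i else bc.2].

Lemma bext_bsnoc n bc k :
  bext (@bsnoc n bc) k = if (k < n)%N then bext bc.1 k else (k == n) && bc.2.
Proof.
rewrite {1}/bext; case: insubP => [i _ <-|] /=.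
  rewrite ffunE; case: ltnP => // h.
  by rewrite (_ : i == n :> nat) // eqn_leq h -ltnS ltn_ord.
by rewrite ltnS; case: ltngtP.
Qed.

Lemma sum_ffun_last n (F : {ffun 'I_n.+1 -> bool} -> K) :
  \sum_b F b = \sum_(c : bool) \sum_(b : {ffun 'I_n -> bool}) F (bsnoc (b, c)).
Proof.
rewrite exchange_big pair_big /=.
rewrite (reindex (@bsnoc n)); first by apply: eq_bigr => -[b c].
pose g (b : {ffun 'I_n.+1 -> bool}) := ([ffun i : 'I_n => bext b i], bext b n).
exists g => [[b c] _|b _].
  congr (_, _); last by rewrite bext_bsnoc ltnn eqxx.
  by apply/ffunP => i; rewrite ffunE bext_bsnoc ltn_ord bextE.
apply/ffunP => i; rewrite ffunE /=; case: ltnP => h.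
  by rewrite (bextE _ (Ordinal h)) ffunE /= bextE.
by rewrite -[RHS]bextE; congr bext; apply/eqP; rewrite eqn_leq h -ltnS ltn_ord.
Qed.

Lemma lsum_last n T :
  \sum_(b : {ffun 'I_n.+1 -> bool})
    (\prod_(0 <= k < n.+1) N k (bext b k)) *
    (\prod_(0 <= k < n) W k (bext b k) (bext b k.+1)) * T (bext b n) =
  \sum_(c : bool) lsum n c * N n c * T c.
Proof.
elim: n T => [|n IHn] T; rewrite sum_ffun_last; apply: eq_bigr => c _.
  rewrite (big_pred1 [ffun=> false]) /=; last first.
    by move=> b; apply/esym/eqP/ffunP => -[].
  by rewrite big_nat1 big_geq // !bext_bsnoc /= mulr1 mul1r.
rewrite [lsum n.+1 c]/= -mulrA mulr_suml.
have -> : \sum_(b : {ffun 'I_n.+1 -> bool})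
   \prod_(0 <= k < n.+2) N k (bext (bsnoc (b, c)) k) *
   \prod_(0 <= k < n.+1) W k (bext (bsnoc (b, c)) k)
      (bext (bsnoc (b, c)) k.+1) * T (bext (bsnoc (b, c)) n.+1) =
   \sum_(b : {ffun 'I_n.+1 -> bool})
    (\prod_(0 <= k < n.+1) N k (bext b k)) *
    (\prod_(0 <= k < n) W k (bext b k) (bext b k.+1)) *
    (W n (bext b n) c * (N n.+1 c * T c)).
  apply: eq_bigr => b _.
  rewrite big_nat_recr //= [X in _ * X * _]big_nat_recr //=.
  rewrite !bext_bsnoc !ltnn ltnSn !eqxx /=.
  under eq_big_nat => k /andP[_ hk] do rewrite bext_bsnoc hk.
  under [X in _ * (X * _)]eq_big_nat => k /andP[_ hk].
    rewrite !bext_bsnoc /= (ltnW hk : (k < n.+1)%N) ltnS hk; over.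
  by rewrite /=; ring.
by rewrite (IHn (fun d => W n d c * (N n.+1 c * T c))); apply: eq_bigr => d _;
  rewrite !mulrA.
Qed.

Lemma lsum_rsum j r :
  \sum_(c : bool) lsum (j + r) c * N (j + r) c =
  \sum_(c : bool) lsum j c * N j c * rsum j r c.
Proof.
elim: r j => [|r IHr] j.
  by rewrite addn0; apply: eq_bigr => c _; rewrite mulr1.
rewrite -addSnnS IHr /=.
under [RHS]eq_bigr => c _ do rewrite mulr_sumr.
rewrite exchange_big /=; apply: eq_bigr => d _.
rewrite !mulr_suml; apply: eq_bigr => c _.
by rewrite !mulrA.
Qed.

(** Summing first over the nodes on either side of j factors the sum over
    configurations into a left and a right part that meet at the value at j. *)
Lemma transfer n j : (j <= n)%N ->
  \sum_(b : {ffun 'I_n.+1 -> bool})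
    (\prod_(0 <= k < n.+1) N k (bext b k)) *
    (\prod_(0 <= k < n) W k (bext b k) (bext b k.+1)) =
  \sum_(c : bool) lsum j c * N j c * rsum j (n - j) c.
Proof.
move=> jn; rewrite -lsum_rsum subnKC //; have := lsum_last n (fun=> 1).
by under eq_bigr do rewrite mulr1; move=> ->; apply: eq_bigr => c _;
  rewrite mulr1.
Qed.

End Transfer.

(** * Exchange relations from a three-term identity *)
Section Elliptic.
Variables (K : fieldType) (s e : K -> K).
Hypothesis sN : forall z, s (- z) = - s z.
Hypothesis eD : forall y z, e (y + z) = e y * e z.
Hypothesis e_neq0 : forall z, e z != 0.
Hypothesis fay : forall m a b g,
  s (m + a + b) * s (a - b) * s (m + g) * s g -
  s (m + a + g) * s (a - g) * s (m + b) * s b +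
  s (m + a) * s a * s (m + b + g) * s (b - g) = 0.

(** This is the shape of theta: an odd function s times an exponential.  The
    exponentials produce the powers of the parameter q in the relations. *)
Definition th z := e z * s z.

Variable tau : K.

(** kap is the kernel of the product for two variables of one colour, where the
    entry of the Cartan matrix is 2, and ker the one for adjacent colours, where
    it is -1; edge is the factor by which a generator joins its variables x and
    x' of adjacent colours. *)
Definition kap x y := th (x - y - 2 * tau) / th (x - y).
Definition ker x y := th (x - y + tau) / th (x - y).
Definition edge a x x' := th (x - x' + a) / th (x - x').
(** The weight of two chains going from the variables x, y of one colour to the
    variables x', y' of the next, x to x' and y to y'. *)
Definition pairw a b x y x' y' :=
  edge a x x' * edge b y y' * ker x y' * ker x' y.
(** The diagonal entry of the exchange operator; the other entry is
    th V * kap y x. *)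
Definition coef V x y := th (- (2 * tau)) * th (x - y + V) / th (x - y).

Lemma th_neq0 z : (th z != 0) = (s z != 0).
Proof. by rewrite /th mulf_eq0 (negbTE (e_neq0 z)). Qed.

Lemma e0 : e 0 = 1.
Proof. by apply: (mulfI (e_neq0 0)); rewrite -eD addr0 mulr1. Qed.

Lemma eN z : e (- z) = (e z)^-1.
Proof. by apply: (mulfI (e_neq0 z)); rewrite -eD subrr e0 divff. Qed.

Lemma e_double z : e (2 * z) = e z ^+ 2.
Proof. by rewrite mulr_natl mulr2n eD expr2. Qed.

Lemma th_ratio z c : th (z + c) / th z = e c * (s (z + c) / s z).
Proof.
rewrite /th eD; have [->|sz] := eqVneq (s z) 0.
  by rewrite !(mulr0, invr0).
by field; rewrite e_neq0 sz.
Qed.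

Lemma kapE x y : kap x y = e (- (2 * tau)) * (s (x - y - 2 * tau) / s (x - y)).
Proof. exact: th_ratio. Qed.

Lemma kerE x y : ker x y = e tau * (s (x - y + tau) / s (x - y)).
Proof. exact: th_ratio. Qed.

Lemma edgeE a x x' : edge a x x' = e a * (s (x - x' + a) / s (x - x')).
Proof. exact: th_ratio. Qed.

Lemma coefE V x y : coef V x y =
  e (- (2 * tau)) * e V * (s (- (2 * tau)) * (s (x - y + V) / s (x - y))).
Proof. by rewrite /coef -mulrA th_ratio /th; ring. Qed.

Lemma sB x y : s (x - y) = - s (y - x).
Proof. by rewrite -sN opprB. Qed.

(** The three-term identity, arranged so that each product on the left joins
    x with x' and y with y'. *)
Lemma bracket V a b x y x' y' : V = a - b ->
  s (x' - y') * s (x - y + V) * s (x - x' + b) * s (y - y' + a) -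
  s (x - y) * s (x' - y' + V) * s (x - x' + a) * s (y - y' + b) =
  - (s V * s (x - y' + a) * s (y - x' + b) * s (x - y - x' + y')).
Proof.
move=> ->.
(* Matching the right-hand side with s (m + a) * s a * s (m + b + g) * s (b - g), up to
   signs, determines m, a, b and g. *)
have := fay (y - x' + a) (x - y) (b - a) (x' - y').
have -> : y - x' + a + (x - y) + (b - a) = x - x' + b by ring.
have -> : x - y - (b - a) = x - y + (a - b) by ring.
have -> : y - x' + a + (x' - y') = y - y' + a by ring.
have -> : y - x' + a + (x - y) + (x' - y') = x - y' + a by ring.
have -> : x - y - (x' - y') = x - y - x' + y' by ring.
have -> : y - x' + a + (b - a) = y - x' + b by ring.
have -> : y - x' + a + (x - y) = x - x' + a by ring.
have -> : y - x' + b + (x' - y') = y - y' + b by ring.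
have -> : b - a - (x' - y') = - (x' - y' + (a - b)) by ring.
rewrite sN (sB b a) => h; apply/eqP; rewrite -subr_eq0 -[X in _ == X]h.
by apply/eqP; ring.
Qed.

Lemma frac_flip u v t : s (u - v + t) / s (u - v) = s (v - u - t) / s (v - u).
Proof.
by rewrite -[u - v + t]opprK sN opprD opprB (sB u v) invrN mulrNN.
Qed.

Lemma bracket_div V a b x y x' y' : V = a - b ->
  s (x - y) != 0 -> s (x' - y') != 0 ->
  s (x - y + V) / s (x - y) * s (x - x' + b) * s (y - y' + a) -
  s (x' - y' + V) / s (x' - y') * s (x - x' + a) * s (y - y' + b) =
  - (s V * s (x - y' + a) * s (y - x' + b) * s (x - y - x' + y')) /
    (s (x - y) * s (x' - y')).
Proof.
move=> eV h1 h2; rewrite -(bracket x y x' y' eV).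
by field; rewrite h1 h2.
Qed.

(** The exchange operator with parameter V commutes with the step between two
    colours when the parameters of the two chains differ by V.  After removal of
    the common exponentials and denominators the difference of the two sides is a
    combination of two brackets, one with parameter V and one with parameter
    - 2 * tau, and the right-hand sides of these cancel. *)
Lemma intertwine V a b x y x' y' : V = a - b ->
  s (x - y) != 0 -> s (x' - y') != 0 -> s (x - x') != 0 -> s (x - y') != 0 ->
  s (y - x') != 0 -> s (y - y') != 0 ->
  coef V x y * pairw b a x y x' y' + th V * kap y x * pairw b a y x x' y' =
  coef V x' y' * pairw a b x y x' y' + th V * kap y' x' * pairw a b x y y' x'.
Proof.
move=> eV nxy nxy' h1 h2 h3 h4; rewrite /pairw !(coefE, kapE, kerE, edgeE) /th.
rewrite (frac_flip x' y) (frac_flip x' x) (frac_flip y' y).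
have nyx : s (y - x) != 0 by rewrite sB oppr_eq0.
have nyx' : s (y' - x') != 0 by rewrite sB oppr_eq0.
have b1 := bracket_div eV nxy nxy'.
have b2 := @bracket_div (- (2 * tau)) (- tau) tau y x y' x' _ nyx nyx'.
have {}b2 := b2 ltac:(ring).
apply/eqP; rewrite -subr_eq0; apply/eqP.
set l := (X in X = 0).
pose d := e (- (2 * tau)) * e V * e a * e b * e tau ^+ 2 /
  (s (x - x') * s (x - y') * s (y - x') * s (y - y')).
have -> : l = d * (s (- (2 * tau)) * s (x - y' + tau) * s (y - x' - tau) *
    (s (x - y + V) / s (x - y) * s (x - x' + b) * s (y - y' + a) -
     s (x' - y' + V) / s (x' - y') * s (x - x' + a) * s (y - y' + b)) +
   s V * s (x - y' + a) * s (y - x' + b) *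
    (s (y - x - 2 * tau) / s (y - x) * s (y - y' + tau) * s (x - x' - tau) -
  s (y' - x' - 2 * tau) / s (y' - x') * s (y - y' - tau) * s (x - x' + tau))).
  by rewrite /l /d; field; rewrite nxy nyx nxy' nyx' h1 h2 h3 h4.
rewrite b1 b2 (sB y x) (sB y' x').
have -> : y - x - y' + x' = - (x - y - x' + y') by ring.
rewrite !sN.
by field; rewrite !oppr_eq0 nxy nxy'.
Qed.

(** When the parameters of the two chains differ by 2 * tau, as they do for two
    segments with a common end point, a step preserves symmetry in the two
    variables: the antisymmetric part in x', y' factors, by the three-term
    identity, into an expression whose sum over the two orders of x, y vanishes. *)
Lemma pair_symm a x y x' y' : 
  s (x - y) != 0 -> s (x' - y') != 0 -> s (x - x') != 0 -> s (x - y') != 0 ->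
  s (y - x') != 0 -> s (y - y') != 0 ->
  let b := a - 2 * tau in
  kap x y * pairw a b x y x' y' + kap y x * pairw a b y x x' y' =
  kap x y * pairw a b x y y' x' + kap y x * pairw a b y x y' x'.
Proof.
move=> nxy nxy' h1 h2 h3 h4 b; rewrite /pairw !(kapE, kerE, edgeE).
rewrite (frac_flip x' y) (frac_flip x' x) (frac_flip y' y) (frac_flip y' x).
have nyx : s (y - x) != 0 by rewrite sB oppr_eq0.
have key u v u' v' :
    s (u - u' + a) * s (v - v' + b) * s (u - v' + tau) * s (v - u' - tau) -
    s (u - v' + a) * s (v - u' + b) * s (u - u' + tau) * s (v - v' - tau) =
    s (u + v - u' - v' + a - tau) * s (u - v + 2 * tau) * s (a - tau) *
      s (v' - u').
  (* The products on the left are the first and the third term of the identity. *)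
  have := fay (u - v - v' + u' + 2 * tau) (b + v - u') (v' - u') (v - u' - tau).
  rewrite /b.
  have -> : u - v - v' + u' + 2 * tau + (a - 2 * tau + v - u') + (v' - u') =
    u - u' + a by ring.
  have -> : a - 2 * tau + v - u' - (v' - u') = v - v' + (a - 2 * tau) by ring.
  have -> : u - v - v' + u' + 2 * tau + (v - u' - tau) = u - v' + tau by ring.
  have -> : u - v - v' + u' + 2 * tau + (a - 2 * tau + v - u') +
    (v - u' - tau) = u + v - u' - v' + a - tau by ring.
  have -> : a - 2 * tau + v - u' - (v - u' - tau) = a - tau by ring.
  have -> : u - v - v' + u' + 2 * tau + (v' - u') = u - v + 2 * tau by ring.
  have -> : u - v - v' + u' + 2 * tau + (a - 2 * tau + v - u') = u - v' + a.
    by ring.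
  have -> : a - 2 * tau + v - u' = v - u' + (a - 2 * tau) by ring.
  have -> : u - v + 2 * tau + (v - u' - tau) = u - u' + tau by ring.
  have -> : v' - u' - (v - u' - tau) = - (v - v' - tau) by ring.
  rewrite sN => h; apply/eqP; rewrite -subr_eq0 -[X in _ == X]h.
  by apply/eqP; ring.
have k1 := key x y x' y'; have k2 := key y x x' y'.
apply/eqP; rewrite -subr_eq0; apply/eqP.
set l := (X in X = 0).
pose d := e (- (2 * tau)) * e a * e b * e tau ^+ 2 /
  (s (x - x') * s (x - y') * s (y - x') * s (y - y')).
have -> : l = d * (s (x - y - 2 * tau) / s (x - y) *
    (s (x - x' + a) * s (y - y' + b) * s (x - y' + tau) * s (y - x' - tau) -
     s (x - y' + a) * s (y - x' + b) * s (x - x' + tau) * s (y - y' - tau)) +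
    s (y - x - 2 * tau) / s (y - x) *
    (s (y - x' + a) * s (x - y' + b) * s (y - y' + tau) * s (x - x' - tau) -
     s (y - y' + a) * s (x - x' + b) * s (y - x' + tau) * s (x - y' - tau))).
  by rewrite /l /d; field; rewrite nxy nyx h1 h2 h3 h4.
rewrite k1 k2 (_ : y + x - x' - y' = x + y - x' - y'); last by ring.
have -> : y - x + 2 * tau = - (x - y - 2 * tau) by ring.
have -> : y - x - 2 * tau = - (x - y + 2 * tau) by ring.
by rewrite !sN (sB y x); field; rewrite ?oppr_eq0 nxy.
Qed.

(** An edge read against the orientation of the diagram, as happens above nu when
    the colours are enumerated from the top down to nu. *)
Definition redge a x x' := th (x' - x - a) / th (x' - x).

(** Reversing an edge only costs an exponential, so that the two sides of nu obey
    the same exchange relations up to the powers of q. *)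
Lemma redgeE a x x' : redge a x x' = e (- (2 * a)) * edge a x x'.
Proof.
rewrite edgeE /redge th_ratio (frac_flip x) [RHS]mulrA -eD.
by congr (e _ * _); ring.
Qed.

(** The exchange relation at the colour where the second chain starts: the
    first one arrives there from its single variable t of the previous colour.
    In one order of the factors the new variable meets t in the second argument
    of the kernel, in the other order in the first argument, and the parameter of
    the edge is shifted by 2 * tau. *)
Lemma base_lt V t x y :
  s (x - y) != 0 -> s (t - x) != 0 -> s (t - y) != 0 ->
  th (V - 2 * tau) * (edge (V + tau) t y * ker x t) =
  e (2 * tau) * (coef V x y * (edge (V - tau) t x * ker t y) +
             th V * kap y x * (edge (V - tau) t y * ker t x)).
Proof.
move=> nxy h1 h2; rewrite !(coefE, kapE, kerE, edgeE) /th.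
rewrite (frac_flip x t) (frac_flip y x) opprK !(eD V) (eN tau) (eN (2 * tau)) e_double.
have := fay (t - y - tau) (y - x) (2 * tau) V.
have -> : t - y - tau + (y - x) + 2 * tau = t - x + tau by ring.
have -> : y - x - 2 * tau = - (x - y + 2 * tau) by ring.
have -> : t - y - tau + V = t - y + (V - tau) by ring.
have -> : t - y - tau + (y - x) + V = t - x + (V - tau) by ring.
have -> : y - x - V = - (x - y + V) by ring.
have -> : t - y - tau + 2 * tau = t - y + tau by ring.
have -> : t - y - tau + (y - x) = t - x - tau by ring.
have -> : t - y + tau + V = t - y + (V + tau) by ring.
have -> : 2 * tau - V = - (V - 2 * tau) by ring.
rewrite !sN (sB y x) => h; apply/eqP; rewrite -subr_eq0; apply/eqP.
set l := (X in X = 0).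
pose d := e V ^+ 2 / (s (t - x) * s (t - y) * s (x - y)).
rewrite -[RHS](mulr0 d) -[in RHS]h /l /d.
by field; rewrite !e_neq0 nxy h1 h2.
Qed.

Lemma base_gt V t x y :
  s (x - y) != 0 -> s (t - x) != 0 -> s (t - y) != 0 ->
  th (V - 2 * tau) * (edge (- V - tau) t x * ker t y) =
  e (- (2 * tau)) * (coef V x y * (edge (- V + tau) t y * ker x t) +
             th V * kap y x * (edge (- V + tau) t x * ker y t)).
Proof.
move=> nxy h1 h2; rewrite !(coefE, kapE, kerE, edgeE) /th.
rewrite (frac_flip x t) (frac_flip y x) (frac_flip y t) opprK.
rewrite !(eD V) !(eD (- V)) (eN tau) (eN (2 * tau)) (eN V) e_double.
have := fay (x - t - tau) (y - x) (2 * tau) V.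
have -> : x - t - tau + (y - x) + 2 * tau = - (t - y - tau) by ring.
have -> : y - x - 2 * tau = - (x - y + 2 * tau) by ring.
have -> : x - t - tau + V = - (t - x + (- V + tau)) by ring.
have -> : x - t - tau + (y - x) + V = - (t - y + (- V + tau)) by ring.
have -> : y - x - V = - (x - y + V) by ring.
have -> : x - t - tau + 2 * tau = - (t - x - tau) by ring.
have -> : x - t - tau + (y - x) = - (t - y + tau) by ring.
have -> : - (t - x - tau) + V = - (t - x + (- V - tau)) by ring.
have -> : 2 * tau - V = - (V - 2 * tau) by ring.
rewrite !sN (sB y x) => h; apply/eqP; rewrite -subr_eq0; apply/eqP.
set l := (X in X = 0).
pose d := e tau ^- 2 / (s (t - x) * s (t - y) * s (x - y)).
rewrite -[RHS](mulr0 d) -[in RHS]h /l /d.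
by field; rewrite !e_neq0 nxy h1 h2.
Qed.

(** The exchange operators with parameters V and W, moved onto the factor of
    colour nu, produce the second term of the relation between generators
    without common end point: this is where e_(i1,i2') e_(i1',i2) arises. *)
Lemma top_exch V W r x y : s (x - y) != 0 -> s V != 0 ->
  th V * coef W x y * (th (x + r - W) * th (y + r - V)) =
  th W * coef V x y * (th (x + r - V) * th (y + r - W)) +
  th V * (th (- (2 * tau)) * th (W - V) / th (- V)) *
    (th (x + r) * th (y + r - V - W)).
Proof.
move=> nxy nV; rewrite !coefE /th !(eD, eN) !sN.
have := fay (- (y + r)) (y - x) W V.
have -> : - (y + r) + (y - x) + W = - (x + r - W) by ring.
have -> : y - x - W = - (x - y + W) by ring.
have -> : - (y + r) + V = - (y + r - V) by ring.
have -> : - (y + r) + (y - x) + V = - (x + r - V) by ring.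
have -> : y - x - V = - (x - y + V) by ring.
have -> : - (y + r) + W = - (y + r - W) by ring.
have -> : - (y + r) + (y - x) = - (x + r) by ring.
have -> : - (y + r - W) + V = - (y + r - V - W) by ring.
rewrite !sN (sB y x) => h; apply/eqP; rewrite -subr_eq0; apply/eqP.
set l := (X in X = 0).
pose d := s (2 * tau) / s (x - y) / e (2 * tau) * e x * e y * e r ^+ 2.
rewrite -[RHS](mulr0 d) -[in RHS]h /l /d.
by field; rewrite !e_neq0 nxy ?oppr_eq0 nV.
Qed.

(** The factor of colour nu for two generators with one common end point is an
    exact eigenvector, so that no second term appears. *)
Lemma top_same V r x y : s (x - y) != 0 ->
  th (V - 2 * tau) * (th (x + r + V) * th (y + r - 2 * tau)) =
  coef V x y * (th (x + r) * th (y + r + V - 2 * tau)) +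
  th V * kap y x * (th (y + r) * th (x + r + V - 2 * tau)).
Proof.
move=> nxy; rewrite !(coefE, kapE) /th (frac_flip y x) opprK !(eD, eN).
have := fay (x + r - 2 * tau) (y - x) (2 * tau) V.
have -> : x + r - 2 * tau + (y - x) + 2 * tau = y + r by ring.
have -> : y - x - 2 * tau = - (x - y + 2 * tau) by ring.
have -> : x + r - 2 * tau + V = x + r + V - 2 * tau by ring.
have -> : x + r - 2 * tau + (y - x) + V = y + r + V - 2 * tau by ring.
have -> : y - x - V = - (x - y + V) by ring.
have -> : x + r - 2 * tau + 2 * tau = x + r by ring.
have -> : x + r - 2 * tau + (y - x) = y + r - 2 * tau by ring.
have -> : 2 * tau - V = - (V - 2 * tau) by ring.
rewrite (addrC (x + r) V) !sN (sB y x) => h.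
apply/eqP; rewrite -subr_eq0; apply/eqP.
set l := (X in X = 0).
pose d := e V ^+ 2 * (e (2 * tau)) ^- 2 * e x * e y * e r ^+ 2 / s (x - y).
rewrite -[RHS](mulr0 d) -[in RHS]h /l /d (addrC V (x + r)).
by field; rewrite !e_neq0 nxy.
Qed.


(** The two variables of one colour form a function z on bool, and a function of a
    boolean c stands for a function of the ordered pair z c, z (~~ c). *)
Definition generic2 (z : bool -> K) := s (z true - z false) != 0.
Definition generic4 (z z' : bool -> K) := forall c c', s (z c - z' c') != 0.

(** B is proportional to the image of A under the exchange operator with parameter
    V.  The factor th (V - 2 * tau), which may vanish, stays on the left. *)
Definition exch V q (z A B : bool -> K) := forall c,
  th (V - 2 * tau) * B c =
  q * (coef V (z c) (z (~~ c)) * A c + th V * kap (z (~~ c)) (z c) * A (~~ c)).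

Definition pstep a b C (z z' A : bool -> K) c' :=
  \sum_(c : bool) A c * kap (z c) (z (~~ c)) *
    (C * pairw a b (z c) (z (~~ c)) (z' c') (z' (~~ c'))).

Lemma generic2E z c : generic2 z -> s (z c - z (~~ c)) != 0.
Proof. by case: c => //; rewrite sB oppr_eq0. Qed.

Lemma exch_step V q a b C z z' A B :
  V = a - b -> generic2 z -> generic2 z' -> generic4 z z' ->
  exch V q z A B -> exch V q z' (pstep a b C z z' A) (pstep b a C z z' B).
Proof.
move=> eV g g' gg h c'; rewrite /pstep !big_bool /=.
rewrite negbK.
have i1 := intertwine eV (generic2E true g) (generic2E c' g') (gg _ _)
  (gg _ _) (gg _ _) (gg _ _).
have i2 := intertwine eV (generic2E false g) (generic2E c' g') (gg _ _)
  (gg _ _) (gg _ _) (gg _ _).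
have h1 := h true; have h2 := h false; simpl in *.
transitivity (C * (th (V - 2 * tau) * B true * kap (z true) (z false) *
    pairw b a (z true) (z false) (z' c') (z' (~~ c')) +
  th (V - 2 * tau) * B false * kap (z false) (z true) *
    pairw b a (z false) (z true) (z' c') (z' (~~ c')))); first by ring.
rewrite h1 h2.
transitivity (C * q * (A true * kap (z true) (z false) *
   (coef V (z true) (z false) *
     pairw b a (z true) (z false) (z' c') (z' (~~ c')) +
     th V * kap (z false) (z true) *
     pairw b a (z false) (z true) (z' c') (z' (~~ c'))) +
  A false * kap (z false) (z true) *
    (coef V (z false) (z true) *
     pairw b a (z false) (z true) (z' c') (z' (~~ c')) +
     th V * kap (z true) (z false) *
     pairw b a (z true) (z false) (z' c') (z' (~~ c'))))); first by ring.
by rewrite i1 i2; ring.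
Qed.

Lemma symm_step a C z z' A :
  generic2 z -> generic2 z' -> generic4 z z' -> (forall c, A c = A (~~ c)) ->
  forall c', pstep a (a - 2 * tau) C z z' A c' =
    pstep a (a - 2 * tau) C z z' A (~~ c').
Proof.
move=> g g' gg h c'; rewrite /pstep !big_bool /= negbK -(h true).
have := pair_symm a (generic2E true g) (generic2E c' g') (gg _ _) (gg _ _)
  (gg _ _) (gg _ _).
rewrite /= => e1.
transitivity (A true * C * (kap (z true) (z false) *
     pairw a (a - 2 * tau) (z true) (z false) (z' c') (z' (~~ c')) +
     kap (z false) (z true) *
     pairw a (a - 2 * tau) (z false) (z true) (z' c') (z' (~~ c')))).
  by ring.
by rewrite e1; ring.
Qed.

Definition pairing_sum (z A B T : bool -> K) :=
  \sum_(c : bool) A c * (kap (z c) (z (~~ c)) * T c) * B c.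

(** The entry coef of the exchange operator is diagonal, and its other entry makes
    kap (z c) (z (~~ c)) * kap (z (~~ c)) (z c), which is symmetric in the two
    variables. *)
Lemma exch_self_adjoint V q z A A' G :
  exch V q z A A' ->
  th (V - 2 * tau) * \sum_c kap (z c) (z (~~ c)) * A' c * G c =
  q * \sum_c kap (z c) (z (~~ c)) * A c *
    (coef V (z c) (z (~~ c)) * G c + th V * kap (z (~~ c)) (z c) * G (~~ c)).
Proof.
move=> h; have h1 := h true; have h2 := h false; rewrite !big_bool /= in h1 h2 *.
transitivity (kap (z true) (z false) * (th (V - 2 * tau) * A' true) * G true +
  kap (z false) (z true) * (th (V - 2 * tau) * A' false) * G false).
  by ring.
by rewrite h1 h2; ring.
Qed.

(** One exchange suffices here, because the function B on the other side of nu is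
    symmetric. *)
Lemma exchange_same V q r z A A' B :
  generic2 z -> th (V - 2 * tau) != 0 -> exch V q z A A' ->
  (forall c, B c = B (~~ c)) ->
  pairing_sum z A' B (fun c => th (z c + r) * th (z (~~ c) + r + V - 2 * tau)) =
  q * pairing_sum z A B (fun c => th (z c + r + V) * th (z (~~ c) + r - 2 * tau)).
Proof.
move=> g nV h hB; apply: (mulfI nV).
pose G c := B c * (th (z c + r) * th (z (~~ c) + r + V - 2 * tau)).
have := exch_self_adjoint G h; rewrite /pairing_sum.
have -> : \sum_c kap (z c) (z (~~ c)) * A' c * G c =
  \sum_c A' c * (kap (z c) (z (~~ c)) *
    (th (z c + r) * th (z (~~ c) + r + V - 2 * tau))) * B c.
  by apply: eq_bigr => c _; rewrite /G; ring.
move=> ->; rewrite mulrCA; congr (_ * _); rewrite mulr_sumr.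
apply: eq_bigr => c _; rewrite /G negbK -hB.
transitivity (A c * kap (z c) (z (~~ c)) * B c *
  (th (V - 2 * tau) * (th (z c + r + V) * th (z (~~ c) + r - 2 * tau)))).
  by rewrite (top_same V r (generic2E c g)); ring.
by ring.
Qed.

(** Both sides of nu are exchanged.  The sums for (A, B) and for (A', B') are
    compared with an exchanged form of each, in which only A and B' occur;
    the difference of the two is governed by top_exch. *)
Lemma exchange_pair V W qA qB r z A A' B B' :
  generic2 z -> th V != 0 -> th (W - 2 * tau) != 0 -> qA != 0 ->
  exch V qA z A A' -> exch W qB z B' B ->
  pairing_sum z A B (fun c => th (z c + r - W) * th (z (~~ c) + r - V)) =
  th (V - 2 * tau) * th W * qA^-1 * qB / (th V * th (W - 2 * tau)) *
  pairing_sum z A' B' (fun c => th (z c + r - V) * th (z (~~ c) + r - W)) +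
  th (- (2 * tau)) * qB * th (W - V) / (th (- V) * th (W - 2 * tau)) *
  pairing_sum z A B' (fun c => th (z c + r) * th (z (~~ c) + r - V - W)).
Proof.
move=> g nV nW nq hA hB.
have sV : s V != 0 by rewrite -th_neq0.
have nNV : th (- V) != 0 by rewrite th_neq0 sN oppr_eq0.
pose G1 c := A c * (th (z c + r - W) * th (z (~~ c) + r - V)).
pose G2 c := B' c * (th (z c + r - V) * th (z (~~ c) + r - W)).
have e1 := exch_self_adjoint G1 hB; have e2 := exch_self_adjoint G2 hA.
have E1 : \sum_c kap (z c) (z (~~ c)) * B c * G1 c =
  pairing_sum z A B (fun c => th (z c + r - W) * th (z (~~ c) + r - V)).
  by apply: eq_bigr => c _; rewrite /G1; ring.
have E2 : \sum_c kap (z c) (z (~~ c)) * A' c * G2 c =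
  pairing_sum z A' B' (fun c => th (z c + r - V) * th (z (~~ c) + r - W)).
  by apply: eq_bigr => c _; rewrite /G2; ring.
rewrite E1 in e1; rewrite E2 in e2; apply: (mulfI nW); rewrite e1.
transitivity (qB / th V * (th W / qA * (th (V - 2 * tau) *
    pairing_sum z A' B' (fun c => th (z c + r - V) * th (z (~~ c) + r - W))) +
  th V * (th (- (2 * tau)) * th (W - V) / th (- V)) *
  pairing_sum z A B' (fun c => th (z c + r) * th (z (~~ c) + r - V - W))));
  last by field; rewrite nV nNV nW nq.
rewrite e2 -[qB in LHS](divfK nV) -[LHS]mulrA; congr (_ * _).
rewrite /pairing_sum /G1 /G2 !big_bool /=.
have t1 := top_exch W r (generic2E true g) sV.
have t2 := top_exch W r (generic2E false g) sV; simpl in *.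
transitivity (kap (z true) (z false) * A true * B' true *
   (th V * coef W (z true) (z false) *
     (th (z true + r - W) * th (z false + r - V))) +
   kap (z false) (z true) * A false * B' false *
   (th V * coef W (z false) (z true) *
     (th (z false + r - W) * th (z true + r - V))) +
   th V * th W * kap (z true) (z false) * kap (z false) (z true) *
   (B' true * A false * (th (z false + r - W) * th (z true + r - V)) +
    B' false * A true * (th (z true + r - W) * th (z false + r - V)))).
  by ring.
by rewrite t1 t2; field; rewrite nNV nq.
Qed.

Variables (Q : nat -> K) (zz : nat -> bool -> K) (mu : K -> K) (kappa : K).
Hypothesis mu_shift : forall a, mu (a + 2 * tau) = mu a * kappa.
Hypothesis kappa_neq0 : kappa != 0.

(** Two chains start at the nodes m1 and m2 and run upwards.  The node k carries a
    first variable zz k false as soon as one chain is present and a second one,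
    zz k true, when both are; the bit c of a configuration tells which one belongs
    to the first chain, or to the only one present. *)
Definition both m1 m2 k := ((m1 <= k) && (m2 <= k))%N.
Definition snd_var m1 k c := zz k (if (m1 <= k)%N then ~~ c else c).
(** Q is the sequence of partial sums of the parameters u, so that par1 is the
    parameter of an edge of the first factor of a product.  For the second factor
    the parameters u are shifted by multiples of the pairings with the first
    segment; up to the sign, the partial sums of these pairings are the difference of
    the two truth values in par2. *)
Definition par1 m k := Q k.+1 - Q m - tau.
Definition par2 m1 m k :=
  Q k.+1 - Q m - tau + 2 * tau * ((k.+1 == m1)%:R - (m1 == m)%:R).

(** The first factor forbids the second variable at nodes that carry only one. *)
Definition node_weight m1 m2 k c :=
  (c ==> both m1 m2 k)%:R * (if both m1 m2 k then kap (zz k c) (zz k (~~ c)) else 1).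

(** The factor mu is trivial below nu; above nu it is the exponential that redgeE
    introduces. *)
Definition edge_weight m1 m2 k c d :=
  (if (m1 <= k)%N then mu (par1 m1 k) * edge (par1 m1 k) (zz k c) (zz k.+1 d)
   else 1) *
  (if (m2 <= k)%N then mu (par2 m1 m2 k) *
     edge (par2 m1 m2 k) (snd_var m1 k c) (snd_var m1 k.+1 d) else 1) *
  (if ((m1 <= k) && (m2 <= k.+1))%N then ker (zz k c) (snd_var m1 k.+1 d) else 1) *
  (if ((m1 <= k.+1) && (m2 <= k))%N then ker (zz k.+1 d) (snd_var m1 k c) else 1).

Definition chain m1 m2 := lsum (node_weight m1 m2) (edge_weight m1 m2).

Definition present m1 m2 k (c : bool) :=
  ((m1 <= k) || (m2 <= k))%N && (c ==> both m1 m2 k).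

Definition separated m1 m2 n := forall k k' c c', (k <= n)%N -> (k' <= n)%N ->
  present m1 m2 k c -> present m1 m2 k' c' -> (k, c) != (k', c') ->
  s (zz k c - zz k' c') != 0.

Lemma separatedC m1 m2 n : separated m1 m2 n -> separated m2 m1 n.
Proof.
move=> h k k' c c' kn kn'; rewrite /present /both ![(m2 <= _)%N || _]orbC.
by rewrite ![(m2 <= _)%N && _]andbC; exact: h.
Qed.

Lemma chain_step m1 m2 k c : both m1 m2 k ->
  chain m1 m2 k.+1 c =
  pstep (par1 m1 k) (par2 m1 m2 k) (mu (par1 m1 k) * mu (par2 m1 m2 k))
    (zz k) (zz k.+1) (chain m1 m2 k) c.
Proof.
move=> hb; have /andP[h1 h2] := hb.
rewrite /chain /= /pstep; apply: eq_bigr => d _.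
rewrite /node_weight hb implybT mul1r; congr (_ * _).
rewrite /edge_weight /snd_var h1 h2 !(leqW h1, leqW h2) /= /pairw; ring.
Qed.

Lemma chain_single m1 m2 k c : ~~ both m1 m2 k ->
  chain m1 m2 k.+1 c = chain m1 m2 k false * edge_weight m1 m2 k false c.
Proof.
move=> hb; rewrite /chain /= big_bool /= /node_weight (negbTE hb) /=.
by rewrite mul0r mulr0 mul0r add0r !mulr1.
Qed.

(** Up to the start m2 of the second chain only one chain is present, so that the
    order of the two does not matter; the parameter of the last edge before m2 is
    not concerned, as it belongs to the step from m2.-1 to m2. *)
Lemma chain_singleC m1 m2 k : (m1 < m2)%N -> (k < m2)%N ->
  chain m2 m1 k false = chain m1 m2 k false.
Proof.
move=> m12; elim: k => // k IH km.
have kb : both m1 m2 k = false by rewrite /both [(m2 <= k)%N]leqNgt (ltnW km) andbF.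
have kb' : both m2 m1 k = false by rewrite /both andbC.
rewrite !chain_single ?kb ?kb' // (IH (ltnW km)); congr (_ * _).
rewrite /edge_weight /snd_var /par1 /par2 ![(m2 <= _)%N]leqNgt km (ltnW km) /=.
rewrite !andbF /= !mulr1 !mul1r.
case: leqP => // h.
by rewrite (ltn_eqF km) (gtn_eqF m12) subrr mulr0 addr0.
Qed.

Lemma par_diff m1 m2 k : both m1 m2 k -> m1 != m2 ->
  [/\ par2 m1 m2 k = par1 m2 k, par2 m2 m1 k = par1 m1 k &
      Q m2 - Q m1 = par1 m1 k - par1 m2 k].
Proof.
move=> /andP[h1 h2] ne; rewrite /par1 /par2 ![_.+1 == _]gtn_eqF //.
rewrite [m2 == m1]eq_sym (negbTE ne) subrr mulr0 !addr0; split=> //; ring.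
Qed.

(** The two orders at the first node with both chains, by base_lt and base_gt.  The
    factor kappa enters through the edge of the chain m1 that leads to this node,
    the only one whose parameter depends on the order. *)
Lemma chain_base m1 m2 : (m1 < m2)%N -> separated m1 m2 m2 ->
  exch (Q m2 - Q m1) (e (2 * tau) * kappa) (zz m2)
    (chain m1 m2 m2) (chain m2 m1 m2) /\
  exch (Q m1 - Q m2) (e (- (2 * tau)) / kappa) (zz m2)
    (chain m2 m1 m2) (chain m1 m2 m2).
Proof.
case: m2 => // n; rewrite ltnS => m1n hs.
set V := Q n.+1 - Q m1.
have nb : ~~ both m1 n.+1 n by rewrite /both ltnn andbF.
have nb' : ~~ both n.+1 m1 n by rewrite /both ltnn.
set C := chain m1 n.+1 n false.
have CE : chain n.+1 m1 n false = C by apply: chain_singleC.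
have mV : mu (V + tau) = mu (V - tau) * kappa by rewrite -mu_shift; congr mu; ring.
have e12 c : chain m1 n.+1 n.+1 c = C * mu (V - tau) *
    (edge (V - tau) (zz n false) (zz n.+1 c) * ker (zz n false) (zz n.+1 (~~ c))).
  rewrite chain_single // -/C /edge_weight /snd_var /par1 m1n ltnn leqnn (leqW m1n) /=.
  by rewrite !mulr1; ring.
have e21 c : chain n.+1 m1 n.+1 c = C * mu (V - tau) * kappa *
    (edge (V + tau) (zz n false) (zz n.+1 (~~ c)) * ker (zz n.+1 c) (zz n false)).
  rewrite chain_single // CE /edge_weight /snd_var /par2 m1n ltnn leqnn (leqW m1n) /=.
  rewrite eqxx gtn_eqF ?ltnS // !(subr0, mulr1, mul1r) -/V.
  rewrite (_ : V - tau + 2 * tau = V + tau); last by ring.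
  by rewrite mV; ring.
have pt : present m1 n.+1 n false by rewrite /present m1n.
have pc c : present m1 n.+1 n.+1 c.
  by rewrite /present /both leqnn (leqW m1n) implybT.
have g0 c : s (zz n.+1 c - zz n.+1 (~~ c)) != 0.
  by apply: hs => //; rewrite xpair_eqE negb_and; case: c; rewrite orbT.
have gt c : s (zz n false - zz n.+1 c) != 0.
  by apply: hs => //; rewrite xpair_eqE ltn_eqF.
split=> c; rewrite !e12 !e21 negbK.
  have := base_lt V (g0 c) (gt c) (gt (~~ c)) => h.
  transitivity (C * mu (V - tau) * kappa * (th (V - 2 * tau) *
   (edge (V + tau) (zz n false) (zz n.+1 (~~ c)) * ker (zz n.+1 c) (zz n false)))).
    by ring.
  by rewrite h; ring.
have eV : Q m1 - Q n.+1 = - V by rewrite opprB.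
have := base_gt (- V) (g0 c) (gt c) (gt (~~ c)).
rewrite opprK eV => h.
transitivity (C * mu (V - tau) * (th (- V - 2 * tau) *
   (edge (V - tau) (zz n false) (zz n.+1 c) * ker (zz n false) (zz n.+1 (~~ c))))).
  by ring.
by rewrite h; field.
Qed.

Lemma separated_le m1 m2 n n' : (n' <= n)%N -> separated m1 m2 n -> separated m1 m2 n'.
Proof. by move=> h hs k k' c c' h1 h2; apply: hs; apply: leq_trans h. Qed.

Lemma separated_generic m1 m2 n k : separated m1 m2 n -> both m1 m2 k -> (k <= n)%N ->
  generic2 (zz k) /\ ((k < n)%N -> generic4 (zz k) (zz k.+1)).
Proof.
move=> hs hb kn; have /andP[h1 h2] := hb.
have p c : present m1 m2 k c by rewrite /present hb h1 implybT.
split=> [|kn' c c']; first by apply: hs => //; rewrite xpair_eqE andbF.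
apply: hs => //; last by rewrite xpair_eqE ltn_eqF.
by rewrite /present /both (leqW h1) (leqW h2) implybT.
Qed.

Lemma chain_exch_from m1 m2 q n n0 : m1 != m2 -> both m1 m2 n0 -> (n0 <= n)%N ->
  separated m1 m2 n ->
  exch (Q m2 - Q m1) q (zz n0) (chain m1 m2 n0) (chain m2 m1 n0) ->
  exch (Q m2 - Q m1) q (zz n) (chain m1 m2 n) (chain m2 m1 n).
Proof.
move=> ne hb /subnKC <-; elim: (n - n0)%N => [|r IH]; first by rewrite addn0.
rewrite addnS => hs h0.
have hk : both m1 m2 (n0 + r)%N.
  by case/andP: hb => h1 h2; rewrite /both !(leq_trans _ (leq_addr _ _)).
have hk' : both m2 m1 (n0 + r)%N by rewrite /both andbC.
have hk1 : both m1 m2 (n0 + r).+1.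
  by case/andP: hk => h1 h2; rewrite /both !leqW.
have hr := IH (separated_le (leqnSn _) hs) h0.
have [p1 p2 p3] := par_diff hk ne.
have [g1 /(_ (ltnSn _)) g3] := separated_generic hs hk (leqnSn _).
have [g2 _] := separated_generic hs hk1 (leqnn _).
have := exch_step (mu (par1 m1 (n0 + r)) * mu (par1 m2 (n0 + r)))
  p3 g1 g2 g3 hr.
move=> h c; rewrite !(chain_step _ hk) !(chain_step _ hk') p1 p2.
by rewrite [mu (par1 m2 _) * _]mulrC; exact: h.
Qed.

Lemma chain_exch m1 m2 n : m1 != m2 -> (m1 <= n)%N -> (m2 <= n)%N ->
  separated m1 m2 n ->
  exch (Q m2 - Q m1)
    (if (m1 < m2)%N then e (2 * tau) * kappa else e (- (2 * tau)) / kappa) (zz n)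
    (chain m1 m2 n) (chain m2 m1 n).
Proof.
move=> ne h1 h2 hs; case: ltngtP (ne) => // m12 _.
  have [hl _] := chain_base m12 (separated_le h2 hs).
  by apply: chain_exch_from hl => //; rewrite /both leqnn ltnW.
have [_ hg] := chain_base m12 (separated_le h1 (separatedC hs)).
by apply: chain_exch_from hg => //; rewrite /both leqnn ltnW.
Qed.

(** With equal starting nodes both variables of the first node enter symmetrically,
    and pair_symm preserves the symmetry along the chain. *)
Lemma chain_symm m n : (m <= n)%N -> separated m m n ->
  forall c, chain m m n c = chain m m n (~~ c).
Proof.
move=> /subnKC <-; elim: (n - m)%N => [_ c|r IH].
  rewrite addn0; case: m => // k.
  have nb : ~~ both k.+1 k.+1 k by rewrite /both ltnn.
  by rewrite !chain_single // /edge_weight !ltnn /= !andbF.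
rewrite addnS => hs c.
have hk : both m m (m + r)%N by rewrite /both leq_addr.
have hk1 : both m m (m + r).+1 by rewrite /both leqW // leq_addr.
have [g1 /(_ (ltnSn _)) g3] := separated_generic hs hk (leqnSn _).
have [g2 _] := separated_generic hs hk1 (leqnn _).
have hr := IH (separated_le (leqnSn _) hs).
have p : par2 m m (m + r) = par1 m (m + r) - 2 * tau.
  rewrite /par2 /par1 eqxx gtn_eqF ?ltnS ?leq_addr //; rewrite sub0r /=; ring.
rewrite !(chain_step _ hk) p.
exact: (symm_step _ _ g1 g2 g3 hr).
Qed.

End Elliptic.

(** * Series indexed by the integers *)
Section Modulus.
Context {R : realType}.
Implicit Types z : R[i].

(** The norm of R[i] takes its values in R[i]; for estimates it is more convenient
    to have them in R. *)
Definition nm z : R := complex.Re `|z|.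

Lemma nmE z : `|z| = (nm z)%:C.
Proof. by rewrite /nm normc_def. Qed.

Lemma nm_ge0 z : 0 <= nm z.
Proof. by rewrite -ler0c -nmE. Qed.

Lemma nm_le z (x : R) : (`|z| <= x%:C) = (nm z <= x).
Proof. by rewrite nmE lecR. Qed.

Lemma nmD y z : nm (y + z) <= nm y + nm z.
Proof. by rewrite -nm_le rmorphD /= -!nmE ler_normD. Qed.

Lemma nmM y z : nm (y * z) = nm y * nm z.
Proof. by apply: complexI; rewrite rmorphM /= -!nmE normrM. Qed.

Lemma nmN z : nm (- z) = nm z.
Proof. by rewrite /nm normrN. Qed.

Lemma nmB y z : nm (y - z) <= nm y + nm z.
Proof. by rewrite -(nmN z) nmD. Qed.

Lemma nm0 : nm 0 = 0.
Proof. by rewrite /nm normr0. Qed.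

Lemma nm1 : nm 1 = 1.
Proof. by rewrite /nm normr1. Qed.

Lemma nmX z n : nm (z ^+ n) = nm z ^+ n.
Proof. by elim: n => [|n IH]; rewrite ?nm1 // !exprS nmM IH. Qed.

Lemma nm_eq0 z : (nm z == 0) = (z == 0).
Proof. by rewrite -(inj_eq (@complexI R)) -nmE normr_eq0. Qed.

Lemma nm_real (x : R) : nm x%:C = `|x|.
Proof. by rewrite /nm normc_def /= expr0n addr0 sqrtr_sqr. Qed.

Lemma nm_Re z : `|complex.Re z| <= nm z.
Proof. by rewrite -lecR -nmE normc_ge_Re. Qed.

Lemma nm_i : nm 'i = 1.
Proof. by rewrite /nm normc_def /= expr0n add0r expr1n sqrtr1. Qed.

Lemma nm_Im z : `|complex.Im z| <= nm z.
Proof.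
have -> : nm z = nm ('i * z) by rewrite nmM nm_i mul1r.
by apply: le_trans (nm_Re _); case: z => a b /=; rewrite !(mul0r, mul1r, sub0r) normrN.
Qed.

Lemma nm_le_ReIm z : nm z <= `|complex.Re z| + `|complex.Im z|.
Proof.
rewrite {1}(complexE z); apply: le_trans (nmD _ _) _.
by rewrite nmM nm_i mul1r !nm_real.
Qed.

Lemma nm_sum I (r : seq I) (F : I -> R[i]) :
  nm (\sum_(i <- r) F i) <= \sum_(i <- r) nm (F i).
Proof.
elim/big_rec2 : _ => [|i x y _ h]; first by rewrite nm0.
by apply: le_trans (nmD _ _) _; rewrite lerD2l.
Qed.

Lemma nmV z : nm z^-1 = (nm z)^-1.
Proof. by apply: complexI; rewrite fmorphV /= -!nmE normfV. Qed.

(** Identities between sums of series are obtained through this criterion: both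
    sides are compared with finite sums up to a geometric error. *)
Lemma nm_half_eq0 z (c : R) : (forall n : nat, nm z <= c * 2^-1 ^+ n) -> z = 0.
Proof.
move=> h; apply/eqP; rewrite -nm_eq0 eq_le nm_ge0 andbT leNgt; apply/negP => z0.
have [n hn] : exists n : nat, c * 2^-1 ^+ n < nm z.
  have c0 : 0 <= c.
    by apply: le_trans (nm_ge0 z) _; have := h 0%N; rewrite expr0 mulr1.
  have /archi_boundP : 0 <= c / nm z by rewrite divr_ge0 // ltW.
  set n := Num.bound _ => hn; exists n.
  rewrite exprVn ltr_pdivrMr ?exprn_gt0 // mulrC -ltr_pdivrMr //.
  apply: lt_le_trans hn _; rewrite -natrX ler_nat.
  by rewrite ltnW // ltn_expl.
by have := h n; rewrite leNgt hn.
Qed.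

End Modulus.

Section IntSeries.
Local Open Scope classical_set_scope.
Local Open Scope ring_scope.
Context {R : realType}.
Implicit Types (f g : int -> R[i]) (c : R).
Notation half := (2^-1 : R).

Definition psum f N : R[i] := \sum_(0 <= i < N) (f (Posz i) + f (Negz i)).

(** This is the form in which the series of theta is summed. *)
Definition zsum f : R[i] :=
  limn (series (fun n => f (Posz n)) : nat -> R[i]^o) +
  limn (series (fun n => f (Negz n)) : nat -> R[i]^o).

Definition geo c f := forall m, nm (f m) <= c * half ^+ `|m|%N.

Lemma half_sum (a b : nat) : \sum_(a <= i < b) half ^+ i <= 2 * half ^+ a.
Proof.
have [ab|ba] := leqP a b; last by rewrite big_geq ?mulr_ge0 ?exprn_ge0 // ltnW.
suff -> : \sum_(a <= i < b) half ^+ i = 2 * half ^+ a - 2 * half ^+ b.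
  by rewrite lerBlDr lerDl mulr_ge0 ?exprn_ge0.
rewrite -(subnKC ab); elim: (b - a)%N => [|n IH].
  by rewrite addn0 big_geq // subrr.
by rewrite addnS big_nat_recr ?leq_addr //= IH exprS; field.
Qed.

(** The convergence is reduced to that of the real and imaginary parts, which are
    dominated by a geometric series. *)
Lemma cvg_half_series (u : nat -> R[i]) c :
  (forall n, nm (u n) <= c * half ^+ n) ->
  exists L : R[i], limn (series u : nat -> R[i]^o) = L /\
    forall n, nm (L - \sum_(0 <= i < n) u i) <= 2 * c * half ^+ n.
Proof.
move=> hu.
have c0 : 0 <= c by have := hu 0%N; rewrite expr0 mulr1; apply: le_trans (nm_ge0 _).
have cv (p : R[i] -> R) : (forall z, `|p z| <= nm z) -> cvgn (series (p \o u)).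
  move=> hp; apply: normed_cvg; apply: (@series_le_cvg _ _ (geometric c half)).
  - by move=> n; rewrite /= normr_ge0.
  - by move=> n; rewrite /= mulr_ge0 // exprn_ge0.
  - by move=> n; rewrite /= (le_trans (hp _)).
  - by apply: is_cvg_geometric_series; rewrite ger0_norm // invf_lt1 // ltr1n.
have cvR := cv _ nm_Re; have cvI := cv _ nm_Im.
pose L := limn (series (@complex.Re R \o u)) +i* limn (series (@complex.Im R \o u)).
have ReS n : complex.Re (\sum_(0 <= i < n) u i) = \sum_(0 <= i < n) complex.Re (u i).
  elim: n => [|n IH]; first by rewrite !big_geq.
  by rewrite !big_nat_recr //= -IH raddfD.
have ImS n : complex.Im (\sum_(0 <= i < n) u i) = \sum_(0 <= i < n) complex.Im (u i).
  elim: n => [|n IH]; first by rewrite !big_geq.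
  by rewrite !big_nat_recr //= -IH raddfD.
have near_L (e : R) : 0 < e ->
    \forall n \near \oo, nm (L - \sum_(0 <= i < n) u i) <= e.
  move=> e0; have e2 : 0 < e / 2 by rewrite divr_gt0.
  have /cvgrPdist_le /(_ _ e2) hR := cvR.
  have /cvgrPdist_le /(_ _ e2) hI := cvI.
  near=> n; apply: le_trans (nm_le_ReIm _) _.
  rewrite [e]splitr; apply: lerD.
    rewrite raddfB /= ReS; near: n; exact: hR.
  rewrite raddfB /= ImS; near: n; exact: hI.
exists L; split.
  apply/cvg_lim => //; apply/cvgrPdist_le => e e0.
  have eE : e = (complex.Re e)%:C by rewrite RRe_real // gtr0_real.
  have e0' : 0 < complex.Re e by rewrite -ltcR -eE.
  have := near_L _ e0'; apply: filterS => n.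
  by rewrite -nm_le -eE.
move=> n; apply/ler_addgt0Pr => e e0.
have [m [nm1 hm]] : exists m, (n <= m)%N /\ nm (L - \sum_(0 <= i < m) u i) <= e.
  have [m _ h] := near_L _ e0; exists (maxn n m); split; first exact: leq_maxl.
  by apply: h; rewrite /= leq_maxr.
have -> : L - \sum_(0 <= i < n) u i = \sum_(n <= i < m) u i + (L - \sum_(0 <= i < m) u i).
  by rewrite (@big_cat_nat _ _ _ n 0 m) //=; ring.
apply: le_trans (nmD _ _) _; apply: lerD => //.
apply: le_trans (nm_sum _ _) _.
apply: (@le_trans _ _ (\sum_(n <= i < m) c * half ^+ i)); first exact: ler_sum.
by rewrite -mulr_sumr (mulrC 2) -mulrA ler_wpM2l // half_sum.
Unshelve. all: by end_near.
Qed.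

Lemma geo_ge0 c f : geo c f -> 0 <= c.
Proof. by move=> /(_ 0); rewrite expr0 mulr1; apply: le_trans (nm_ge0 _). Qed.

(** The partial sum of length N misses the indices N, N + 1, ... and - N - 1, - N - 2, ...,
    two geometric tails. *)
Lemma zsum_psum c f : geo c f ->
  forall N, nm (zsum f - psum f N) <= 4 * c * half ^+ N.
Proof.
move=> hf N; have c0 := geo_ge0 hf.
have [|L1 [e1 h1]] := @cvg_half_series (fun n => f (Posz n)) c; first by move=> n; exact: hf.
have [|L2 [e2 h2]] := @cvg_half_series (fun n => f (Negz n)) c.
  move=> n; apply: le_trans (hf _) _; rewrite ler_wpM2l // exprS.
  by rewrite ler_piMl ?exprn_ge0 // invf_le1 // ler1n.
rewrite /zsum e1 e2 /psum big_split /= opprD addrACA.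
apply: le_trans (nmD _ _) _; have := h1 N; have := h2 N.
set x := half ^+ N; lra.
Qed.

Lemma zsum_unique f S c : (exists d, geo d f) ->
  (forall N, nm (S - psum f N) <= c * half ^+ N) -> zsum f = S.
Proof.
move=> [d hd] h; apply/eqP; rewrite -subr_eq0; apply/eqP.
apply: (@nm_half_eq0 _ _ (4 * d + c)) => N.
rewrite (_ : zsum f - S = (zsum f - psum f N) - (S - psum f N)); last by ring.
apply: le_trans (nmB _ _) _; rewrite mulrDl; apply: lerD => //.
exact: zsum_psum.
Qed.

End IntSeries.

Section IntSeriesTheory.
Context {R : realType}.
Implicit Types (f g : int -> R[i]) (c : R).
Notation half := (2^-1 : R).

Definition decays f := exists c, geo c f.

Lemma half_gt0 : 0 < half. Proof. by rewrite invr_gt0. Qed.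

Lemma half_le1 : half <= 1. Proof. by rewrite invf_le1 // ler1n. Qed.

Lemma half_expS_le n : half ^+ n.+1 <= half ^+ n.
Proof. by rewrite exprS ler_piMl ?exprn_ge0 ?half_le1 // ltW ?half_gt0. Qed.

Lemma half_exp_le a b : (a <= b)%N -> half ^+ b <= half ^+ a.
Proof. by move=> ab; apply: ler_wiXn2l; rewrite ?half_le1 // ltW ?half_gt0. Qed.

Lemma psum_le c f N : geo c f -> nm (psum f N) <= 4 * c.
Proof.
move=> hf; have c0 := geo_ge0 hf; apply: le_trans (nm_sum _ _) _.
apply: (@le_trans _ _ (\sum_(0 <= i < N) (2 * c) * half ^+ i)).
  apply: ler_sum => i _; apply: le_trans (nmD _ _) _.
  have h1 := hf (Posz i); have h2 := hf (Negz i); simpl in h1, h2.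
  have : c * half ^+ i.+1 <= c * half ^+ i by rewrite ler_wpM2l // half_expS_le.
  by lra.
rewrite -mulr_sumr; have := half_sum 0 N (R := R); rewrite expr0 => h.
by have : 2 * c * \sum_(0 <= i < N) half ^+ i <= 2 * c * 2 by [rewrite ler_wpM2l ?mulr_ge0 //; lra]; lra.
Qed.

Lemma zsum_le c f : geo c f -> nm (zsum f) <= 4 * c.
Proof.
move=> /zsum_psum /(_ 0%N).
by rewrite /psum big_geq // subr0 expr0 mulr1.
Qed.

Lemma decays_lin a f g : decays f -> decays g -> decays (fun m => a * f m + g m).
Proof.
move=> [c hf] [d hg]; exists (nm a * c + d) => m.
apply: le_trans (nmD _ _) _; rewrite nmM mulrDl; apply: lerD => //.
by rewrite -mulrA ler_wpM2l ?nm_ge0.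
Qed.

Lemma zsum_lin a f g : decays f -> decays g ->
  zsum (fun m => a * f m + g m) = a * zsum f + zsum g.
Proof.
move=> df dg; have [c hf] := df; have [d hg] := dg.
apply: (@zsum_unique _ _ _ (nm a * (4 * c) + 4 * d)); first exact: decays_lin.
move=> N.
have -> : psum (fun m => a * f m + g m) N = a * psum f N + psum g N.
  by rewrite /psum mulr_sumr -big_split; apply: eq_bigr => i _ /=; ring.
rewrite (_ : _ - _ = a * (zsum f - psum f N) + (zsum g - psum g N)); last by ring.
apply: le_trans (nmD _ _) _; rewrite nmM mulrDl; apply: lerD.
  by rewrite -mulrA ler_wpM2l ?nm_ge0 //; exact: zsum_psum.
exact: zsum_psum.
Qed.

Lemma decays0 : decays (fun=> 0).
Proof. by exists 0 => m; rewrite nm0 mul0r. Qed.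

Lemma zsum0 : zsum (fun=> 0 : R[i]) = 0.
Proof.
apply: (@zsum_unique _ _ _ 0); first exact: decays0.
by move=> N; rewrite /psum big1 ?subrr ?nm0 ?mul0r // => i _; rewrite addr0.
Qed.

Lemma zsum_ext f g : f =1 g -> zsum f = zsum g.
Proof. by move=> /funext ->. Qed.

Lemma zsumM a f : decays f -> zsum (fun m => a * f m) = a * zsum f.
Proof.
move=> df; rewrite -[RHS]addr0 -zsum0 -zsum_lin //; last exact: decays0.
by apply: zsum_ext => m; rewrite addr0.
Qed.

Lemma decays_comp (p : int -> int) f k : (forall m, (`|m| <= `|p m| + k)%N) ->
  decays f -> decays (f \o p).
Proof.
move=> hp [c hf]; have c0 := geo_ge0 hf.
exists (c * 2 ^+ k) => m; apply: le_trans (hf _) _.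
rewrite -mulrA ler_wpM2l //.
have -> : half ^+ `|p m|%N = 2 ^+ k * half ^+ (`|p m| + k)%N.
  by rewrite exprD mulrCA -exprMn divff // expr1n mulr1.
by rewrite ler_wpM2l ?exprn_ge0 // half_exp_le.
Qed.

Lemma psum_shift f N :
  psum (fun m => f (m + 1)) N = psum f N + f N%:Z - f (- N%:Z).
Proof.
rewrite /psum; elim: N => [|N IH]; first by rewrite !big_geq // oppr0 addrK.
rewrite !big_nat_recr //= IH.
rewrite (_ : Negz N + 1 = - N%:Z); last by rewrite NegzE; lia.
rewrite (_ : Posz N + 1 = N.+1%:Z); last by lia.
by rewrite -NegzE; ring.
Qed.

(** The partial sums before and after the shift differ by two boundary terms. *)
Lemma zsum_shift1 f : decays f -> zsum (fun m => f (m + 1)) = zsum f.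
Proof.
move=> df; have [c hf] := df; have c0 := geo_ge0 hf.
apply: (@zsum_unique _ _ _ (6 * c)).
  by apply: (@decays_comp (fun m => m + 1) _ 1%N _ df) => m; lia.
move=> N; rewrite psum_shift.
rewrite (_ : _ - _ = (zsum f - psum f N) - (f N%:Z - f (- N%:Z))); last by ring.
apply: le_trans (nmB _ _) _.
have := zsum_psum hf N; have := nmB (f N%:Z) (f (- N%:Z)).
have := hf N%:Z; have := hf (- N%:Z); rewrite abszN /=.
set x := half ^+ N; lra.
Qed.

Lemma decays_shift k f : decays f -> decays (fun m => f (m + k)).
Proof. by apply: (@decays_comp (fun m => m + k) _ `|k|%N) => m; lia. Qed.

Lemma zsum_shift k f : decays f -> zsum (fun m => f (m + k)) = zsum f.
Proof.
have nat_shift (n : nat) g : decays g -> zsum (fun m => g (m + n%:Z)) = zsum g.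
  elim: n g => [|n IH] g dg.
    by apply: zsum_ext => m; rewrite addr0.
  rewrite -[RHS]IH // -[RHS]zsum_shift1; last exact: decays_shift.
  by apply: zsum_ext => m; congr g; lia.
move=> df; case: (intP k) => [|n|n]; first exact: (nat_shift 0%N).
  exact: nat_shift.
rewrite -(nat_shift n.+1); last exact: decays_shift.
by apply: zsum_ext => m; congr f; lia.
Qed.

Lemma decays_opp k f : decays f -> decays (fun m => f (k - m)).
Proof. by apply: (@decays_comp (fun m => k - m) _ `|k|%N) => m; lia. Qed.

Lemma zsum_opp k f : decays f -> zsum (fun m => f (k - m)) = zsum f.
Proof.
move=> df.
(* The reflection m |-> - 1 - m preserves the partial sums, as these run over the
   indices from - N to N - 1. *)
rewrite -(zsum_shift (k + 1)); last exact: decays_opp.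
have -> : (fun m => f (k - (m + (k + 1)))) = (fun m => f (- 1 - m)).
  by apply/funext => m; congr f; lia.
have [c hf] := df.
apply: (@zsum_unique _ _ _ (4 * c)); first exact: decays_opp.
move=> N; rewrite (_ : psum _ N = psum f N); first exact: zsum_psum.
apply: eq_bigr => i _; rewrite addrC; congr (f _ + f _); lia.
Qed.

Lemma zsum_even_odd f : decays f ->
  zsum f = zsum (fun m => f (2 * m)) + zsum (fun m => f (2 * m + 1)).
Proof.
move=> df; have d0 : decays (fun m => f (2 * m)).
  by apply: (@decays_comp (fun m => 2 * m) _ 0%N _ df) => m; lia.
have d1 : decays (fun m => f (2 * m + 1)).
  by apply: (@decays_comp (fun m => 2 * m + 1) _ 1%N _ df) => m; lia.
have [c hc] := df; have [c0 h0] := d0; have [c1 h1] := d1.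
apply/eqP; rewrite -subr_eq0; apply/eqP.
apply: (@nm_half_eq0 _ _ (4 * c + 4 * c0 + 4 * c1)) => N.
have e : psum f (2 * N) =
    psum (fun m => f (2 * m)) N + psum (fun m => f (2 * m + 1)) N.
  rewrite /psum; elim: N => [|N IH]; first by rewrite !big_geq // addr0.
  rewrite mulnS !addSn add0n !big_nat_recr //= IH.
  rewrite (_ : 2 * Negz N = Negz (2 * N).+1); last by lia.
  rewrite (_ : Negz (2 * N).+1 + 1 = Negz (2 * N)); last by lia.
  rewrite (_ : 2 * Posz N = Posz (2 * N)); last by lia.
  rewrite (_ : Posz (2 * N) + 1 = Posz (2 * N).+1); last by lia.
  by ring.
rewrite (_ : _ - _ = (zsum f - psum f (2 * N)) -
    (zsum (fun m => f (2 * m)) - psum (fun m => f (2 * m)) N) -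
    (zsum (fun m => f (2 * m + 1)) - psum (fun m => f (2 * m + 1)) N));
  last by rewrite e; ring.
apply: le_trans (nmB _ _) _; rewrite mulrDl; apply: lerD; last exact: zsum_psum.
apply: le_trans (nmB _ _) _; rewrite mulrDl; apply: lerD; last exact: zsum_psum.
apply: le_trans (zsum_psum hc _) _; rewrite ler_wpM2l //.
  by rewrite mulr_ge0 // (geo_ge0 hc).
by rewrite half_exp_le // leq_pmull.
Qed.

(** Both iterated sums are approximated by the same sums over squares. *)
Lemma zsum_fubini c (F : int -> int -> R[i]) :
  (forall m n, nm (F m n) <= c * half ^+ `|m|%N * half ^+ `|n|%N) ->
  zsum (fun m => zsum (F m)) = zsum (fun n => zsum (F^~ n)).
Proof.
have key (G : int -> int -> R[i]) :
    (forall m n, nm (G m n) <= c * half ^+ `|m|%N * half ^+ `|n|%N) ->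
    forall N, nm (zsum (fun m => zsum (G m)) - psum (fun m => psum (G m) N) N)
      <= (32 * c) * half ^+ N.
  move=> hG N; have gr : geo (4 * c) (fun m => zsum (G m)).
    by move=> m; rewrite -mulrA; apply: zsum_le => n; exact: hG.
  rewrite (_ : _ - _ = (zsum (fun m => zsum (G m)) - psum (fun m => zsum (G m)) N)
    + psum (fun m => zsum (G m) - psum (G m) N) N); last first.
    suff -> : psum (fun m => zsum (G m) - psum (G m) N) N =
      psum (fun m => zsum (G m)) N - psum (fun m => psum (G m) N) N by ring.
    by rewrite [LHS]/psum [X in _ = X - _]/psum [X in _ = _ - X]/psum -sumrB;
      apply: eq_bigr => i _; ring.
  apply: le_trans (nmD _ _) _; have := zsum_psum gr N.
  have : nm (psum (fun m => zsum (G m) - psum (G m) N) N) <= 4 * (4 * c * half ^+ N).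
    apply: psum_le => m.
    have := @zsum_psum _ (c * half ^+ `|m|%N) (G m) (hG m) N.
    by rewrite -!mulrA [half ^+ N * _]mulrC.
  by set x := half ^+ N; lra.
move=> hF; apply/eqP; rewrite -subr_eq0; apply/eqP.
apply: (@nm_half_eq0 _ _ (64 * c)) => N.
have h1 := key _ hF N.
have h2 := key (fun n m => F m n) (fun n m => le_trans (hF m n) _) N.
have e : psum (fun m => psum (F m) N) N = psum (fun n => psum (F^~ n) N) N.
  rewrite /psum; under eq_bigr do rewrite -big_split /=.
  rewrite exchange_big /=; apply: eq_bigr => j _.
  by rewrite -big_split; apply: eq_bigr => i _ /=; ring.
set a := zsum _ in h1 *; set b := zsum _ in h2 *; rewrite e in h1.
set p := psum _ _ in h1 h2.
rewrite (_ : a - b = (a - p) - (b - p)); last by ring.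
apply: le_trans (nmB _ _) _.
have {}h2 := h2 _; move: h1 h2; set x := half ^+ N => h1 h2.
have {}h2 : nm (b - p) <= 32 * c * x.
  by apply: h2 => m n; rewrite -!mulrA [half ^+ `|n|%N * _]mulrC.
by lra.
Qed.

(** The double sum is split according to the parity of the sum s of the two indices:
    they are m + k and k - m for s = 2 * k, and m + k + 1 and k - m for
    s = 2 * k + 1. *)
Lemma zsum_mul c f g :
  (forall m, nm (f m) <= c * half ^+ `|m|%N ^+ 2) ->
  (forall m, nm (g m) <= c * half ^+ `|m|%N ^+ 2) ->
  zsum f * zsum g =
  zsum (fun k => zsum (fun m => f (m + k) * g (k - m))) +
  zsum (fun k => zsum (fun m => f (m + k + 1) * g (k - m))).
Proof.
move=> hf hg.
have c0 : 0 <= c.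
  by have := hf 0; rewrite expr0 expr1n mulr1; apply: le_trans (nm_ge0 _).
have dec h : (forall m, nm (h m) <= c * half ^+ `|m|%N ^+ 2) -> decays h.
  move=> hh; exists c => m; apply: le_trans (hh m) _.
  by rewrite ler_wpM2l // expr2 ler_piMl ?exprn_ge0 ?exprn_ile1 ?half_le1 // ltW ?half_gt0.
have df := dec _ hf; have dg := dec _ hg.
pose F m s := f m * g (s - m).
have hF m s : nm (F m s) <= c ^+ 2 * half ^+ `|m|%N * half ^+ `|s|%N.
  rewrite nmM; apply: le_trans (ler_pM (nm_ge0 _) (nm_ge0 _) (hf _) (hg _)) _.
  rewrite mulrACA -expr2 -mulrA ler_wpM2l ?exprn_ge0 // -!exprM -!exprD.
  by apply: half_exp_le; lia.
transitivity (zsum (fun m => zsum (F m))).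
  rewrite mulrC -zsumM //; apply: zsum_ext => m.
  rewrite /F zsumM; first by rewrite zsum_shift // mulrC.
  exact: decays_shift.
rewrite (zsum_fubini hF) zsum_even_odd; last first.
  exists (4 * c ^+ 2) => s; rewrite -mulrA; apply: zsum_le => m.
  by rewrite mulrAC; exact: hF.
have dF s : decays (F^~ s).
  by exists (c ^+ 2 * half ^+ `|s|%N) => m; rewrite mulrAC; exact: hF.
congr (_ + _); apply: zsum_ext => k.
  rewrite -(zsum_shift k) //; apply: zsum_ext => m; rewrite /F.
  by congr (_ * g _); lia.
rewrite -(zsum_shift (k + 1)) //; apply: zsum_ext => m; rewrite /F.
by congr (f _ * g _); lia.
Qed.

End IntSeriesTheory.

(** * The exponential function and Fourier series *)
Section ComplexExponential.
Context {R : realType}.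
Implicit Types z : R[i].

Lemma cexpD y z : cexp (y + z) = cexp y * cexp z.
Proof.
case: y z => [a b] [c d]; rewrite /cexp /= expRD cosD sinD.
apply/eqP; rewrite eq_complex /=; apply/andP; split; apply/eqP; ring.
Qed.

Lemma cexp0 : cexp 0 = 1 :> R[i].
Proof. by rewrite /cexp /= expR0 cos0 sin0 mulr1 mulr0. Qed.

Lemma nm_cexp z : nm (cexp z) = expR (complex.Re z).
Proof.
rewrite /nm normc_def /= !exprMn -mulrDr cos2Dsin2 mulr1 sqrtr_sqr.
by rewrite ger0_norm ?expR_ge0.
Qed.

Lemma cexp_neq0 z : cexp z != 0.
Proof. by rewrite -nm_eq0 nm_cexp gt_eqF ?expR_gt0. Qed.

Lemma expR_sub1_le (x : R) : `|expR x - 1| <= `|x| * expR `|x|.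
Proof.
have h1 := expR_ge1Dx x; have h2 := expR_ge1Dx (- x).
have [x0|x0] := leP 0 x.
  have : (1 - x) * expR x <= expR (- x) * expR x by rewrite ler_wpM2r ?expR_ge0.
  rewrite -expRD addNr expR0 => e1.
  by rewrite ger0_norm ?(ger0_norm x0); lra.
rewrite ltr0_norm; last by rewrite subr_lt0 expR_lt1.
rewrite ltr0_norm //; apply: (@le_trans _ _ (- x)); first by lra.
by rewrite ler_peMr; lra.
Qed.

Lemma expR_sub1x_le (x : R) : `|expR x - 1 - x| <= `|x| ^+ 2 * expR `|x|.
Proof.
have h1 := expR_ge1Dx x; have h2 := expR_ge1Dx (- x).
have : (1 - x) * expR x <= expR (- x) * expR x by rewrite ler_wpM2r ?expR_ge0.
rewrite -expRD addNr expR0 => e1.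
rewrite ger0_norm; last by lra.
apply: (@le_trans _ _ (x * (expR x - 1))); first by lra.
apply: le_trans (ler_norm _) _; rewrite normrM expr2 -mulrA.
by rewrite ler_wpM2l // expR_sub1_le.
Qed.

Lemma norm_sin_le (y : R) : `|sin y| <= `|y|.
Proof.
wlog y0 : y / 0 < y => [h|].
  have [y0|y0|->] := ltgtP y 0; last by rewrite sin0.
    by rewrite -normrN -sinN -(normrN y) h // oppr_gt0.
  exact: h.
have [|c _] := @MVT R sin cos 0 y y0 (fun x _ => is_derive_sin x).
  by apply: continuous_subspaceT => x; exact: continuous_sin.
rewrite sin0 !subr0 => ->; rewrite normrM ler_piMl //.
exact: cos_max.
Qed.

Lemma norm_cos_sub1 (y : R) : `|cos y - 1| = 2 * sin (y / 2) ^+ 2.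
Proof.
have -> : cos y = 2 * cos (y / 2) ^+ 2 - 1.
  have := cos_mulr2n (y / 2).
  have -> : (y / 2) *+ 2 = y by rewrite -[RHS](@divfK _ 2) ?pnatr_eq0 // mulr_natr.
  by move=> ->; rewrite mulr_natl.
rewrite ler0_norm; have := cos2Dsin2 (y / 2); first by lra.
by have := sqr_ge0 (sin (y / 2)); lra.
Qed.

Lemma norm_cos_sub1_le (y : R) : `|cos y - 1| <= `|y|.
Proof.
rewrite norm_cos_sub1 -real_normK ?num_real // expr2.
have h := norm_sin_le (y / 2); have h1 := sin_max (y / 2).
move: h; rewrite normrM (ger0_norm (_ : 0 <= 2^-1)) ?invr_ge0 // => h.
have : `|sin (y / 2)| * `|sin (y / 2)| <= 1 * `|sin (y / 2)|.
  by rewrite ler_wpM2r.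
by lra.
Qed.

Lemma norm_cos_sub1_le2 (y : R) : `|cos y - 1| <= `|y| ^+ 2.
Proof.
rewrite norm_cos_sub1 -real_normK ?num_real //.
have h := norm_sin_le (y / 2).
move: h; rewrite normrM (ger0_norm (_ : 0 <= 2^-1)) ?invr_ge0 // => h.
have : `|sin (y / 2)| ^+ 2 <= (`|y| / 2) ^+ 2 by rewrite ler_pXn2r ?nnegrE ?divr_ge0.
by have := sqr_ge0 `|y|; rewrite expr_div_n; lra.
Qed.

Lemma norm_sin_subx_le (y : R) : `|sin y - y| <= `|y| ^+ 2.
Proof.
wlog y0 : y / 0 < y => [h|].
  have [y0|y0|->] := ltgtP y 0; last by rewrite sin0 subrr normr0 expr0n.
    by rewrite -normrN opprD -sinN -(normrN y) h // oppr_gt0.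
  exact: h.
have [|c hc] := @MVT R sin cos 0 y y0 (fun x _ => is_derive_sin x).
  by apply: continuous_subspaceT => x; exact: continuous_sin.
rewrite sin0 !subr0 => ->.
rewrite -{2}[y]mul1r -mulrBl normrM expr2 ler_wpM2r //.
apply: le_trans (norm_cos_sub1_le c) _.
by move: hc; rewrite in_itv /= => /andP[c0 cy]; rewrite !gtr0_norm // ltW.
Qed.

(** The bound is stated for any B that dominates z, in order that it can be used
    with a B that is explicit in the index of a Fourier series. *)
Lemma cexp_taylor1 z (B : R) : nm z <= B ->
  nm (cexp z - 1 - z) <= 4 * B ^+ 2 * expR B.
Proof.
move=> hB; have h1 := le_trans (nm_Re z) hB; have h2 := le_trans (nm_Im z) hB.
have B0 := le_trans (nm_ge0 z) hB.
case: z hB h1 h2 => x y /= hB h1 h2.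
have eB : expR `|x| <= expR B by rewrite ler_expR.
have ex : expR x <= expR B by rewrite ler_expR (le_trans _ h1) // ler_norm.
have e0 := expR_ge0 x.
have x2 : `|x| ^+ 2 <= B ^+ 2 by rewrite ler_pXn2r ?nnegrE.
have y2 : `|y| ^+ 2 <= B ^+ 2 by rewrite ler_pXn2r ?nnegrE.
have b0 : 0 <= B ^+ 2 by rewrite exprn_ge0.
have t1 : `|expR x - 1 - x| <= B ^+ 2 * expR B.
  apply: le_trans (expR_sub1x_le x) _; apply: ler_pM => //; exact: expR_ge0.
have t2 : `|expR x * (cos y - 1)| <= B ^+ 2 * expR B.
  rewrite normrM (ger0_norm e0) mulrC; apply: ler_pM => //.
  exact: le_trans (norm_cos_sub1_le2 y) _.
have t3 : `|expR x * (sin y - y)| <= B ^+ 2 * expR B.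
  rewrite normrM (ger0_norm e0) mulrC; apply: ler_pM => //.
  exact: le_trans (norm_sin_subx_le y) _.
have t4 : `|y * (expR x - 1)| <= B ^+ 2 * expR B.
  rewrite normrM expr2 -mulrA; apply: ler_pM => //.
  apply: le_trans (expR_sub1_le x) _; apply: ler_pM => //; exact: expR_ge0.
apply: le_trans (nm_le_ReIm _) _ => /=.
rewrite (_ : expR x * cos y + - 1 - x = (expR x - 1 - x) + expR x * (cos y - 1)); last by ring.
rewrite (_ : expR x * sin y + - 0 - y = expR x * (sin y - y) + y * (expR x - 1)); last by ring.
have := ler_normD (expR x - 1 - x) (expR x * (cos y - 1)).
have := ler_normD (expR x * (sin y - y)) (y * (expR x - 1)).
lra.
Qed.

Definition ee z : R[i] := cexp (twopii * z).

Lemma eeD y z : ee (y + z) = ee y * ee z.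
Proof. by rewrite /ee mulrDr cexpD. Qed.

Lemma ee0 : ee 0 = 1.
Proof. by rewrite /ee mulr0 cexp0. Qed.

Lemma ee_neq0 z : ee z != 0.
Proof. exact: cexp_neq0. Qed.

Lemma eeN z : ee (- z) = (ee z)^-1.
Proof. by apply: (mulfI (ee_neq0 z)); rewrite -eeD subrr ee0 divff ?ee_neq0. Qed.

Lemma nm_ee z : nm (ee z) = expR (- (2 * pi * complex.Im z)).
Proof. by rewrite nm_cexp; case: z => a b /=; rewrite mul0r sub0r. Qed.

Lemma nm_twopii : nm (twopii : R[i]) = 2 * pi.
Proof.
rewrite /nm normc_def /= expr0n add0r sqrtr_sqr ger0_norm //.
by rewrite mulr_ge0 // pi_ge0.
Qed.

End ComplexExponential.

Section FourierSeries.
Context {R : realType}.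
Implicit Types (c d : int -> R[i]) (z : R[i]).
Notation half := (2^-1 : R).

(** Coefficients that stay summable against every exponential m |-> ee (m * z) and
    against powers of m: this is what makes a Fourier series converge everywhere
    and allows it to be differentiated term by term. *)
Definition superdecays c :=
  forall r : nat, exists D : R, forall m, nm (c m) <= D * half ^+ (r * `|m|)%N.

Definition fourier c z := zsum (fun m => c m * ee (m%:~R * z)).

Lemma expR_le_pow2 (x : R) : exists r : nat, expR x <= 2 ^+ r.
Proof.
have /archi_boundP := expR_ge0 x; set r := Num.bound _ => h; exists r.
by apply: le_trans (ltW h) _; rewrite -natrX ler_nat ltnW // ltn_expl.
Qed.

Lemma ee_bound z : exists r : nat, forall m : int,
  nm (ee (m%:~R * z)) <= 2 ^+ (r * `|m|)%N.
Proof.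
have [r hr] := expR_le_pow2 (2 * pi * `|complex.Im z|); exists r => m.
rewrite nm_ee exprM.
have -> : complex.Im (m%:~R * z) = m%:~R * complex.Im z.
  have -> : (m%:~R : R[i]) = (m%:~R : R)%:C by rewrite rmorph_int.
  by case: z {hr} => a b /=; rewrite mul0r addr0.
apply: (@le_trans _ _ (expR (2 * pi * `|complex.Im z|) ^+ `|m|%N)); last first.
  by apply: lerXn2r; rewrite ?nnegrE ?expR_ge0 // exprn_ge0.
rewrite -expRM_natl ler_expR; apply: le_trans (ler_norm _) _.
rewrite normrN !normrM (ger0_norm (pi_ge0 R)) ger0_norm //.
by rewrite natr_absz intr_norm mulrCA.
Qed.

End FourierSeries.

(** * The three-term identity of the theta function *)
Section ThetaIdentity.
Context {R : realType}.
Implicit Types (c d : int -> R[i]) (z : R[i]).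
Notation half := (2^-1 : R).

Lemma fourier_decays c z t : superdecays c ->
  exists D : R, forall m, nm (c m * ee (m%:~R * z)) <= D * half ^+ (t * `|m|)%N.
Proof.
have [r hr] := ee_bound z => /(_ (t + r)%N) [D hD]; exists D => m.
have D0 : 0 <= D by have := hD 0; rewrite muln0 mulr1; apply: le_trans (nm_ge0 _).
rewrite nmM; apply: le_trans (ler_pM (nm_ge0 _) (nm_ge0 _) (hD m) (hr m)) _.
rewrite -mulrA ler_wpM2l // mulnDl exprD -mulrA -exprMn mulVf //.
by rewrite expr1n mulr1.
Qed.

Lemma fourier_decays1 c z : superdecays c -> decays (fun m => c m * ee (m%:~R * z)).
Proof.
by move=> /fourier_decays -/(_ z 1%N) [D h]; exists D => m; have := h m; rewrite mul1n.
Qed.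

(** The constant is the maximum over all real t of the exponent
    r * t - k * (t ^+ 2 - t), obtained by completing the square. *)
Lemma gauss_superdecays c (k : R) : 0 < k ->
  (forall m, nm (c m) <= expR (- (k * (`|m|%N%:R ^+ 2 - `|m|%N%:R)))) ->
  superdecays c.
Proof.
move=> k0 hc r; exists (expR ((k + r%:R) ^+ 2 / (4 * k))) => m.
apply: le_trans (hc m) _; set n := `|m|%N.
have hh : expR (- 1) <= half.
  by rewrite expRN lef_pV2 ?posrE ?expR_gt0 //; have := expR_ge1Dx (1 : R); lra.
apply: (@le_trans _ _ (expR ((k + r%:R) ^+ 2 / (4 * k)) * expR (- 1) ^+ (r * n)%N)).
  rewrite -expRM_natl -expRD ler_expR natrM -subr_ge0.
  set a := n%:R; set b := r%:R.
  rewrite (_ : _ - _ = (2 * k * a - (k + b)) ^+ 2 / (4 * k)); last first.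
    by field; rewrite gt_eqF.
  by rewrite divr_ge0 ?sqr_ge0 // mulr_ge0 // ltW.
by rewrite ler_wpM2l ?expR_ge0 // lerXn2r ?nnegrE ?expR_ge0 // invr_ge0.
Qed.

Lemma nm_sign (m : int) : nm ((-1) ^ m : R[i]) = 1.
Proof.
case: m => n; last rewrite NegzE -exprz_inv invrN1; rewrite -exprnP nmX nmN nm1 expr1n //.
Qed.

Variable eta : R[i].
Hypothesis eta_gt0 : 0 < complex.Im eta.

Lemma gauss_ee (s q : int -> R[i]) (x : int -> R) :
  (forall m, nm (s m) = 1) -> (forall m, q m = (x m)%:C) ->
  (forall m, (`|m|%N%:R ^+ 2 - `|m|%N%:R) / 2 <= x m) ->
  superdecays (fun m => s m * ee (q m * eta)).
Proof.
move=> hs hq hx.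
apply: (@gauss_superdecays _ (pi * complex.Im eta)); first by rewrite mulr_gt0 ?pi_gt0.
move=> m; rewrite nmM hs mul1r nm_ee hq ler_expR lerN2.
have -> : complex.Im ((x m)%:C * eta) = x m * complex.Im eta.
  by case: eta => a b /=; rewrite mul0r addr0.
have p0 : 0 < 2 * (pi * complex.Im eta) by rewrite !mulr_gt0 ?pi_gt0.
have h := hx m; rewrite -(ler_pM2l p0) in h.
rewrite (_ : 2 * pi * _ = 2 * (pi * complex.Im eta) * x m); last by ring.
by apply: le_trans h; rewrite le_eqVlt; apply/orP; left; apply/eqP; field.
Qed.

Lemma absz_sqr (m : int) : (`|m|%N%:R ^+ 2 : R) = m%:~R ^+ 2.
Proof. by rewrite natr_absz intr_norm real_normK ?num_real. Qed.

Lemma absz_ge (m : int) : m%:~R <= (`|m|%N%:R : R).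
Proof. by rewrite natr_absz ler_int ler_norm. Qed.

Lemma absz_le_sqr (m : int) : (`|m|%N%:R : R) <= `|m|%N%:R ^+ 2.
Proof. by rewrite -natrX ler_nat; case: `|m|%N => // n; rewrite -mulnn leq_pmulr. Qed.

(** Theta is the Fourier series with these coefficients, Gaussian in the index since
    eta lies in the upper half plane. *)
Definition theta_coef (m : int) : R[i] :=
  (-1) ^ m * ee ((m * (m - 1))%:~R / 2 * eta).

Lemma theta_coef_superdecays : superdecays theta_coef.
Proof.
apply: (@gauss_ee _ (fun m => (m * (m - 1))%:~R / 2) (fun m => (m * (m - 1))%:~R / 2)).
- exact: nm_sign.
- by move=> m; rewrite [RHS]rmorphM /= fmorphV /= rmorph_int rmorph_nat.
move=> m; rewrite ler_wpM2r ?invr_ge0 // rmorphM rmorphB /= absz_sqr.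
by have := absz_ge m; lra.
Qed.

Lemma theta_termE z m : theta_term eta z m = theta_coef m * ee (m%:~R * z).
Proof. by rewrite /theta_term /theta_coef -[RHS]mulrA -eeD [in RHS]addrC. Qed.

Lemma thetaE z : theta eta z = fourier theta_coef z.
Proof. by rewrite /fourier -(zsum_ext (theta_termE z)). Qed.

Lemma signz_opp1 (m : int) : (-1) ^ (1 - m) = - (-1) ^ m :> R[i].
Proof.
rewrite expfzDr ?oppr_eq0 ?oner_eq0 // expr1z mulN1r -exprz_inv invrN1 //.
Qed.

Lemma thetaN z : theta eta (- z) = - (ee (- z) * theta eta z).
Proof.
rewrite !thetaE /fourier -(zsum_opp 1); last exact/fourier_decays1/theta_coef_superdecays.
rewrite -mulNr -zsumM; last exact/fourier_decays1/theta_coef_superdecays.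
apply: zsum_ext => m; rewrite /theta_coef signz_opp1 !mulNr; congr (- _).
rewrite mulrCA -!mulrA; congr (_ * _); rewrite -!eeD; congr ee.
by rewrite !(rmorphM, rmorphB) /=; ring.
Qed.

(** The two theta functions of modulus 2 * eta, evaluated at 2 * z: the products
    theta (x + y) * theta (x - y), as functions of x, lie in their span up to
    exponentials. *)
Definition theta_even z := fourier (fun m => 1 * ee ((m * (m - 1))%:~R * eta)) (2 * z).
Definition theta_odd z := fourier (fun m => 1 * ee ((m * m)%:~R * eta)) (2 * z).

Lemma theta_even_superdecays :
  superdecays (fun m => 1 * ee ((m * (m - 1))%:~R * eta)).
Proof.
apply: (@gauss_ee _ (fun m => (m * (m - 1))%:~R) (fun m => (m * (m - 1))%:~R)).
- by move=> m; exact: nm1.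
- by move=> m; rewrite rmorph_int.
move=> m; rewrite rmorphM rmorphB /=.
by have := absz_ge m; have := absz_le_sqr m; rewrite absz_sqr; lra.
Qed.

Lemma theta_odd_superdecays : superdecays (fun m => 1 * ee ((m * m)%:~R * eta)).
Proof.
apply: (@gauss_ee _ (fun m => (m * m)%:~R) (fun m => (m * m)%:~R)).
- by move=> m; exact: nm1.
- by move=> m; rewrite rmorph_int.
move=> m; rewrite rmorphM /=; have : 0 <= `|m|%N%:R :> R by [].
by have := absz_le_sqr m; rewrite absz_sqr; lra.
Qed.

(** In the product of the two series, the terms with index sum 2 * k give the first
    product and those with index sum 2 * k + 1 the second one, whose sign is that of
    (-1) ^ (2 * k + 1). *)
Lemma theta_mul x y : theta eta (x + y) * theta eta (x - y) =
  theta_even x * theta_odd y - ee (x - y) * theta_odd x * theta_even y.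
Proof.
have dec z : exists D, forall m,
    nm (theta_coef m * ee (m%:~R * z)) <= D * half ^+ `|m|%N ^+ 2.
  have [D h] := fourier_decays z 2 theta_coef_superdecays; exists D => m.
  by rewrite -exprM mulnC.
have [D1 h1] := dec (x + y); have [D2 h2] := dec (x - y).
pose D := Num.max D1 D2.
have le z m (D' : R) : D' <= D -> nm z <= D' * half ^+ `|m|%N ^+ 2 ->
    nm z <= D * half ^+ `|m|%N ^+ 2.
  by move=> hD h; apply: le_trans h _; rewrite ler_wpM2r ?exprn_ge0 // exprn_ge0.
have sgn (k m : int) : (-1) ^ (m + k) * (-1) ^ (k - m) = 1 :> R[i].
  rewrite -expfzDr ?oppr_eq0 ?oner_eq0 // (_ : m + k + (k - m) = k * 2); last by ring.
  by rewrite mulrC -exprz_exp -exprnP sqrrN expr1n exp1rz.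
have dE := theta_even_superdecays; have dO := theta_odd_superdecays.
rewrite !thetaE /fourier (@zsum_mul _ D); last first.
- by move=> m; apply: le (h2 m); rewrite le_max lexx orbT.
- by move=> m; apply: le (h1 m); rewrite le_max lexx.
congr (_ + _).
  rewrite mulrC -zsumM; last exact: fourier_decays1.
  apply: zsum_ext => k; rewrite [RHS]mulrC -zsumM; last exact: fourier_decays1.
  apply: zsum_ext => m; rewrite /theta_coef.
  transitivity (((-1) ^ (m + k) * (-1) ^ (k - m)) *
    (ee ((m + k)%:~R * (x + y)) * ee ((k - m)%:~R * (x - y)) *
    (ee (((m + k) * (m + k - 1))%:~R / 2 * eta) *
     ee (((k - m) * (k - m - 1))%:~R / 2 * eta)))); first by ring.
  rewrite sgn !mul1r -!eeD; congr ee.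
  by rewrite !(rmorphM, rmorphB, rmorphD) /=; field.
have inner k : zsum (fun m => theta_coef (m + k + 1) *
      ee ((m + k + 1)%:~R * (x + y)) *
      (theta_coef (k - m) * ee ((k - m)%:~R * (x - y)))) =
    - (ee (x - y) * theta_even y) * (1 * ee ((k * k)%:~R * eta) * ee (k%:~R * (2 * x))).
  have dec1 := fourier_decays1 (2 * y) dE.
  rewrite /theta_even /fourier -(zsum_shift 1 dec1).
  rewrite -mulNr mulrC mulrA -zsumM; last exact: (decays_shift 1 dec1).
  apply: zsum_ext => m; rewrite /theta_coef.
  transitivity (((-1) ^ (m + k + 1) * (-1) ^ (k - m)) *
    (ee ((m + k + 1)%:~R * (x + y)) * ee ((k - m)%:~R * (x - y)) *
    (ee (((m + k + 1) * (m + k + 1 - 1))%:~R / 2 * eta) *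
     ee (((k - m) * (k - m - 1))%:~R / 2 * eta)))); first by ring.
  have -> : (-1) ^ (m + k + 1) * (-1) ^ (k - m) = -1 :> R[i].
    by rewrite expfzDr ?oppr_eq0 ?oner_eq0 // expr1z mulrAC sgn mul1r.
  rewrite mulN1r !mul1r !mulrN !mulNr -!eeD; congr (- ee _).
  by rewrite !(rmorphM, rmorphB, rmorphD) /=; field.
rewrite (zsum_ext inner) zsumM; last exact: fourier_decays1.
by rewrite /theta_odd /fourier; ring.
Qed.

(** The exponential is chosen such that sigma is odd. *)
Definition sigma z := ee (- (z / 2)) * theta eta z.

Lemma theta_sigma z : theta eta z = ee (z / 2) * sigma z.
Proof. by rewrite /sigma mulrA -eeD subrr ee0 mul1r. Qed.

Lemma sigmaN z : sigma (- z) = - sigma z.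
Proof.
rewrite /sigma thetaN mulrN mulrA -eeD; congr (- (ee _ * _)); by field.
Qed.

Lemma sigma_mul x y : sigma (x + y) * sigma (x - y) =
  (ee (- x) * theta_even x) * theta_odd y -
  theta_odd x * (ee (- y) * theta_even y).
Proof.
rewrite /sigma mulrACA -eeD theta_mul.
have -> : - ((x + y) / 2) + - ((x - y) / 2) = - x by field.
have -> : ee (- y) = ee (- x) * ee (x - y) by rewrite -eeD; congr ee; ring.
by ring.
Qed.

(** By sigma_mul every product of two values is a two by two determinant
    P x * Q y - Q x * P y; at the four points w + a, w + b, w + g and w, with w = m / 2,
    the identity is the Pluecker relation. *)
Lemma sigma_three_term m a b g :
  sigma (m + a + b) * sigma (a - b) * sigma (m + g) * sigma g -
  sigma (m + a + g) * sigma (a - g) * sigma (m + b) * sigma b +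
  sigma (m + a) * sigma a * sigma (m + b + g) * sigma (b - g) = 0.
Proof.
pose w := m / 2.
have split2 u v x y : x + y = u -> x - y = v -> sigma u * sigma v =
   (ee (- x) * theta_even x) * theta_odd y - theta_odd x * (ee (- y) * theta_even y).
  by move=> <- <-; exact: sigma_mul.
have e1 := @split2 (m + a + b) (a - b) (w + a) (w + b).
have e2 := @split2 (m + g) g (w + g) w.
have e3 := @split2 (m + a + g) (a - g) (w + a) (w + g).
have e4 := @split2 (m + b) b (w + b) w.
have e5 := @split2 (m + a) a (w + a) w.
have e6 := @split2 (m + b + g) (b - g) (w + b) (w + g).
have -> : sigma (m + a + b) * sigma (a - b) * sigma (m + g) * sigma g =
  (sigma (m + a + b) * sigma (a - b)) * (sigma (m + g) * sigma g) by ring.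
have -> : sigma (m + a + g) * sigma (a - g) * sigma (m + b) * sigma b =
  (sigma (m + a + g) * sigma (a - g)) * (sigma (m + b) * sigma b) by ring.
have -> : sigma (m + a) * sigma a * sigma (m + b + g) * sigma (b - g) =
  (sigma (m + a) * sigma a) * (sigma (m + b + g) * sigma (b - g)) by ring.
rewrite e1 ?e2 ?e3 ?e4 ?e5 ?e6 /w; first by ring.
all: by field.
Qed.

End ThetaIdentity.

(** * Theta is holomorphic and not locally zero *)
Section ThetaAnalytic.
Context {R : realType}.
Implicit Types (c d : int -> R[i]) (z : R[i]).
Notation half := (2^-1 : R).

Lemma superdecays_lin a c d : superdecays c -> superdecays d ->
  superdecays (fun m => a * c m + d m).
Proof.
move=> hc hd r; have [C h1] := hc r; have [D h2] := hd r.
exists (nm a * C + D) => m; apply: le_trans (nmD _ _) _.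
rewrite nmM mulrDl -mulrA; apply: lerD => //.
by rewrite ler_wpM2l // nm_ge0.
Qed.

Lemma superdecays_mulz c : superdecays c -> superdecays (fun m => m%:~R * c m).
Proof.
move=> hc r; have [D h] := hc r.+1; exists D => m.
have D0 : 0 <= D by have := h 0; rewrite muln0 mulr1; apply: le_trans (nm_ge0 _).
rewrite nmM -[m%:~R](rmorph_int (real_complex R)) nm_real -intr_norm -natr_absz.
apply: le_trans (ler_wpM2l _ (h m)) _ => //.
rewrite mulSn exprD mulrCA ler_wpM2l // mulrA ler_piMl ?exprn_ge0 //.
by rewrite exprVn ler_pdivrMr ?exprn_gt0 // mul1r -natrX ler_nat ltnW // ltn_expl.
Qed.

(** The Taylor remainder of the term of index m is at most
    4 * (2 * pi * m * h) ^+ 2 * expR (2 * pi * m), and the coefficients absorb the growth in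
    m: the exponent r + 3 leaves one factor for the exponential, two for m ^+ 2 and one
    for the summation. *)
Lemma fourier_taylor1 c z : superdecays c ->
  exists K : R, forall h, nm h <= 1 ->
    nm (fourier c (z + h) - fourier c z -
        h * (twopii * fourier (fun m => m%:~R * c m) z)) <= K * nm h ^+ 2.
Proof.
move=> hc.
have [r hr] := expR_le_pow2 (2 * pi : R).
have [D hD] := fourier_decays z (r + 3)%N hc.
have D0 : 0 <= D by have := hD 0; rewrite muln0 mulr1; apply: le_trans (nm_ge0 _).
exists (4 * (D * (4 * (2 * pi) ^+ 2))) => h h1.
have dz := fourier_decays1 z hc.
have dzh := fourier_decays1 (z + h) hc.
have dm := fourier_decays1 z (superdecays_mulz hc).
set G := fun m => c m * ee (m%:~R * z) * (ee (m%:~R * h) - 1 - twopii * (m%:~R * h)).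
have -> : fourier c (z + h) - fourier c z -
    h * (twopii * fourier (fun m => m%:~R * c m) z) = zsum G.
  transitivity (- (h * twopii) * zsum (fun m => m%:~R * c m * ee (m%:~R * z)) +
    (-1 * zsum (fun m => c m * ee (m%:~R * z)) +
      zsum (fun m => c m * ee (m%:~R * (z + h))))).
    by rewrite /fourier; ring.
  rewrite -zsum_lin // -zsum_lin //; last exact: decays_lin.
  by apply: zsum_ext => m; rewrite /G mulrDr eeD; ring.
rewrite -mulrA; apply: zsum_le => m.
rewrite nmM.
pose B := 2 * pi * `|m|%N%:R * nm h.
have hB : nm (twopii * (m%:~R * h)) <= B.
  rewrite !nmM nm_twopii -[m%:~R](rmorph_int (real_complex R)) nm_real.
  by rewrite -intr_norm -natr_absz mulrA.
have p0 : 0 <= pi :> R := pi_ge0 R.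
have B0 : 0 <= B by rewrite !mulr_ge0 // nm_ge0.
have := cexp_taylor1 hB; rewrite -/(ee _) => hT.
have eB : expR B <= 2 ^+ (r * `|m|)%N.
  apply: (@le_trans _ _ (expR (2 * pi) ^+ `|m|%N)).
    rewrite -expRM_natl ler_expR /B [leLHS](_ : _ = nm h * (`|m|%N%:R * (2 * pi))); last by ring.
    by rewrite ler_piMl // !mulr_ge0.
  by rewrite exprM lerXn2r // nnegrE ?expR_ge0 // exprn_ge0.
have mB : `|m|%N%:R ^+ 2 <= 2 ^+ (2 * `|m|)%N :> R.
  rewrite mulnC exprM lerXn2r ?nnegrE // -natrX ler_nat ltnW // ltn_expl //.
apply: le_trans (ler_pM (nm_ge0 _) (nm_ge0 _) (hD m) hT) _.
rewrite /B !exprMn.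
have -> : half ^+ ((r + 3) * `|m|)%N =
    half ^+ (r * `|m|)%N * (half ^+ (2 * `|m|)%N * half ^+ `|m|%N).
  by rewrite -!exprD; congr (_ ^+ _); lia.
have i1 : half ^+ (r * `|m|)%N * expR B <= 1.
  apply: le_trans (ler_wpM2l _ eB) _; first by rewrite exprn_ge0.
  by rewrite -exprMn mulVf // expr1n.
have i2 : half ^+ (2 * `|m|)%N * `|m|%N%:R ^+ 2 <= 1.
  apply: le_trans (ler_wpM2l _ mB) _; first by rewrite exprn_ge0.
  by rewrite -exprMn mulVf // expr1n.
rewrite [leLHS](_ : _ = D * (4 * (2 ^+ 2 * pi ^+ 2)) * nm h ^+ 2 * half ^+ `|m|%N *
  ((half ^+ (r * `|m|)%N * expR B) * (half ^+ (2 * `|m|)%N * `|m|%N%:R ^+ 2))); last first.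
  by rewrite /B; ring.
rewrite ler_piMr //.
  by rewrite !mulr_ge0 ?exprn_ge0 // ?nm_ge0.
by apply: le_trans (ler_pM _ _ i1 i2) _; rewrite ?mulr1 // !mulr_ge0 ?exprn_ge0 ?expR_ge0.
Qed.

End ThetaAnalytic.

Section ThetaHolomorphic.
Context {R : realType}.
Implicit Types (c d : int -> R[i]) (z : R[i]).
Local Open Scope classical_set_scope.
Local Open Scope ring_scope.
Notation half := (2^-1 : R).

Lemma fourier_differentiable c z : superdecays c ->
  differentiable (fourier c : R[i]^o -> R[i]^o) (z : R[i]^o).
Proof.
move=> hc; apply/derivable1_diffP; have [K hK] := fourier_taylor1 z hc.
set G := twopii * _ in hK.
have K0 : 0 <= K by have := hK 1; rewrite nm1 lexx expr1n mulr1 => /(_ isT); apply: le_trans (nm_ge0 _).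
apply/cvg_ex; exists (G : R[i]^o); apply/cvgrPdist_le => e e0.
have eE : e = (complex.Re e)%:C by rewrite RRe_real // gtr0_real.
set e' := complex.Re e in eE.
have e0' : 0 < e' by rewrite -ltcR -eE.
pose d := Num.min 1 (e' / (K + 1)).
have d0 : 0 < d by rewrite lt_min ltr01 divr_gt0 // ltr_wpDl.
near=> h.
have hn0 : h != 0 by near: h; exact: nbhs_dnbhs_neq.
have hd : nm h <= d.
  rewrite -nm_le; near: h; apply: dnbhs0_le; by rewrite -(rmorph0 (real_complex R)) ltcR.
have h1 : nm h <= 1 by apply: le_trans hd _; rewrite ge_min lexx.
have h2 : nm h <= e' / (K + 1) by apply: le_trans hd _; rewrite ge_min lexx orbT.
rewrite eE nm_le /= -[h *: 1]/(h * 1) mulr1 -[_ *: _]/(h^-1 * _).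
have -> : G - h^-1 * (fourier c (h + z) - fourier c z) =
    - (h^-1 * (fourier c (z + h) - fourier c z - h * G)).
  by rewrite (addrC h z); field.
have n0 : 0 < nm h by rewrite lt_def nm_eq0 hn0 nm_ge0.
rewrite nmN nmM nmV ler_pdivrMl //.
apply: le_trans (hK h h1) _.
rewrite expr2 mulrCA ler_pM2l //.
apply: le_trans (ler_wpM2l K0 h2) _.
rewrite mulrCA ler_piMr ?(ltW e0') // ler_pdivrMr; lra.
Unshelve. all: by end_near.
Qed.

(** The first-order expansion at y, taken along steps h that tend to 0, forces the
    derivative to vanish. *)
Lemma fourier_moment c z (r : R) : superdecays c -> 0 < r ->
  (forall y, nm (y - z) < r -> fourier c y = 0) ->
  forall y, nm (y - z) < r -> fourier (fun m => m%:~R * c m) y = 0.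
Proof.
move=> hc r0 h0 y hy; have [K hK] := fourier_taylor1 y hc.
set G := fourier (fun m => m%:~R * c m) y in hK *.
have K0 : 0 <= K.
  by have := hK 1; rewrite nm1 lexx expr1n mulr1 => /(_ isT); apply: le_trans (nm_ge0 _).
have t0 : 0 < r - nm (y - z) by rewrite subr_gt0.
pose t := Num.min 1 ((r - nm (y - z)) / 2).
have tp : 0 < t by rewrite lt_min ltr01 divr_gt0.
suff /eqP : twopii * G = 0.
  by rewrite mulf_eq0 -nm_eq0 nm_twopii gt_eqF ?mulr_gt0 ?pi_gt0 //= => /eqP.
apply: (@nm_half_eq0 _ _ (K * t)) => n.
pose h := (t * half ^+ n)%:C : R[i].
have hE : nm h = t * half ^+ n.
  by rewrite nm_real ger0_norm // mulr_ge0 ?exprn_ge0 // ltW.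
have h0' : 0 < nm h by rewrite hE mulr_gt0 // exprn_gt0 // half_gt0.
have ht : nm h <= t by rewrite hE ler_piMr ?(ltW tp) // exprn_ile1 ?half_le1 // ltW // half_gt0.
have h1 : nm h <= 1 by apply: le_trans ht _; rewrite ge_min lexx.
have := hK h h1; rewrite !h0 //; last first.
  rewrite addrAC; apply: le_lt_trans (nmD _ _) _.
  have : nm h <= (r - nm (y - z)) / 2 by apply: le_trans ht _; rewrite ge_min lexx orbT.
  by lra.
rewrite subrr sub0r nmN nmM expr2 mulrCA ler_pM2l //.
by rewrite hE mulrA.
Qed.

(** The partial products of the product formula of sin (pi * m) / (pi * m). *)
Definition cutoff (n : nat) (m : int) : R[i] :=
  \prod_(1 <= j < n.+1) (1 - m%:~R ^+ 2 / j%:R ^+ 2).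

Lemma cutoff0 n : cutoff n 0 = 1.
Proof. by rewrite /cutoff big1 // => j _; rewrite expr0n mul0r subr0. Qed.

Lemma cutoff_eq0 n (m : int) : m != 0 -> (`|m| <= n)%N -> cutoff n m = 0.
Proof.
move=> m0 mn; rewrite /cutoff.
rewrite (@big_cat_nat _ _ _ `|m|%N) ?absz_gt0 //=; last exact: leqW.
rewrite [X in _ * X]big_nat_recl // (_ : _ ^+ 2 / _ = 1) ?subrr ?mul0r ?mulr0 //.
have -> : `|m|%N%:R = `|m|%:~R :> R[i] by rewrite natr_absz.
rewrite -(rmorphXn (intmul 1)) /= -(rmorphXn (intmul 1)) /= real_normK ?num_real //.
by rewrite divff // intr_eq0 expf_eq0 m0.
Qed.

(** For m > n every factor is at most m ^+ 2 / j ^+ 2 in absolute value, and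
    m ^+ n / n`! <= expR m bounds the product independently of n. *)
Lemma cutoff_bound : exists r : nat, forall n m, nm (cutoff n m) <= 2 ^+ (r * `|m|)%N.
Proof.
have [r hr] := expR_le_pow2 (2 : R); exists r => n m.
have [-> |m0] := eqVneq m 0; first by rewrite cutoff0 nm1 muln0.
have [mn|ltnm] := leqP `|m|%N n; first by rewrite cutoff_eq0 // nm0 exprn_ge0.
set a : R := `|m|%N%:R.
apply: (@le_trans _ _ ((a ^+ n / n`!%:R) ^+ 2)).
  have nmprod (s : seq nat) (F : nat -> R[i]) :
      nm (\prod_(i <- s) F i) = \prod_(i <- s) nm (F i).
    by elim/big_rec2 : _ => [|i x y _ h]; rewrite ?nm1 // nmM h.
  rewrite /cutoff nmprod fact_prod natr_prod.
  have -> : (a ^+ n / \prod_(1 <= i < n.+1) i%:R) ^+ 2 =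
      \prod_(1 <= i < n.+1) (a ^+ 2 / i%:R ^+ 2).
    rewrite big_split /= prodfV exprMn exprVn -[in LHS]prodrXl.
    by rewrite big_const_nat subSS subn0 iter_mulr mulr1 -!exprM mulnC.
  rewrite big_nat [leRHS]big_nat; apply: ler_prod => j /andP[j0 jn].
  rewrite nm_ge0 /=.
  have -> : 1 - m%:~R ^+ 2 / j%:R ^+ 2 = (1 - a ^+ 2 / j%:R ^+ 2)%:C :> R[i].
    rewrite absz_sqr rmorphB rmorph1 rmorphM fmorphV !rmorphXn /=.
    by rewrite rmorph_int rmorph_nat.
  have j0' : 0 < j%:R :> R by rewrite ltr0n.
  have : 1 <= a ^+ 2 / j%:R ^+ 2.
    rewrite ler_pdivlMr ?exprn_gt0 // mul1r lerXn2r ?nnegrE // ler_nat.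
    by apply: leq_trans (ltnW ltnm); rewrite -ltnS.
  by move=> h1; rewrite nm_real ler0_norm; lra.
have a0 : 0 <= a by [].
have h1 : a ^+ n / n`!%:R <= expR a.
  case: n {ltnm} => [|n]; first by rewrite expr0 fact0 divr1; have := expR_ge1Dx a; lra.
  by have := expR_ge1Dxn n a0; lra.
apply: (@le_trans _ _ (expR a ^+ 2)).
  by rewrite lerXn2r ?nnegrE ?expR_ge0 // divr_ge0 // exprn_ge0.
rewrite exprM; apply: (@le_trans _ _ (expR 2 ^+ `|m|%N)).
  by rewrite -!expRM_natl mulrC.
by rewrite lerXn2r ?nnegrE ?expR_ge0 // exprn_ge0.
Qed.

(** Multiplying the coefficients by [cutoff n] keeps the series zero on the disc.
    At the centre of the disc only the index 0 and indices beyond n remain, and the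
    latter contribute an error that is geometric in n. *)
Lemma fourier_ball_eq0 c z (r : R) : superdecays c -> 0 < r ->
  (forall y, nm (y - z) < r -> fourier c y = 0) -> c 0 = 0.
Proof.
move=> hc r0 h0.
have cut n : superdecays (fun m => cutoff n m * c m) /\
    forall y, nm (y - z) < r -> fourier (fun m => cutoff n m * c m) y = 0.
  elim: n => [|n [hs hz]].
    have -> : (fun m => cutoff 0 m * c m) = c; last by [].
    by apply/funext => m; rewrite /cutoff big_geq // mul1r.
  have hs2 := superdecays_mulz (superdecays_mulz hs).
  have hz2 := fourier_moment (superdecays_mulz hs) r0 (fourier_moment hs r0 hz).
  pose a := - n.+1%:R ^- 2 : R[i].
  have e m : cutoff n.+1 m * c m =
      a * (m%:~R * (m%:~R * (cutoff n m * c m))) + cutoff n m * c m.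
    rewrite /cutoff big_nat_recr //= /a; ring.
  have {}e := funext e; rewrite e; split; first exact: superdecays_lin.
  move=> y hy; rewrite -[RHS](addr0 0) -[X in X + _](mulr0 a) -[X in _ * X](hz2 y hy).
  rewrite -[X in _ + X](hz y hy) -zsum_lin; try exact: fourier_decays1.
  by apply: zsum_ext => m; ring.
have [t ht] := cutoff_bound.
have [D hD] := fourier_decays z t.+1 hc.
apply: (@nm_half_eq0 _ _ (4 * D)) => n.
have g : geo D (fun m => cutoff n.+1 m * c m * ee (m%:~R * z)).
  move=> m; rewrite -mulrA nmM.
  apply: le_trans (ler_pM (nm_ge0 _) (nm_ge0 _) (ht _ _) (hD m)) _.
  rewrite mulSn exprD [leLHS](_ : _ = D * half ^+ `|m|%N *
    (2 ^+ (t * `|m|)%N * half ^+ (t * `|m|)%N)); last by ring.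
  by rewrite -exprMn divff // expr1n mulr1.
have := zsum_psum g n.+1.
have [_ /(_ z)] := cut n.+1; rewrite subrr nm0 => /(_ r0).
rewrite /fourier => ->.
have -> : psum (fun m => cutoff n.+1 m * c m * ee (m%:~R * z)) n.+1 = c 0.
  rewrite /psum big_nat_recl // big_nat big1 => [|i /andP[_ hi]].
    rewrite cutoff0 mul0r ee0 mulr1 mul1r (cutoff_eq0 (m := Negz 0)) //.
    by rewrite !mul0r !addr0.
  by rewrite !cutoff_eq0 // ?mul0r ?addr0 //= ltnS // ltnW.
rewrite sub0r nmN => h; apply: le_trans h _.
have D0 := geo_ge0 g.
by rewrite ler_wpM2l ?mulr_ge0 // half_expS_le.
Qed.

Variable eta : R[i].
Hypothesis eta_gt0 : 0 < complex.Im eta.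

Lemma theta_differentiable z :
  differentiable (theta eta : R[i]^o -> R[i]^o) (z : R[i]^o).
Proof.
rewrite (_ : theta eta = fourier (theta_coef eta)).
  exact/fourier_differentiable/theta_coef_superdecays.
by apply/funext => y; rewrite thetaE.
Qed.

Lemma theta_nonzero_near z (r : R) : 0 < r ->
  exists2 y, nm (y - z) < r & theta eta y != 0.
Proof.
move=> r0; apply: contrapT => hn.
have /eqP : theta_coef eta 0 = 0.
  apply: (@fourier_ball_eq0 _ z r) => // [|y hy].
    exact: theta_coef_superdecays.
  by rewrite -thetaE; apply/eqP; apply: contrapT => /negP h; apply: hn; exists y.
by rewrite /theta_coef expr0z !mul0r ee0 mul1r oner_eq0.
Qed.

End ThetaHolomorphic.

(** * The product of homogeneous functions *)
Section Coordinates.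
Context {R : realType} {h : nat}.
Implicit Types (l : Lplus h) (u : 'rV[R[i]]_h).
Local Notation vars := (@vars R h).

(** Total in the index k, so that variables of functions of different degrees can be
    compared; the default value 0 stands for the variables that do not occur. *)
Definition xv l (p : vars l) (i : 'I_h) (k : nat) : R[i] :=
  oapp (xvar p (i := i)) 0 (insub k).

Lemma xvE l (p : vars l) i (a : 'I_(l i)) : xv p i a = xvar p a.
Proof. by rewrite /xv valK. Qed.

Lemma xvar_mkvars l (x : forall i : 'I_h, 'I_(l i) -> R[i]) u i (a : 'I_(l i)) :
  xvar (mkvars x u) a = x i a.
Proof. by rewrite /xvar /mkvars /= mxrowK mxE. Qed.

Lemma mkvars_xvar l (p : vars l) : @mkvars R h l (fun i a => xvar p a) p.2 = p.
Proof.
case: p => x u; congr (_, _) => /=; rewrite -[RHS]submxrowK; congr mxrow.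
apply: functional_extensionality_dep => i; apply/rowP => a.
by rewrite mxE.
Qed.

Lemma xv_castvars l l' (E : l = l') (p : vars l) i k : xv (castvars E p) i k = xv p i k.
Proof. by case: l' / E. Qed.

Lemma castvars2 l l' (E : l = l') (p : vars l) : (castvars E p).2 = p.2.
Proof. by case: l' / E. Qed.

Definition permvars l (s : forall i : 'I_h, 'S_(l i)) (p : vars l) : vars l :=
  @mkvars R h l (fun i a => xvar p (s i a)) p.2.

Lemma fun2_ext (T : 'I_h -> Type) (U : Type) (f g : forall i, T i -> U) :
  (forall i a, f i a = g i a) -> f = g.
Proof.
move=> fg; apply: functional_extensionality_dep => i.
exact: functional_extensionality_dep.
Qed.

Definition star_term (eta tau : R[i]) l l' (f : vars l -> R[i]) (g : vars l' -> R[i])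
    (xl : forall i, 'I_(l i) -> R[i]) (xr : forall i, 'I_(l' i) -> R[i]) u : R[i] :=
  f (mkvars xl u) *
  g (mkvars xr (\row_(i < h) (u 0 i - 2 * (pairing l i)%:~R * tau))) *
  \prod_(i < h) \prod_(j < h) \prod_(a < l i) \prod_(b < l' j)
    (theta eta (xl i a - xr j b - (cartan i j)%:~R * tau) /
     theta eta (xl i a - xr j b)).

Lemma starE eta tau l l' (f : vars l -> R[i]) (g : vars l' -> R[i]) p :
  star eta tau f g p =
  (\prod_(i < h) ((l i)`! * (l' i)`!))%:R^-1 *
  \sum_(s : {dffun forall i : 'I_h, 'S_(l i + l' i)})
    star_term eta tau f g (fun i a => xvar p (s i (lshift (l' i) a)))
      (fun i b => xvar p (s i (rshift (l i) b))) p.2.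
Proof. by []. Qed.

(** Translation by s permutes the summation over the symmetric groups. *)
Lemma star_permvars eta tau l l' L (f : vars l -> R[i]) (g : vars l' -> R[i])
    (E : L = Ladd l l') (s : forall i : 'I_h, 'S_(L i)) (p : vars L) :
  star eta tau f g (castvars E (permvars s p)) = star eta tau f g (castvars E p).
Proof.
(* The double symmetry lets case analysis eliminate L in favour of Ladd l l'. *)
rewrite (Prop_irrelevance E (esym (esym E))).
move: (esym E) s p => {E} E; case: L / E => s p /=.
rewrite !starE; congr (_ * _).
pose hm (sg : forall i : 'I_h, 'S_(Ladd l l' i))
  (t : {dffun forall i : 'I_h, 'S_(l i + l' i)}) :
  {dffun forall i : 'I_h, 'S_(l i + l' i)} := [ffun i => (t i * sg i)%g].
rewrite [RHS](reindex (hm s)); last first.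
  exists (hm (fun i => (s i)^-1%g)) => t _; apply/ffunP => i; rewrite !ffunE.
    by rewrite mulgK.
  by rewrite mulgKV.
apply: eq_bigr => t _.
have e1 : (fun i a => xvar (permvars s p) (t i (lshift (l' i) a))) =
  (fun i a => xvar p (hm s t i (lshift (l' i) a))).
  by apply: fun2_ext => i a; rewrite xvar_mkvars ffunE permM.
have e2 : (fun i b => xvar (permvars s p) (t i (rshift (l i) b))) =
  (fun i b => xvar p (hm s t i (rshift (l i) b))).
  by apply: fun2_ext => i a; rewrite xvar_mkvars ffunE permM.
by rewrite e1 e2.
Qed.

Lemma mulF_permvars eta tau (a b : gradedfam R h) L (s : forall i : 'I_h, 'S_(L i)) p :
  mulF eta tau a b (permvars s p) = mulF eta tau a b p.
Proof. by apply: eq_bigr => d _; rewrite star_permvars. Qed.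

Lemma star0l eta tau l l' (g : vars l' -> R[i]) (p : vars (Ladd l l')) :
  star eta tau (fun=> 0) g p = 0.
Proof. by rewrite starE [X in _ * X]big1 ?mulr0 // => t _; rewrite /star_term !mul0r. Qed.

Lemma star0r eta tau l l' (f : vars l -> R[i]) (p : vars (Ladd l l')) :
  star eta tau f (fun _ : vars l' => 0) p = 0.
Proof. by rewrite starE [X in _ * X]big1 ?mulr0 // => t _; rewrite /star_term mulr0 mul0r. Qed.

Lemma homF_neq l (f : vars l -> R[i]) m : m <> l -> @homF R h l f m = (fun=> 0).
Proof. by move=> ne; apply/funext => p; rewrite /homF; case: pselect. Qed.

Lemma homF_eq l (f : vars l -> R[i]) : @homF R h l f l = f.
Proof.
apply/funext => p; rewrite /homF; case: pselect => // E.
by rewrite (Prop_irrelevance E (erefl _)).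
Qed.

Lemma mulF_homF_neq eta tau l l' (f : vars l -> R[i]) (g : vars l' -> R[i]) L p :
  L <> Ladd l l' -> @mulF R h eta tau (homF f) (homF g) L p = 0.
Proof.
move=> ne; apply: big1 => d _.
have [e1|n1] := pselect ((fun i => d i : nat) = l); last by rewrite homF_neq // star0l.
have [e2|n2] := pselect (Lsub L (fun i => d i : nat) = l'); last first.
  by rewrite (homF_neq g n2) star0r.
by case: ne; rewrite -e2 -e1 {1}(Ladd_sub d).
Qed.

Lemma star_homF eta tau l l' (f : vars l -> R[i]) (g : vars l' -> R[i]) L m m'
    (p : vars L) (E : L = Ladd m m') (E' : L = Ladd l l') :
  m = l -> m' = l' ->
  star eta tau (@homF R h l f m) (@homF R h l' g m') (castvars E p) =
  star eta tau f g (castvars E' p).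
Proof.
move=> /esym em /esym em'; case: m / em E; case: m' / em' => E.
by rewrite !homF_eq (Prop_irrelevance E E').
Qed.

(** Only the splitting of the degree L as l + l' contributes. *)
Lemma mulF_homF eta tau l l' (f : vars l -> R[i]) (g : vars l' -> R[i]) L p
    (E : L = Ladd l l') :
  @mulF R h eta tau (homF f) (homF g) L p = star eta tau f g (castvars E p).
Proof.
have lE i : (l i < (L i).+1)%N by rewrite E ltnS leq_addr.
pose d0 : {dffun forall i : 'I_h, 'I_(L i).+1} := [ffun i => Ordinal (lE i)].
have e0 : (fun i => d0 i : nat) = l by apply/funext => i; rewrite ffunE.
rewrite /mulF (bigD1 d0) //= big1 ?addr0 => [|d ne].
  apply: star_homF => //; rewrite e0 E; apply/funext => i.
  by rewrite /Lsub /Ladd addKn.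
rewrite homF_neq ?star0l // => e; case/eqP: ne; apply/ffunP => i; apply: val_inj.
by rewrite ffunE /= -e.
Qed.

Lemma pairing0 j : pairing (Lzero : Lplus h) j = 0.
Proof. by apply: big1 => i _; rewrite mul0r. Qed.

(** The kernel is an empty product here, and the summands are equal by the symmetry of
    F m', so that they cancel the factorials. *)
Lemma star_funF eta tau (c : 'rV[R[i]]_h -> R[i]) L m m' (F : forall l, vars l -> R[i])
    (p : vars L) (E : L = Ladd m m') (E' : L = m') :
  (forall s p, F m' (permvars s p) = F m' p) ->
  m = Lzero -> star eta tau (@funF R h c m) (F m') (castvars E p) =
  c p.2 * F m' (castvars E' p).
Proof.
move=> sF /esym em; case: m / em E => E.
move: p E; case: m' / E' sF => sF p E.
rewrite /funF homF_eq (Prop_irrelevance E (erefl L)) /= starE.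
rewrite [X in _ * X](eq_bigr (fun=> c p.2 * F L p)) => [|t _]; last first.
  rewrite /star_term [X in _ * _ * X]big1; last first.
    by move=> i _; apply: big1 => j _; apply: big1 => -[].
  rewrite mulr1 (_ : \row__ _ = p.2); last first.
    by apply/rowP => i; rewrite mxE pairing0 mulr0 mul0r subr0.
  rewrite -(sF (fun i => t i : 'S_(L i)) p); congr (_ * F L (mkvars _ _)).
  by apply: fun2_ext => i b; congr (xvar p (t i _)); exact: val_inj.
rewrite sumr_const card_dep_ffun.
have -> : foldr muln 1%N [seq #|{: 'S_(Lzero i + L i)}| | i : 'I_h] =
    (\prod_(i < h) ((Lzero i)`! * (L i)`!))%N.
  rewrite foldrE big_image /=; apply: eq_bigr => i _.
  by rewrite card_Sn fact0 mul1n.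
set n := (\prod_(i < h) _)%N.
have n0 : (n%:R : R[i]) != 0.
  rewrite pnatr_eq0 -lt0n; apply: prodn_gt0 => i.
  by rewrite muln_gt0 !fact_gt0.
by rewrite -(mulr_natl (c p.2 * F L p)) mulKf.
Qed.

Lemma Lsub0 (L : Lplus h) : L = Lsub L Lzero.
Proof. by apply/funext => i; rewrite /Lsub subn0. Qed.

Lemma mulF_funF eta tau (c : 'rV[R[i]]_h -> R[i]) (a : gradedfam R h) L p :
  (forall L s p, a L (permvars s p) = a L p) ->
  @mulF R h eta tau (funF c) a L p = c p.2 * a L p.
Proof.
move=> sa; pose d0 : {dffun forall i : 'I_h, 'I_(L i).+1} := [ffun i => ord0].
have e0 : (fun i => d0 i : nat) = Lzero by apply/funext => i; rewrite ffunE.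
rewrite /mulF (bigD1 d0) //= big1 ?addr0 => [|d ne]; last first.
  rewrite /funF homF_neq ?star0l // => e; case/eqP: ne; apply/ffunP => i.
  by apply: val_inj; rewrite ffunE /=; exact: (congr1 (@^~ i) e).
have E' : L = Lsub L (fun i => d0 i : nat) by rewrite e0; exact: Lsub0.
rewrite (star_funF eta tau c p (Ladd_sub d0) E' (sa _) e0); congr (_ * _).
by case: _ / E'.
Qed.

End Coordinates.

(** * Products of functions with at most one variable of each colour *)
Section NormalForm.
Context {R : realType} {h : nat}.
Implicit Types (l : Lplus h) (u : 'rV[R[i]]_h).
Local Notation vars := (@vars R h).

(** The nontrivial element of the symmetric group on two letters; the symmetric groups
    on fewer letters are trivial.  This turns a permutation into a boolean. *)
Definition swapped n (s : 'S_n) := (n == 2)%N && (s != 1%g).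

Lemma perm2_lshift n n' (s : 'S_(n + n')) (a : 'I_n) : (n <= 1)%N -> (n' <= 1)%N ->
  s (lshift n' a) = swapped s :> nat.
Proof.
case: n s a => [|[|//]] s a; first by case: a.
case: n' s => [|[|//]] s _ _; first by case: (s _) => -[].
rewrite /swapped /= (ord1 a); have [->|] /= := eqVneq s 1%g; first by rewrite perm1.
move=> ns; case e: (s (lshift 1 ord0)) => [[|[|//]] i] //=.
case/eqP: ns; apply/permP => j; rewrite perm1.
have el : lshift 1 (ord0 : 'I_1) = ord0 by exact: val_inj.
have e0 : s ord0 = ord0 by rewrite -[in LHS]el e; exact: val_inj.
have [->|j0] := eqVneq j ord0; first exact: e0.
apply: val_inj; have : s j != ord0 by rewrite -e0 (inj_eq perm_inj).
by move: j0; rewrite -!val_eqE /=; case: (s j) => -[|[|]]; case: j => -[|[|]].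
Qed.

Lemma perm2_rshift n n' (s : 'S_(n + n')) (b : 'I_n') : (n <= 1)%N -> (n' <= 1)%N ->
  s (rshift n b) = (if n == 1%N then ~~ swapped s else swapped s) :> nat.
Proof.
case: n' s b => [|[|//]] s b; first by case: b.
case: n s => [|[|//]] s n1 n1'; first by case: (s _) => -[].
have h1 := perm2_lshift s ord0 n1 n1'.
have : s (rshift 1 b) != s (lshift 1 ord0).
  by rewrite (inj_eq perm_inj) -val_eqE.
rewrite -val_eqE /= h1; case: (s _) => -[|[|//]] /= _; by case: (swapped s).
Qed.

Lemma swapped_inj n (s t : 'S_n) : (n <= 2)%N -> swapped s = swapped t -> s = t.
Proof.
have p1 (x : 'S_1) : x = 1%g by apply/permP => i; rewrite perm1 (ord1 (x i)) (ord1 i).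
case: n s t => [|[|[|//]]] s t _.
- by move=> _; apply/permP => -[].
- by rewrite (p1 s) (p1 t).
rewrite /swapped /=; have [->|ns] := eqVneq s 1%g.
  by case: eqVneq => // ->.
case: eqVneq => // nt _.
have nfix (x : 'S_2) : x != 1%g -> x ord0 = ord_max.
  move=> nx; have := @perm2_lshift 1 1 x ord0 isT isT.
  rewrite /swapped nx /= => e; apply: val_inj; apply: etrans e => /=.
  by congr (nat_of_ord (x _)); exact: val_inj.
apply/permP => i; have [->|i0] := eqVneq i ord0; first by rewrite !nfix.
have nmax (x : 'S_2) : x != 1%g -> x i = ord0.
  move=> nx; have : x i != ord_max by rewrite -(nfix x nx) (inj_eq perm_inj).
  by rewrite -val_eqE /= => e; apply: val_inj; case: (x i) e => -[|[|]].
by rewrite !nmax.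
Qed.

Lemma swapped_rev n : n = 2 -> swapped (perm (@rev_ord_inj n)).
Proof.
move=> ->; rewrite /swapped /=; apply/eqP => /permP /(_ ord0).
by rewrite permE perm1 => /(congr1 val).
Qed.

Definition allowed l l' (b : {ffun 'I_h -> bool}) :=
  [forall i, b i ==> (l i + l' i == 2)%N].

Definition left_var l l' (p : vars (Ladd l l')) (b : {ffun 'I_h -> bool}) i : R[i] :=
  xv p i (b i).

Definition right_var l l' (p : vars (Ladd l l')) (b : {ffun 'I_h -> bool}) i : R[i] :=
  xv p i (if l i == 1%N then ~~ b i else b i).

Definition on_support l (fx : ('I_h -> R[i]) -> 'rV[R[i]]_h -> R[i]) :=
  forall x y u, (forall i, l i = 1%N -> x i = y i) -> fx x u = fx y u.

(** The functions f and g are given through fx and gx, which take one variable of each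
    colour as a function on the colours, whether or not the colour occurs. *)
Lemma star_normal eta tau l l' (f : vars l -> R[i]) (g : vars l' -> R[i]) fx gx
    (p : vars (Ladd l l')) :
  (forall i, (l i <= 1)%N) -> (forall i, (l' i <= 1)%N) ->
  (forall q, f q = fx ((xv q)^~ 0%N) q.2) -> (forall q, g q = gx ((xv q)^~ 0%N) q.2) ->
  on_support l fx -> on_support l' gx ->
  star eta tau f g p =
  \sum_(b | allowed l l' b)
    fx (left_var p b) p.2 *
    gx (right_var p b) (\row_(i < h) (p.2 0 i - 2 * (pairing l i)%:~R * tau)) *
    \prod_(i < h) \prod_(j < h) (if (l i == 1%N) && (l' j == 1%N) then
      theta eta (left_var p b i - right_var p b j - (cartan i j)%:~R * tau) /
      theta eta (left_var p b i - right_var p b j) else 1).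
Proof.
move=> l1 l1' hf hg sf sg; rewrite starE.
have -> : (\prod_(i < h) ((l i)`! * (l' i)`!))%N = 1%N.
  apply: big1 => i _; have := l1 i; have := l1' i.
  by case: (l i) => [|[|]]; case: (l' i) => [|[|]].
rewrite invr1 mul1r.
pose beta (s : {dffun forall i : 'I_h, 'S_(l i + l' i)}) : {ffun 'I_h -> bool} :=
  [ffun i => swapped (s i)].
pose unbeta (b : {ffun 'I_h -> bool}) : {dffun forall i : 'I_h, 'S_(l i + l' i)} :=
  [ffun i => if b i then perm (@rev_ord_inj (l i + l' i)) else 1%g].
rewrite (reindex_onto beta unbeta) => [|b /forallP hb]; last first.
  apply/ffunP => i; rewrite !ffunE; have := hb i; case: (b i) => /= [/eqP e|_].
    exact: swapped_rev.
  by rewrite /swapped eqxx andbF.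
have le2 i : (l i + l' i <= 2)%N by rewrite (leq_add (l1 i) (l1' i)).
rewrite [RHS](eq_bigl predT) => [|s]; last first.
  apply/andP; split.
    by apply/forallP => i; rewrite ffunE /swapped; apply/implyP => /andP[].
  apply/eqP/ffunP => i; rewrite !ffunE; apply: (swapped_inj (le2 i)).
  case: ifP => [h1|_]; last by rewrite /swapped eqxx andbF.
  by apply: swapped_rev; case/andP: h1 => /eqP.
apply: eq_bigr => s _.
have eL i (a : 'I_(l i)) : xvar p (s i (lshift (l' i) a)) = left_var p (beta s) i.
  by rewrite -xvE perm2_lshift // /left_var ffunE.
have eR i (b : 'I_(l' i)) : xvar p (s i (rshift (l i) b)) = right_var p (beta s) i.
  by rewrite -xvE perm2_rshift // /right_var ffunE.
rewrite /star_term hf hg /=; congr (_ * _ * _).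
- apply: sf => i li; rewrite /xv; case: insubP => [a _ _ /=|/negP[]]; last by rewrite li.
  by rewrite xvar_mkvars.
- apply: sg => i li; rewrite /xv; case: insubP => [a _ _ /=|/negP[]]; last by rewrite li.
  by rewrite xvar_mkvars.
apply: eq_bigr => i _; apply: eq_bigr => j _.
transitivity (\prod_(a < l i) \prod_(b < l' j) (theta eta (left_var p (beta s) i -
    right_var p (beta s) j - (cartan i j)%:~R * tau) /
    theta eta (left_var p (beta s) i - right_var p (beta s) j))).
  by apply: eq_bigr => a _; apply: eq_bigr => b _; rewrite eL eR.
rewrite !prodr_const !card_ord.
have := l1 i; have := l1' j.
by case: (l i) => [|[|]]; case: (l' j) => [|[|]] //=; rewrite ?expr0 ?expr1n ?expr1.
Qed.

End NormalForm.

(** * The generators in terms of nearest neighbours *)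
Section PairingSums.

(** A segment pairs to 1 with its two ends and to -1 with the two simple roots adjacent
    to it; the cases of a segment of length one and of the ends of the diagram are
    covered by the addition of the four terms. *)
Definition segment_pairing (a b j : nat) : int :=
  (j == a)%:Z + (j == b)%:Z - (j.+1 == a)%:Z - (j == b.+1)%:Z.

Lemma pairing_segment h (i1 i2 j : 'I_h) : (i1 <= i2)%N ->
  pairing (segment i1 i2) j = segment_pairing i1 i2 j.
Proof.
move=> le12; pose c i : int := if i == j :> nat then 2 else
  if (i.+1 == j) || (j.+1 == i) then -1 else 0.
have -> : pairing (segment i1 i2) j = \sum_(i1 <= i < i2.+1) c i.
  rewrite /pairing (@big_nat_widen _ _ _ _ _ h) // big_geq_mkord [RHS]big_mkcond.
  apply: eq_bigr => i _; rewrite /segment /= ltnS andbC.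
  by case: ifP; rewrite ?mul0r ?mul1r.
rewrite -(subnKC le12); elim: (i2 - i1)%N => [|r IH].
  rewrite addn0 big_nat1 /c /segment_pairing.
  by case: ifP => ?; [|case: ifP => ?]; lia.
rewrite addnS big_nat_recr /= ?IH; last by lia.
by rewrite /c /segment_pairing; case: ifP => ?; [|case: ifP => ?]; lia.
Qed.

Lemma sum_eq_nat (x y a : nat) : \sum_(x <= j < y) (j == a)%:Z = (x <= a < y)%N%:Z.
Proof.
elim: y => [|y IH]; first by rewrite big_geq // ltn0 andbF.
have [xy|yx] := leqP x y; last by rewrite big_geq //; lia.
by rewrite big_nat_recr //= IH; lia.
Qed.

Lemma sum_segment_pairing x y a b :
  \sum_(x <= j < y) segment_pairing a b j =
  (x <= a < y)%N%:Z + (x <= b < y)%N%:Z - (x < a <= y)%N%:Z - (x <= b.+1 < y)%N%:Z.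
Proof.
rewrite /segment_pairing !sumrB big_split /= !sum_eq_nat; congr (_ - _ - _).
elim: y => [|y IH]; first by rewrite big_geq //; lia.
have [xy|yx] := leqP x y; last by rewrite big_geq //; lia.
by rewrite big_nat_recr //= IH; lia.
Qed.

End PairingSums.

Section Generator.
Context {R : realType} {n : nat}.
Variables (eta tau : R[i]).
Local Notation h := n.+1.
Local Notation vars := (@vars R h).
Implicit Types (U : nat -> R[i]).

Definition natseq (x : 'I_h -> R[i]) k : R[i] := oapp x 0 (insub k).

Lemma natseqE x (i : 'I_h) : natseq x i = x i.
Proof. by rewrite /natseq valK. Qed.

Definition usum U (x y : nat) : R[i] := \sum_(x <= j < y) U j.

(** The part of a generator that involves the variables x, x' of the colours k and
    k.+1; it is 1 when k does not lie in the segment or is its end. *)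
Definition efactor (nu a b : nat) U k x x' : R[i] :=
  if (a <= k < nu)%N then theta eta (x - x' + usum U a k.+1 - tau) / theta eta (x - x')
  else if (nu <= k < b)%N then
    theta eta (x - x' - usum U k.+1 b.+1 + tau) / theta eta (x - x') else 1.

Definition evalue (nu a b : nat) (x : nat -> R[i]) U : R[i] :=
  (\prod_(0 <= k < n) efactor nu a b U k (x k) (x k.+1)) *
  theta eta (x nu + usum U a b.+1 - 2 * tau).

Lemma usum_segment_shift (i1 i2 : 'I_h) (u : 'rV[R[i]]_h) x y :
  (i1 <= i2)%N -> (y <= h)%N ->
  usum (natseq ((\row_(i < h) (u 0 i - 2 * (pairing (segment i1 i2) i)%:~R * tau)) 0)) x y =
  usum (natseq (u 0)) x y - 2 * tau * (\sum_(x <= j < y) segment_pairing i1 i2 j)%:~R.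
Proof.
move=> h12 yh; rewrite /usum rmorph_sum mulr_sumr -sumrB big_nat [RHS]big_nat.
apply: eq_bigr => j /andP[_ jw]; have jh : (j < h)%N by apply: leq_trans yh.
by rewrite !(natseqE _ (Ordinal jh)) mxE pairing_segment //=; ring.
Qed.

Lemma prod_ord_nat (P : pred nat) (F : 'I_h -> R[i]) (G : nat -> R[i]) : ~~ P n ->
  (forall i : 'I_h, P i -> F i = G i) ->
  \prod_(i < h | P i) F i = \prod_(0 <= k < n | P k) G k.
Proof.
move=> nP FG; transitivity (\prod_(i < h | P i) G i); first exact: eq_bigr.
by rewrite -big_mkord big_mkcond big_nat_recr //= (negbTE nP) mulr1 -big_mkcond.
Qed.

Lemma sum_ord_usum (P : pred nat) (u : 'rV[R[i]]_h) x y : (y <= h)%N ->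
  (forall k : nat, P k = (x <= k < y)%N) ->
  \sum_(k < h | P k) u 0 k = usum (natseq (u 0)) x y.
Proof.
move=> yh hP; rewrite /usum (@big_nat_widen _ _ _ _ _ h) // big_geq_mkord.
apply: eq_big => [k|k _]; last by rewrite natseqE.
by rewrite hP andbC.
Qed.

Lemma efunE (nu i1 i2 : 'I_h) (p : vars (segment i1 i2)) : (i1 <= nu)%N -> (nu <= i2)%N ->
  efun eta tau nu p = evalue nu i1 i2 (natseq ((xv p)^~ 0%N)) (natseq (p.2 0)).
Proof.
move=> h1 h2; rewrite /efun /evalue; set x := x1 p; set z := natseq ((xv p)^~ 0%N).
have xE (i : 'I_h) : x i = z i by rewrite /z natseqE.
have hn (i : 'I_h) : (i <= n)%N by rewrite -ltnS.
have xS (i : 'I_h) : (i < n)%N -> x (ordS i) = z i.+1.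
  by move=> hi; rewrite xE /= modn_small.
have sE (P : pred nat) a b (hb : (b <= h)%N) := @sum_ord_usum P p.2 a b hb.
rewrite (sE (fun k => i1 <= k <= i2)%N i1 i2.+1) // xE; congr (_ * theta _ _).
rewrite (@prod_ord_nat (fun k => i1 <= k < nu)%N _ (fun k =>
    theta eta (z k - z k.+1 + usum (natseq (p.2 0)) i1 k.+1 - tau))); last 2 first.
- by rewrite ltnNge (hn nu) andbF.
- move=> i /andP[_ hi]; rewrite xE xS ?(leq_trans hi) //.
  by rewrite (sE (fun k => i1 <= k <= i)%N i1 i.+1).
rewrite (@prod_ord_nat (fun k => nu <= k < i2)%N _ (fun k =>
    theta eta (z k - z k.+1 - usum (natseq (p.2 0)) k.+1 i2.+1 + tau))); last 2 first.
- by rewrite ltnNge (hn i2) andbF.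
- move=> i /andP[_ hi]; rewrite xE xS ?(leq_trans hi) //.
  by rewrite (sE (fun k => i < k <= i2)%N i.+1 i2.+1).
rewrite (@prod_ord_nat (fun k => i1 <= k < i2)%N _ (fun k =>
    theta eta (z k - z k.+1))); last 2 first.
- by rewrite ltnNge (hn i2) andbF.
- by move=> i /andP[_ hi]; rewrite xE xS ?(leq_trans hi).
rewrite big_mkcond [X in _ * X / _]big_mkcond [X in _ / X]big_mkcond.
rewrite -prodfV -!big_split; apply: eq_bigr => k _ /=.
rewrite /efactor; have [hk|hk] := leqP nu k.
  rewrite ?andbF (leq_trans h1 hk) /=.
  by case: ifP => _; rewrite ?invr1 ?mulr1 ?mul1r.
rewrite (leq_trans hk h2) ?andbF ?andbT /=.
by case: ifP => _; rewrite ?invr1 ?mulr1 ?mul1r.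
Qed.

Lemma efun_on_support (nu i1 i2 : 'I_h) : (i1 <= nu)%N -> (nu <= i2)%N ->
  on_support (segment i1 i2)
    (fun x u => evalue nu i1 i2 (natseq x) (natseq (u 0))).
Proof.
move=> h1 h2 x y u xy.
have e k : (i1 <= k <= i2)%N -> natseq x k = natseq y k.
  move=> /andP[k1 k2]; have kh : (k < h)%N by apply: leq_ltn_trans k2 _.
  by rewrite !(natseqE _ (Ordinal kh)) xy // /segment /= k1 k2.
rewrite /evalue (e nu); last by rewrite h1 h2.
congr (_ * _).
apply: eq_bigr => k _; rewrite /efactor.
case: ifP => [/andP[a1 a2]|_].
  by rewrite (e k) ?(e k.+1) //; apply/andP; split; lia.
case: ifP => [/andP[a1 a2]|_ //].
by rewrite (e k) ?(e k.+1) //; apply/andP; split; lia.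
Qed.

End Generator.

(** * The product of two generators as a transfer-matrix sum *)
Section TransferForm.
Variables (K : comPzRingType).

Lemma lsum_ext N N' W W' m (c : bool) :
  (forall k d, (k < m)%N -> N k d = N' k d) ->
  (forall k d d', (k < m)%N -> W k d d' = W' k d d') ->
  lsum N W m c = lsum N' W' m c :> K.
Proof.
elim: m c => //= m IH c hN hW; apply: eq_bigr => d _.
rewrite hN // hW // IH // => k *; [exact/hN/ltnW|exact/hW/ltnW].
Qed.

(** The sum over the nodes above j is a sum over the nodes below it in the reversed
    numbering. *)
Lemma rsum_lsum N W n j (c : bool) : (j <= n)%N ->
  rsum N W (n - j) j c =
  lsum (fun i => N (n - i)%N) (fun i d d' => W (n - i.+1)%N d' d) j c :> K.
Proof.
elim: j c => //= j IH c jn; apply: eq_bigr => d _.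
by rewrite -subSn // subSS IH ?(ltnW jn) //; ring.
Qed.

Lemma prod_banded (G : nat -> nat -> K) n :
  (forall i j, (i.+1 < j)%N || (j.+1 < i)%N -> G i j = 1) ->
  \prod_(0 <= i < n.+1) \prod_(0 <= j < n.+1) G i j =
  (\prod_(0 <= k < n.+1) G k k) * \prod_(0 <= k < n) (G k k.+1 * G k.+1 k).
Proof.
move=> hG; elim: n => [|n IH]; first by rewrite !big_nat1 big_geq // mulr1.
have col : \prod_(0 <= i < n.+1) G i n.+1 = G n n.+1.
  rewrite big_nat_recr //= big_nat big1 ?mul1r // => i /andP[_ hi].
  by rewrite hG // ltnS hi.
have row : \prod_(0 <= j < n.+1) G n.+1 j = G n.+1 n.
  rewrite big_nat_recr //= big_nat big1 ?mul1r // => i /andP[_ hi].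
  by rewrite hG // ltnS hi orbT.
rewrite big_nat_recr //=.
under eq_bigr do rewrite big_nat_recr //=.
rewrite big_split /= IH col [X in _ * X = _]big_nat_recr //= row.
rewrite [X in _ = X * _]big_nat_recr //= [X in _ = _ * X]big_nat_recr //=.
by ring.
Qed.

End TransferForm.

Section StarOfGenerators.
Context {R : realType} {n : nat}.
Variables (eta tau : R[i]) (nu i1 i2 j1 j2 : 'I_n.+1).
Hypotheses (i1nu : (i1 <= nu)%N) (nui2 : (nu <= i2)%N).
Hypotheses (j1nu : (j1 <= nu)%N) (nuj2 : (nu <= j2)%N).
Local Notation h := n.+1.
Local Notation vars := (@vars R h).

(** The exponential by which theta differs from the odd function sigma. *)
Definition ehalf (z : R[i]) := ee (z / 2).
Local Notation sg := (sigma eta).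
Local Notation Th := (th sg ehalf).

Lemma ehalfD y z : ehalf (y + z) = ehalf y * ehalf z.
Proof. by rewrite /ehalf mulrDl eeD. Qed.

Lemma ehalf_neq0 z : ehalf z != 0.
Proof. exact: ee_neq0. Qed.

Hypothesis eta_gt0 : 0 < complex.Im eta.

Lemma theta_th z : theta eta z = Th z.
Proof. exact: theta_sigma. Qed.

Variable p : vars (Ladd (segment i1 i2) (segment j1 j2)).

Definition zvar L (q : vars L) k (c : bool) := natseq (fun i => xv q i c) k.
Definition useq L (q : vars L) := natseq (q.2 0).

Local Notation z := (zvar p).
Local Notation U := (useq p).
Local Notation in1 := (fun k : nat => i1 <= k <= i2)%N.
Local Notation in2 := (fun k : nat => j1 <= k <= j2)%N.

Definition occupied k := ((i1 <= k <= i2) + (j1 <= k <= j2))%N.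

(** At these points the factors of the kernel for colours that are neither equal nor
    adjacent are quotients of equal nonzero numbers, hence 1. *)
Definition regular := forall k k' (c c' : bool), (c < occupied k)%N ->
  (c' < occupied k')%N -> (k, c) != (k', c') -> theta eta (z k c - z k' c') != 0.

Hypothesis zreg : regular.

Definition prefixL (V : nat -> R[i]) k := usum V 0 k.
Definition suffixR (V : nat -> R[i]) k := usum V (h - k) h.
Definition chainL L (q : vars L) (a b : nat) := chain sg ehalf tau (prefixL (useq q)) (zvar q) (fun=> 1) a b nu.
(** Above nu the colours are enumerated downwards from the top n of the diagram, so
    that the partial sums Q start from the top as well, and the reversed edges
    contribute the exponentials of redgeE. *)
Definition chainR L (q : vars L) (a b : nat) :=
  chain sg ehalf tau (suffixR (useq q)) (fun k => zvar q (n - k)%N) (fun a => ehalf (- (2 * a)))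
    (n - a)%N (n - b)%N (n - nu)%N.

Definition top c := Th (z nu c + usum U i1 i2.+1 - 2 * tau) *
  Th (z nu (~~ c) + usum U j1 j2.+1 - 2 * tau * ((i1 == j1)%:R + (i2 == j2)%:R) - 2 * tau).

Local Notation evalue := (@evalue R n eta tau nu).
(* The parameters and the variables of the second factor of the product. *)
Let U' := natseq ((\row_(i < h) (p.2 0 i - 2 * (pairing (segment i1 i2) i)%:~R * tau)) 0).
Let y k c := z k (if (i1 <= k <= i2)%N then ~~ c else c).

Definition nodew k c : R[i] :=
  (c ==> in1 k && in2 k)%:R * (if in1 k && in2 k then kap sg ehalf tau (z k c) (z k (~~ c)) else 1) *
  (if k == nu then top c else 1).

Definition edgew k c d : R[i] :=
  efactor eta tau nu i1 i2 U k (z k c) (z k.+1 d) *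
  efactor eta tau nu j1 j2 U' k (y k c) (y k.+1 d) *
  (if in1 k && in2 k.+1 then ker sg ehalf tau (z k c) (y k.+1 d) else 1) *
  (if in1 k.+1 && in2 k then ker sg ehalf tau (z k.+1 d) (y k c) else 1).

Let le_i1i2 : (i1 <= i2)%N. Proof. exact: leq_trans nui2. Qed.
Let ltn_h (i : 'I_h) : (i <= n)%N. Proof. by rewrite -ltnS. Qed.

Lemma usumB V x w t : (x <= w)%N -> (w <= t)%N -> usum V w t = usum V x t - usum V x w :> R[i].
Proof. by move=> h1 h2; rewrite /usum (@big_cat_nat _ _ _ w x t) //= [RHS]addrC addKr. Qed.

Lemma usum_shift x w : (w <= h)%N ->
  usum U' x w = usum U x w - 2 * tau * (\sum_(x <= j < w) segment_pairing i1 i2 j)%:~R.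
Proof. by move=> wh; exact: usum_segment_shift. Qed.

Lemma y_bext (b : {ffun 'I_h -> bool}) k : natseq (right_var p b) k = y k (bext b k).
Proof.
rewrite /y /zvar /natseq /bext; case: insubP => //= i _ <-.
rewrite /right_var /segment; congr (xv p i _).
by case: (i1 <= i <= i2)%N.
Qed.

Lemma z_bext (b : {ffun 'I_h -> bool}) k : natseq (left_var p b) k = z k (bext b k).
Proof. by rewrite /zvar /natseq /bext; case: insubP. Qed.

Definition cartan_nat (i j : nat) : int :=
  if i == j then 2 else if (i.+1 == j) || (j.+1 == i) then -1 else 0.

Lemma top_shift (c : bool) :
  theta eta (z nu c + usum U i1 i2.+1 - 2 * tau) *
  theta eta (y nu c + usum U' j1 j2.+1 - 2 * tau) = top c.
Proof.
rewrite /top !theta_th /y i1nu nui2 usum_shift ?ltn_ord // sum_segment_pairing.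
congr (_ * Th _); rewrite -!val_eqE /=.
have -> : ((j1 <= i1 < j2.+1)%N : nat)%:Z + (j1 <= i2 < j2.+1)%N%:Z -
    (j1 < i1 <= j2.+1)%N%:Z - (j1 <= i2.+1 < j2.+1)%N%:Z =
    (i1 == j1 :> nat)%:Z + (i2 == j2 :> nat)%:Z :> int by lia.
by rewrite rmorphD /= addrA.
Qed.

(** Each factor belongs to a colour or to a pair of adjacent colours: the generators
    by their very form, and the kernel because G is 1 off the three diagonals. *)
Lemma summandE (b : {ffun 'I_h -> bool}) :
  allowed (segment i1 i2) (segment j1 j2) b ->
  evalue i1 i2 (natseq (left_var p b)) U *
  evalue j1 j2 (natseq (right_var p b)) U' *
  (\prod_(i < h) \prod_(j < h) (if (segment i1 i2 i == 1%N) && (segment j1 j2 j == 1%N) then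
      theta eta (left_var p b i - right_var p b j - (cartan i j)%:~R * tau) /
      theta eta (left_var p b i - right_var p b j) else 1)) =
  (\prod_(0 <= k < h) nodew k (bext b k)) *
  (\prod_(0 <= k < n) edgew k (bext b k) (bext b k.+1)).
Proof.
move=> /forallP hb.
have hbk k : bext b k ==> in1 k && in2 k.
  rewrite /bext; case: insubP => //= i _ <-; have := hb i; rewrite /segment.
  by case: (b i) => //=; case: (_ <= _ <= _)%N; case: (_ <= _ <= _)%N.
pose G i j := if in1 i && in2 j then
  theta eta (z i (bext b i) - y j (bext b j) - (cartan_nat i j)%:~R * tau) /
  theta eta (z i (bext b i) - y j (bext b j)) else 1.
have -> : (\prod_(i < h) \prod_(j < h) (if (segment i1 i2 i == 1%N) && (segment j1 j2 j == 1%N) then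
      theta eta (left_var p b i - right_var p b j - (cartan i j)%:~R * tau) /
      theta eta (left_var p b i - right_var p b j) else 1)) =
    \prod_(0 <= i < h) \prod_(0 <= j < h) G i j.
  rewrite big_mkord; apply: eq_bigr => i _; rewrite big_mkord; apply: eq_bigr => j _.
  rewrite /G -z_bext -y_bext !natseqE /segment !eqb1.
  by case: ifP.
have bpos k : in1 k -> (bext b k < occupied k)%N.
  rewrite /occupied => hk; rewrite hk; have := hbk k; rewrite hk /=.
  by case: (bext b k) => //= ->.
have bpos' k : in2 k -> ((if in1 k then ~~ bext b k else bext b k) < occupied k)%N.
  rewrite /occupied => hk; rewrite hk; have := hbk k; rewrite hk andbT.
  by case: ifP => _; case: (bext b k).
rewrite prod_banded => [|i j hij]; last first.
  rewrite /G; case: ifP => // /andP[hi hj].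
  have -> : cartan_nat i j = 0.
    by rewrite /cartan_nat; case: ifP => [|_]; [|case: ifP => [|//]]; lia.
  rewrite mul0r subr0 divff // /y; apply: zreg; [exact: bpos|exact: bpos'|].
  by rewrite xpair_eqE; lia.
have E1 : evalue i1 i2 (natseq (left_var p b)) U =
    \prod_(0 <= k < n) efactor eta tau nu i1 i2 U k (z k (bext b k)) (z k.+1 (bext b k.+1)) *
    theta eta (z nu (bext b nu) + usum U i1 i2.+1 - 2 * tau).
  rewrite /evalue; apply: (congr2 *%R); last by rewrite -(z_bext b nu).
  by apply: eq_bigr => k _; rewrite -(z_bext b k) -(z_bext b k.+1).
have E2 : evalue j1 j2 (natseq (right_var p b)) U' =
    \prod_(0 <= k < n) efactor eta tau nu j1 j2 U' k (y k (bext b k)) (y k.+1 (bext b k.+1)) *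
    theta eta (y nu (bext b nu) + usum U' j1 j2.+1 - 2 * tau).
  rewrite /evalue; apply: (congr2 *%R); last by rewrite -(y_bext b nu).
  by apply: eq_bigr => k _; rewrite -(y_bext b k) -(y_bext b k.+1).
have E3 : \prod_(0 <= k < h) nodew k (bext b k) =
    (\prod_(0 <= k < h) G k k) * top (bext b nu).
  rewrite /nodew 2!big_split /= big1 ?mul1r => [|k _]; last by rewrite hbk.
  congr (_ * _).
    apply: eq_bigr => k _; rewrite /G /y; case: ifP => // /andP[h1 h2].
    by rewrite h1 /cartan_nat eqxx /kap !theta_th.
  rewrite big_mkord (bigD1 nu) //= eqxx [X in _ * X]big1 ?mulr1 //.
  by move=> k; rewrite -val_eqE => /negbTE /= ->.
have E4 : \prod_(0 <= k < n) edgew k (bext b k) (bext b k.+1) =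
    \prod_(0 <= k < n) efactor eta tau nu i1 i2 U k (z k (bext b k)) (z k.+1 (bext b k.+1)) *
    \prod_(0 <= k < n) efactor eta tau nu j1 j2 U' k (y k (bext b k)) (y k.+1 (bext b k.+1)) *
    \prod_(0 <= k < n) (G k k.+1 * G k.+1 k).
  rewrite -!big_split; apply: eq_bigr => k _ /=; rewrite /edgew -[LHS]mulrA; congr (_ * _).
  rewrite /G /cartan_nat !eqxx /= orbT (ltn_eqF (ltnSn k)) (gtn_eqF (ltnSn k)).
  by rewrite mulN1r opprK /ker !theta_th.
by rewrite E1 E2 E3 E4 -top_shift; ring.
Qed.

Lemma sum_chainE : star eta tau (efun eta tau nu (i1 := i1) (i2 := i2)) (efun eta tau nu (i1 := j1) (i2 := j2)) p =
  \sum_(c : bool) lsum nodew edgew nu c * nodew nu c * rsum nodew edgew nu (n - nu) c.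
Proof.
rewrite -transfer; last exact: ltn_h.
have seg1 (a b i : 'I_h) : (segment a b i <= 1)%N by rewrite /segment; case: (_ <= _ <= _)%N.
rewrite (star_normal eta tau p (seg1 _ _) (seg1 _ _) (fun q => efunE eta tau q i1nu nui2)
  (fun q => efunE eta tau q j1nu nuj2) (efun_on_support eta tau i1nu nui2)
  (efun_on_support eta tau j1nu nuj2)).
rewrite big_mkcond; apply: eq_bigr => b _.
case: ifP => [hb|/negbT]; first exact: summandE.
rewrite negb_forall => /existsP[k].
rewrite negb_imply => /andP[bi hi].
rewrite big_mkord (bigD1 k) //= /nodew bextE bi /=.
have -> : (i1 <= k <= i2)%N && (j1 <= k <= j2)%N = false.
  by move: hi; rewrite /segment; do 2 case: (_ <= _ <= _)%N.
by rewrite !mul0r.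
Qed.

(** Below nu the first factor shifts the partial sums of u for the second factor as
    described by par2: its upper end i2 lies too far up to be seen. *)
Lemma lsum_chainL (c : bool) : lsum nodew edgew nu c = chainL p i1 j1 c.
Proof.
apply: lsum_ext => [k d hk|k d d' hk].
  rewrite /nodew /node_weight /both (ltn_eqF hk) mulr1.
  by rewrite (leq_trans (ltnW hk) nui2) (leq_trans (ltnW hk) nuj2) !andbT.
have e (x w : nat) : (x <= w)%N -> usum U x w = prefixL U w - prefixL U x by exact: usumB.
rewrite /edgew /edge_weight /snd_var /y.
rewrite (leq_trans (ltnW hk) nui2) (leq_trans (ltnW hk) nuj2).
rewrite (leq_trans hk nui2) (leq_trans hk nuj2) !andbT !mul1r; congr (_ * _ * _ * _).
  rewrite /efactor hk andbT [(nu <= k)%N]leqNgt hk /=; case: ifP => // hk1.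
  rewrite /edge !theta_th /par1 e ?leqW //; congr (Th _ / _); ring.
rewrite /efactor hk andbT [(nu <= k)%N]leqNgt hk /=; case: ifP => // hk1.
rewrite /edge !theta_th /par2 usum_shift; last by rewrite ltnW // (leq_ltn_trans hk).
rewrite (e _ _ (leqW hk1)) sum_segment_pairing; congr (Th _ / _).
have -> : ((j1 <= i1 < k.+1)%N : nat)%:Z + (j1 <= i2 < k.+1)%N%:Z -
    (j1 < i1 <= k.+1)%N%:Z - (j1 <= i2.+1 < k.+1)%N%:Z =
    (i1 == j1 :> nat)%:Z - (k.+1 == i1 :> nat)%:Z by lia.
by rewrite rmorphB /=; ring.
Qed.

Lemma suffixRB (k w : nat) : (w <= k.+1)%N ->
  usum U (n - k) (h - w) = suffixR U k.+1 - suffixR U w.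
Proof.
move=> wk; rewrite /suffixR subSS; apply/eqP; rewrite eq_sym subr_eq eq_sym.
rewrite /usum -(@big_cat_nat _ _ _ (h - w)) //=; lia.
Qed.

Lemma redge_mu a x x' : redge sg ehalf a x x' = ehalf (- (2 * a)) * edge sg ehalf a x x'.
Proof. exact: (redgeE (sigmaN eta_gt0) ehalfD ehalf_neq0). Qed.

Lemma efactor_right1 k x x' : (k < n - nu)%N ->
  efactor eta tau nu i1 i2 U (n - k.+1) x' x =
  if (n - i2 <= k)%N then
    ehalf (- (2 * par1 tau (suffixR U) (n - i2)%N k)) *
      edge sg ehalf (par1 tau (suffixR U) (n - i2)%N k) x x' else 1.
Proof.
move=> hk; have hi2 := ltn_h i2.
have f0 : (nu <= n - k.+1)%N by lia.
have f1 : (n - k.+1 < nu)%N = false by lia.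
have f2 : (n - k.+1 < i2)%N = (n - i2 <= k)%N by lia.
rewrite /efactor f0 f1 f2 andbF /=; case: ifP => // hm.
rewrite -redge_mu /redge /par1 !theta_th.
have -> : ((n - k.+1).+1 = n - k)%N by lia.
have -> : i2.+1 = (h - (n - i2))%N by lia.
by rewrite (suffixRB (leqW hm)); congr (Th _ / _); ring.
Qed.

Lemma efactor_right2 k x x' : (k < n - nu)%N ->
  efactor eta tau nu j1 j2 U' (n - k.+1) x' x =
  if (n - j2 <= k)%N then
    ehalf (- (2 * par2 tau (suffixR U) (n - i2)%N (n - j2)%N k)) *
      edge sg ehalf (par2 tau (suffixR U) (n - i2)%N (n - j2)%N k) x x' else 1.
Proof.
move=> hk; have hi2 := ltn_h i2; have hj2 := ltn_h j2.
have f0 : (nu <= n - k.+1)%N by lia.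
have f1 : (n - k.+1 < nu)%N = false by lia.
have f2 : (n - k.+1 < j2)%N = (n - j2 <= k)%N by lia.
rewrite /efactor f0 f1 f2 andbF /=; case: ifP => // hm.
rewrite -redge_mu /redge /par2 !theta_th usum_shift ?ltn_ord //.
rewrite sum_segment_pairing.
have -> : ((n - k.+1).+1 = n - k)%N by lia.
have f3 : (n - k <= i1)%N = false by have := i1nu; lia.
have f4 : (n - k < i1)%N = false by have := i1nu; lia.
rewrite f3 f4 !andFb /= !ltnS.
have -> : 0 + (n - k <= i2 <= j2)%N%:Z - 0 - (n - k <= i2.+1 <= j2)%N%:Z =
    (n - i2 == n - j2)%N%:Z - (k.+1 == n - i2)%N%:Z by lia.
have -> : j2.+1 = (h - (n - j2))%N by lia.
by rewrite (suffixRB (leqW hm)) rmorphB /=; congr (Th _ / _); ring.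
Qed.

Lemma rsum_chainR (c : bool) : rsum nodew edgew nu (n - nu) c = chainR p i2 j2 c.
Proof.
have nun := ltn_h nu.
have -> : rsum nodew edgew nu (n - nu) c = rsum nodew edgew (n - (n - nu)) (n - nu) c.
  by rewrite subKn.
rewrite rsum_lsum ?leq_subr // /chainR /chain.
have hi2 := ltn_h i2; have hj2 := ltn_h j2.
apply: lsum_ext => [k d hk|k d d' hk].
  have hk' : (nu < n - k)%N by lia.
  rewrite /nodew /node_weight /both (gtn_eqF hk') mulr1.
  have -> : (i1 <= n - k <= i2)%N = (n - i2 <= k)%N by lia.
  by have -> : (j1 <= n - k <= j2)%N = (n - j2 <= k)%N by lia.
rewrite /edgew /edge_weight efactor_right1 // efactor_right2 // /snd_var /y.
have -> : ((n - k.+1).+1 = n - k)%N by lia.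
have -> : ((i1 <= n - k.+1 <= i2) = (n - i2 <= k.+1))%N by lia.
have -> : ((j1 <= n - k.+1 <= j2) = (n - j2 <= k.+1))%N by lia.
have -> : ((i1 <= n - k <= i2) = (n - i2 <= k))%N by lia.
have -> : ((j1 <= n - k <= j2) = (n - j2 <= k))%N by lia.
by rewrite [LHS]mulrAC.
Qed.

Lemma star_efun :
  star eta tau (efun eta tau nu (i1 := i1) (i2 := i2)) (efun eta tau nu (i1 := j1) (i2 := j2)) p =
  pairing_sum sg ehalf tau (z nu) (chainL p i1 j1) (chainR p i2 j2) top.
Proof.
rewrite sum_chainE; apply: eq_bigr => c _; rewrite lsum_chainL rsum_chainR.
by rewrite /nodew i1nu nui2 j1nu nuj2 eqxx implybT mul1r.
Qed.

End StarOfGenerators.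

(** * Meromorphic functions and generic points *)
Section HolomorphicFunctions.
Context {R : realType}.
Local Open Scope classical_set_scope.
Local Open Scope ring_scope.

Definition entire (V : normedModType R[i]) (f : V -> R[i]) :=
  forall p, differentiable (f : V -> R[i]^o) p.

Section Closure.
Variable V : normedModType R[i].
Implicit Types f g : V -> R[i].

Lemma entire_cst (c : R[i]) : entire (fun _ : V => c).
Proof. by move=> p; exact: differentiable_cst. Qed.

Lemma entireD f g : entire f -> entire g -> entire (fun p => f p + g p).
Proof. by move=> hf hg p; apply: (@differentiableD _ V R[i]^o f g). Qed.

Lemma entireN f : entire f -> entire (fun p => - f p).
Proof. by move=> hf p; apply: (@differentiableN _ V R[i]^o f). Qed.

Lemma entireB f g : entire f -> entire g -> entire (fun p => f p - g p).
Proof. by move=> hf hg; apply/entireD/entireN. Qed.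

Lemma entireM f g : entire f -> entire g -> entire (fun p => f p * g p).
Proof. by move=> hf hg p; apply: (@differentiableM _ V f g). Qed.

Lemma entire_prod (I : Type) (r : seq I) (P : pred I) (F : I -> V -> R[i]) :
  (forall i, P i -> entire (F i)) -> entire (fun p => \prod_(i <- r | P i) F i p).
Proof.
move=> hF; elim: r => [|i r IH].
  rewrite (_ : (fun p => _) = fun=> 1); first exact: entire_cst.
  by apply/funext => p; rewrite big_nil.
have [Pi|nPi] := boolP (P i); last first.
  by congr entire: IH; apply/funext => p; rewrite big_cons (negbTE nPi).
rewrite (_ : (fun p => _) = fun p => F i p * \prod_(i <- r | P i) F i p).
  exact: entireM (hF _ Pi) IH.
by apply/funext => p; rewrite big_cons Pi.
Qed.

Lemma entire_sum (I : Type) (r : seq I) (P : pred I) (F : I -> V -> R[i]) :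
  (forall i, P i -> entire (F i)) -> entire (fun p => \sum_(i <- r | P i) F i p).
Proof.
move=> hF; elim: r => [|i r IH].
  rewrite (_ : (fun p => _) = fun=> 0); first exact: entire_cst.
  by apply/funext => p; rewrite big_nil.
have [Pi|nPi] := boolP (P i); last first.
  by congr entire: IH; apply/funext => p; rewrite big_cons (negbTE nPi).
rewrite (_ : (fun p => _) = fun p => F i p + \sum_(i <- r | P i) F i p).
  exact: entireD (hF _ Pi) IH.
by apply/funext => p; rewrite big_cons Pi.
Qed.

Lemma entire_linear f : linear (f : V -> R[i]^o) -> continuous (f : V -> R[i]^o) ->
  entire f.
Proof.
move=> lf cf p.
pose F : {linear V -> R[i]^o} := HB.pack (f : V -> R[i]^o) (GRing.isLinear.Build _ _ _ _ _ lf).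
exact: (@linear_differentiable _ _ _ F p cf).
Qed.

Lemma entire_open_neq0 f : entire f -> open [set p | f p != 0].
Proof.
move=> hf; rewrite openE => p /= fp.
have /differentiable_continuous /cvgrPdist_lt /(_ `|f p|) := hf p.
rewrite normr_gt0 => /(_ fp); apply: filterS => q hq.
by apply: contraTneq hq => ->; rewrite subr0 ltxx.
Qed.

End Closure.

Variable eta : R[i].
Hypothesis eta_gt0 : 0 < complex.Im eta.

Lemma entire_theta (V : normedModType R[i]) (f : V -> R[i]) :
  entire f -> entire (fun p => theta eta (f p)).
Proof.
move=> hf p; apply: (@differentiable_comp _ V R[i]^o R[i]^o f (theta eta) p (hf p)).
exact: theta_differentiable.
Qed.

(** Moving along v changes the value of f freely, which is all that is needed to move
    off the zeros of theta. *)
Definition affine_form (V : normedModType R[i]) (f : V -> R[i]) :=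
  entire f /\ exists v : V, forall p (t : R[i]), f (p + t *: v) = f p + t.

Lemma theta_open (V : normedModType R[i]) (f : V -> R[i]) :
  affine_form f -> open [set p | theta eta (f p) != 0].
Proof. by move=> [hf _]; exact/entire_open_neq0/entire_theta. Qed.

(** Near any point the form takes all nearby values, and theta does not vanish
    identically on a disc. *)
Lemma theta_dense (V : normedModType R[i]) (f : V -> R[i]) :
  affine_form f -> dense [set p | theta eta (f p) != 0].
Proof.
move=> [hf [v hv]] O [p Op] oO.
pose K : numFieldType := R[i].
have cl : {for (0 : K), continuous (fun t : K => p + t *: v)}.
  have h := @cvgD K V K (nbhs (0 : K)) _ (fun=> p) (fun t : K => t *: v) p (0 *: v)
    (cvg_cst p) (@scalel_continuous K V v 0).
  exact: h.
have : nbhs (p + (0 : K) *: v) O by rewrite scale0r addr0; exact: open_nbhs_nbhs.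
move=> /cl /nbhs_ballP [e /= e0 he].
have eE : e = (complex.Re e)%:C by rewrite RRe_real // gtr0_real.
have e0' : 0 < complex.Re e by rewrite -ltcR -eE.
have [y hy1 hy2] := theta_nonzero_near eta_gt0 (f p) e0'.
exists (p + (y - f p) *: v); split => /=; last first.
  by rewrite hv addrC subrK.
apply: (he (y - f p)); rewrite -ball_normE /= sub0r normrN eE.
by rewrite nmE ltcR.
Qed.

Lemma theta_open_dense (V : normedModType R[i]) (I : eqType) (s : seq I)
    (f : I -> V -> R[i]) : (forall i, i \in s -> affine_form (f i)) ->
  open [set p | all (fun i => theta eta (f i p) != 0) s] /\
  dense [set p | all (fun i => theta eta (f i p) != 0) s].
Proof.
elim: s => [|i s IH] hf /=.
  have -> : [set p : V | is_true true] = setT by apply/seteqP; split.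
  by split; [exact: openT | move=> O; rewrite setIT].
have [|os ds] := IH; first by move=> j js; apply: hf; rewrite in_cons js orbT.
have hi : affine_form (f i) by apply: hf; rewrite mem_head.
have -> : [set p | (theta eta (f i p) != 0) && all (fun i => theta eta (f i p) != 0) s] =
  [set p | theta eta (f i p) != 0] `&` [set p | all (fun i => theta eta (f i p) != 0) s].
  by apply/seteqP; split => p /=; [move=> /andP | move=> [-> ->]].
split; first by apply: openI => //; exact: theta_open.
by apply: denseI => //; [exact: theta_open | exact: theta_dense].
Qed.

Lemma dense_closure (T : topologicalType) (A : set T) : dense A -> closure A = setT.
Proof.
move=> dA; apply/seteqP; split=> // p _ B; rewrite nbhsE => -[B0 [h1 h2] OB].
have [q [Oq Aq]] := dA B0 (ex_intro _ p h2) h1.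
by exists q; split; [|exact: OB].
Qed.

End HolomorphicFunctions.

Section Forms.
Context {R : realType} {h : nat}.
Local Notation vars := (@vars R h).
Local Open Scope classical_set_scope.
Local Open Scope ring_scope.

Lemma entire_ucoord l i : entire (fun p : vars l => p.2 0 i).
Proof.
apply: entire_linear => [a x y|p]; first by rewrite !mxE.
pose K : numFieldType := R[i].
have c2 := @coord_continuous K 1 h 0 i p.2.
have c1 : (snd : vars l -> 'rV[K]_h) @ p --> p.2 by exact: cvg_snd.
exact: (cvg_comp _ _ c1 c2).
Qed.

Lemma entire_xv l i k : entire (fun p : vars l => xv p i k).
Proof.
rewrite /xv; case: insubP => [a _ _ /=|_ /=]; last exact: entire_cst.
rewrite /xvar.
have -> : (fun p : vars l => submxrow p.1 i 0 a) = (fun p => p.1 0 (tagnat.Rank i a)).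
  by apply/funext => p; rewrite !mxE.
apply: entire_linear => [c x y|p]; first by rewrite !mxE.
pose K : numFieldType := R[i].
have c2 := @coord_continuous K 1 _ 0 (tagnat.Rank i a) p.1.
have c1 : (fst : vars l -> 'rV[K]_(\sum_(i < h) l i)) @ p --> p.1 by exact: cvg_fst.
exact: (cvg_comp _ _ c1 c2).
Qed.

Lemma xv_add l (p q : vars l) (t : R[i]) i k : xv (p + t *: q) i k = xv p i k + t * xv q i k.
Proof.
rewrite /xv; case: insubP => [a _ _ /=|_ /=]; last by rewrite mulr0 addr0.
by rewrite /xvar !mxE.
Qed.

Lemma affine_xdiff l (i j : 'I_h) (a b : nat) : (a < l i)%N -> (b < l j)%N ->
  (i, a) != (j, b) -> affine_form (fun p : vars l => xv p i a - xv p j b).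
Proof.
move=> ai bj ne; split; first by apply: entireB; exact: entire_xv.
exists (@mkvars R h l (fun k c => ((k == i) && (c == a :> nat))%:R) 0) => p t.
rewrite !xv_add.
have xm k c : (c < l k)%N -> xv (@mkvars R h l (fun k c => ((k == i) && (c == a :> nat))%:R) 0) k c =
    ((k == i) && (c == a))%:R.
  by move=> ck; rewrite (xvE _ (Ordinal ck)) xvar_mkvars.
rewrite !xm // !eqxx /= mulr1.
have -> : (j == i) && (b == a) = false.
  by apply/negbTE; move: ne; rewrite xpair_eqE eq_sym [a == b]eq_sym.
by rewrite mulr0 addr0 addrAC.
Qed.

Lemma affine_udiff l (c : 'I_h -> R[i]) (d : R[i]) (i : 'I_h) : c i != 0 ->
  affine_form (fun p : vars l => \sum_(k < h) c k * p.2 0 k + d).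
Proof.
move=> ci; split.
  apply: entireD; last exact: entire_cst.
  apply: entire_sum => k _; apply: entireM; [exact: entire_cst|exact: entire_ucoord].
exists ((0, (c i)^-1 *: delta_mx 0 i) : vars l) => p t.
rewrite addrAC; congr (_ + _).
transitivity (\sum_(k < h) (c k * p.2 0 k + (if k == i then t else 0))).
  apply: eq_bigr => k _; rewrite !mxE eqxx /= mulrDr; congr (_ + _).
  have [->|ki] := eqVneq k i; last by rewrite !mulr0.
  by rewrite mulr1 mulrCA mulfV // mulr1.
by rewrite big_split /= -big_mkcond big_pred1_eq.
Qed.

End Forms.

Section GenericPoints.
Context {R : realType} {h : nat}.
Local Notation vars := (@vars R h).
Local Open Scope classical_set_scope.
Local Open Scope ring_scope.
Variable eta : R[i].
Hypothesis eta_gt0 : 0 < complex.Im eta.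

Definition separated_point L (p : vars L) := forall (i j : 'I_h) (a b : nat),
  (a < L i)%N -> (b < L j)%N -> (i, a) != (j, b) -> theta eta (xv p i a - xv p j b) != 0.

(** Finitely many differences of coordinates and two further forms are to avoid the zeros
    of theta; each of these conditions is open and dense. *)
Lemma generic_set L (f1 f2 : vars L -> R[i]) : affine_form f1 -> affine_form f2 ->
  exists D : set (vars L : normedModType R[i]), [/\ open D, dense D &
    forall p, D p -> [/\ separated_point p, theta eta (f1 p) != 0 & theta eta (f2 p) != 0]].
Proof.
move=> h1 h2; pose T := {i : 'I_h & 'I_(L i)}.
pose g (w : T * T) (p : vars L) := xv p (tag w.1) (tagged w.1) - xv p (tag w.2) (tagged w.2).
pose s := [seq w <- enum {: T * T} | w.1 != w.2].
have hg w : w \in s -> affine_form (g w).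
  rewrite mem_filter => /andP[ne _]; apply: affine_xdiff => //.
  case: w ne => -[i a] [j b] /=; apply: contra => /eqP[].
  move=> e; case: j / e b => b e; apply/eqP; congr existT; exact: val_inj.
pose V : normedModType R[i] := vars L.
pose A0 : set V := [set p | all (fun w => theta eta (g w p) != 0) s].
pose A1 : set V := [set p | theta eta (f1 p) != 0].
pose A2 : set V := [set p | theta eta (f2 p) != 0].
have [os ds] : open A0 /\ dense A0 by exact: theta_open_dense.
have [c1 d1] : open A1 /\ dense A1 by split; [exact: theta_open | exact: theta_dense].
have [c2 d2] : open A2 /\ dense A2 by split; [exact: theta_open | exact: theta_dense].
exists (A0 `&` (A1 `&` A2)); split.
- by apply: openI => //; exact: openI.
- by apply: denseI => //; exact: denseI.
move=> p [/= hs [k1 k2]]; split => // i j a b ai bj ne.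
have := allP hs (Tagged (fun i => 'I_(L i)) (Ordinal ai), Tagged (fun i => 'I_(L i)) (Ordinal bj)).
apply; rewrite mem_filter mem_enum andbT /=.
apply: contra ne => /eqP e; apply/eqP; congr (_, _).
  exact: (congr1 (@tag _ _) e).
exact: (congr1 (fun w : T => nat_of_ord (tagged w)) e).
Qed.

Lemma mero_eq_everywhere (V : normedModType R[i]) (f g : V -> R[i]) : (forall p, f p = g p) -> mero_eq f g.
Proof.
move=> fg; exists setT; split; [exact: openT| |by move=> p _].
by move=> O [p Op] oO; exists p.
Qed.

Lemma entire_meromorphic (V : normedModType R[i]) (f : V -> R[i]) : entire f -> meromorphic f.
Proof.
move=> hf p; exists setT, f, (fun=> 1); split.
- by split; [exact: openT|].
- by move=> q _; exact: hf.
- by move=> q _; exact: entire_cst.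
- by move=> q _ B /nbhs_singleton Bq; exists q; split => //=; exact: oner_neq0.
by move=> q _ _; rewrite divr1.
Qed.

Lemma meromorphic_fraction (V : normedModType R[i]) (f g d : V -> R[i]) : entire g -> entire d ->
  dense [set p | d p != 0] -> (forall p, f p = g p / d p) -> meromorphic f.
Proof.
move=> hg hd dd e p; exists setT, g, d; split.
- by split; [exact: openT|].
- by move=> q _; exact: hg.
- by move=> q _; exact: hd.
- by rewrite dense_closure.
by move=> q _ _; exact: e.
Qed.

End GenericPoints.

Section Membership.
Context {R : realType} {n : nat}.
Local Notation h := n.+1.
Local Notation vars := (@vars R h).
Local Open Scope classical_set_scope.
Local Open Scope ring_scope.
Variables (eta tau : R[i]).
Hypothesis eta_gt0 : 0 < complex.Im eta.

Lemma homF_inF l (f : vars l -> R[i]) : meromorphic f ->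
  (forall s p, f (permvars s p) = f p) -> inF (homF f).
Proof.
move=> mf sf; split=> [m|].
  have [E|ne] := pselect (m = l).
    case: l / E f mf sf => f mf sf; rewrite homF_eq; split => // s.
    by apply: mero_eq_everywhere => p; exact: sf.
  rewrite homF_neq //; split; first exact/entire_meromorphic/entire_cst.
  by move=> s; exact: mero_eq_everywhere.
exists (\sum_(i < h) l i)%N => m hm; rewrite homF_neq; first exact: mero_eq_everywhere.
by move=> E; rewrite E ltnn in hm.
Qed.

Lemma permvars_le1 l (s : forall i : 'I_h, 'S_(l i)) (p : vars l) :
  (forall i, (l i <= 1)%N) -> permvars s p = p.
Proof.
move=> l1; rewrite -[RHS]mkvars_xvar /permvars; congr mkvars.
apply: fun2_ext => i a; congr (xvar p _); apply: val_inj.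
have small (b : 'I_(l i)) : b = 0%N :> nat.
  by apply/eqP; rewrite -leqn0 -ltnS (leq_trans (ltn_ord b)).
by rewrite /= !small.
Qed.

Lemma segment_le1 (a b i : 'I_h) : (segment a b i <= 1)%N.
Proof. by rewrite /segment; case: (_ <= _ <= _)%N. Qed.

Lemma permvars_funF (c : 'rV[R[i]]_h -> R[i]) L (s : forall i : 'I_h, 'S_(L i)) p :
  @funF R h c L (permvars s p) = @funF R h c L p.
Proof. by rewrite /funF /homF; case: pselect => // E; rewrite !castvars2. Qed.

Lemma funF_inF (c : 'rV[R[i]]_h -> R[i]) :
  entire (fun p : vars Lzero => c p.2) -> inF (funF c).
Proof. by move=> hc; apply: homF_inF => //; exact: entire_meromorphic. Qed.

Lemma entire_natseq_x l k : entire (fun p : vars l => natseq ((xv p)^~ 0%N) k).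
Proof.
rewrite /natseq; case: insubP => [i _ _ /=|_ /=]; last exact: entire_cst.
exact: entire_xv.
Qed.

Lemma entire_natseq_u l k : entire (fun p : vars l => natseq (p.2 0) k).
Proof.
rewrite /natseq; case: insubP => [i _ _ /=|_ /=]; last exact: entire_cst.
exact: entire_ucoord.
Qed.

Lemma entire_usum l x y : entire (fun p : vars l => usum (natseq (p.2 0)) x y).
Proof. by apply: entire_sum => k _; exact: entire_natseq_u. Qed.

Lemma efun_meromorphic (nu i1 i2 : 'I_h) : (i1 <= nu)%N -> (nu <= i2)%N ->
  meromorphic (efun eta tau nu (i1 := i1) (i2 := i2)).
Proof.
move=> h1 h2.
pose x (p : vars (segment i1 i2)) k := natseq ((xv p)^~ 0%N) k.
pose u (p : vars (segment i1 i2)) := natseq (p.2 0).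
pose num k p := if (i1 <= k < nu)%N then
    theta eta (x p k - x p k.+1 + usum (u p) i1 k.+1 - tau)
  else if (nu <= k < i2)%N then
    theta eta (x p k - x p k.+1 - usum (u p) k.+1 i2.+1 + tau) else 1.
pose den k p := if (i1 <= k < i2)%N then theta eta (x p k - x p k.+1) else 1.
pose V : normedModType R[i] := vars (segment i1 i2).
apply: (@meromorphic_fraction R V (efun eta tau nu (i1 := i1) (i2 := i2))
  (fun p => (\prod_(0 <= k < n) num k p) *
     theta eta (x p nu + usum (u p) i1 i2.+1 - 2 * tau))
  (fun p => \prod_(0 <= k < n) den k p)).
- apply: entireM.
    apply: entire_prod => k _; rewrite /num.
    case: (i1 <= k < nu)%N; last case: (nu <= k < i2)%N; last exact: entire_cst.
      apply: (entire_theta eta_gt0); apply: entireB; last exact: entire_cst.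
      apply: entireD; last exact: entire_usum.
      by apply: entireB; exact: entire_natseq_x.
    apply: (entire_theta eta_gt0); apply: entireD; last exact: entire_cst.
    apply: entireB; last exact: entire_usum.
    by apply: entireB; exact: entire_natseq_x.
  apply: (entire_theta eta_gt0); apply: entireB; last exact: entire_cst.
  by apply: entireD; [exact: entire_natseq_x|exact: entire_usum].
- apply: entire_prod => k _; rewrite /den; case: (i1 <= k < i2)%N; last exact: entire_cst.
  by apply: (entire_theta eta_gt0); apply: entireB; exact: entire_natseq_x.
- have hs k : k \in [seq k <- index_iota 0 n | (i1 <= k < i2)%N] ->
      affine_form (fun p : vars (segment i1 i2) => x p k - x p k.+1).
    rewrite mem_filter => /andP[/andP[k1 k2] _].
    have kh : (k.+1 < h)%N by rewrite (leq_ltn_trans k2).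
    have kh' : (k < h)%N by apply: ltnW.
    rewrite (_ : (fun p => _) = fun p : vars (segment i1 i2) =>
      xv p (Ordinal kh') 0 - xv p (Ordinal kh) 0); last first.
      apply/funext => p; rewrite /x -[k]/(nat_of_ord (Ordinal kh')).
      by rewrite -[(Ordinal kh').+1]/(nat_of_ord (Ordinal kh)) !natseqE.
    apply: affine_xdiff; rewrite /segment /= ?k1 ?k2 ?(leqW k1) ?(ltnW k2) //.
    by rewrite xpair_eqE -val_eqE /= ltn_eqF.
  have [_ ds] := @theta_open_dense R eta eta_gt0 V _ _ _ hs.
  rewrite (_ : [set p | _] = [set p | all (fun k => theta eta (x p k - x p k.+1) != 0)
    [seq k <- index_iota 0 n | (i1 <= k < i2)%N]]) //.
  apply/seteqP; split => p /=; rewrite prodf_seq_neq0 => /allP hp; apply/allP => k.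
    rewrite mem_filter => /andP[hk kn]; have := hp k kn.
    by rewrite /den hk.
  move=> kn; rewrite /den /=; case: ifP => hk; last exact: oner_neq0.
  by apply: (hp k); rewrite mem_filter hk.
move=> p; rewrite efunE // /evalue mulrAC -prodfV -big_split; congr (_ * _).
apply: eq_bigr => k _; rewrite /efactor /num /den /= -/(x p k) -/(x p k.+1) -/(u p).
have [hk|hk] := leqP nu k.
  by rewrite ?andbF (leq_trans h1 hk) /=; case: ifP => _; rewrite ?invr1 ?mulr1.
by rewrite (leq_trans hk h2) ?andbF ?andbT /=; case: ifP => _; rewrite ?invr1 ?mulr1.
Qed.

Lemma efun_permvars (nu i1 i2 : 'I_h) s (p : vars (segment i1 i2)) :
  efun eta tau nu (permvars s p) = efun eta tau nu p.
Proof. by rewrite permvars_le1 // => i; exact: segment_le1. Qed.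

Lemma homF_efun_permvars (nu i1 i2 : 'I_h) L (s : forall i : 'I_h, 'S_(L i)) p :
  @homF R h _ (efun eta tau nu (i1 := i1) (i2 := i2)) L (permvars s p) =
  @homF R h _ (efun eta tau nu (i1 := i1) (i2 := i2)) L p.
Proof.
have [E|ne] := pselect (L = segment i1 i2); last by rewrite !homF_neq.
rewrite permvars_le1 // => i; rewrite E; exact: segment_le1.
Qed.

Lemma vfunE (nu i : 'I_h) (u : 'rV[R[i]]_h) : vfun nu i u = usum (natseq (u 0)) i nu.+1.
Proof. by apply: (@sum_ord_usum _ _ (fun k => i <= k <= nu)%N). Qed.

Lemma wfunE (nu i : 'I_h) (u : 'rV[R[i]]_h) : wfun nu i u = usum (natseq (u 0)) nu i.+1.
Proof. by apply: (@sum_ord_usum _ _ (fun k => nu <= k <= i)%N). Qed.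

Lemma vfun_inF (nu i : 'I_h) : inF (@funF R h (vfun nu i)).
Proof. by apply: funF_inF; apply: entire_sum => k _; exact: entire_ucoord. Qed.

Lemma wfun_inF (nu i : 'I_h) : inF (@funF R h (wfun nu i)).
Proof. by apply: funF_inF; apply: entire_sum => k _; exact: entire_ucoord. Qed.

Lemma efun_inF (nu i1 i2 : 'I_h) : (i1 <= nu)%N -> (nu <= i2)%N ->
  inF (homF (efun eta tau nu (i1 := i1) (i2 := i2))).
Proof.
move=> h1 h2; apply: homF_inF; first exact: efun_meromorphic.
by move=> s p; exact: efun_permvars.
Qed.

End Membership.

(** * Exchange relations between the chains of two generators *)
Section Relations.
Context {R : realType} {n : nat}.
Local Notation h := n.+1.
Local Notation vars := (@vars R h).
Variables (eta tau : R[i]) (nu : 'I_h).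
Hypothesis eta_gt0 : 0 < complex.Im eta.
Local Notation sg := (sigma eta).
Local Notation Th := (th sg ehalf).
Local Notation chL := (chainL eta tau nu).
Local Notation chR := (chainR eta tau nu).
Local Notation ef i1 i2 := (efun eta tau nu (i1 := i1) (i2 := i2)).
Local Notation mul := (@mulF R h eta tau).

Let sN z : sg (- z) = - sg z. Proof. exact: sigmaN. Qed.
Let fay m a b g :
  sg (m + a + b) * sg (a - b) * sg (m + g) * sg g -
  sg (m + a + g) * sg (a - g) * sg (m + b) * sg b +
  sg (m + a) * sg a * sg (m + b + g) * sg (b - g) = 0.
Proof. exact: sigma_three_term. Qed.

Lemma zvar_castvars L L' (E : L = L') (p : vars L) : zvar (castvars E p) = zvar p.
Proof. by case: L' / E. Qed.

Lemma ehalf_2tau : ehalf (2 * tau) = cexp (twopii * tau).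
Proof. by rewrite /ehalf /ee; congr (cexp (_ * _)); field. Qed.

Lemma cexpN (z : R[i]) : cexp (- z) = (cexp z)^-1.
Proof.
by apply: (mulfI (cexp_neq0 z)); rewrite -cexpD subrr cexp0 divff ?cexp_neq0.
Qed.

Lemma ehalfN (z : R[i]) : ehalf (- z) = (ehalf z)^-1.
Proof. by rewrite /ehalf mulNr eeN. Qed.

Section AtPoint.
Variables (L : Lplus h) (p : vars L).
Hypothesis psep : separated_point eta p.

Definition top_at (a1 a2 b1 b2 : nat) c :=
  Th (zvar p nu c + usum (useq p) a1 a2.+1 - 2 * tau) *
  Th (zvar p nu (~~ c) + usum (useq p) b1 b2.+1 -
      2 * tau * ((a1 == b1)%:R + (a2 == b2)%:R) - 2 * tau).

Lemma star_at (i1 i2 j1 j2 : 'I_h) (E : L = Ladd (segment i1 i2) (segment j1 j2)) :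
  (i1 <= nu)%N -> (nu <= i2)%N -> (j1 <= nu)%N -> (nu <= j2)%N ->
  star eta tau (ef i1 i2) (ef j1 j2) (castvars E p) =
  pairing_sum sg ehalf tau (zvar p nu) (chL p i1 j1) (chR p i2 j2) (top_at i1 i2 j1 j2).
Proof.
move=> h1 h2 h3 h4.
have zreg : regular eta (castvars E p).
  move=> k k' c c' kc kc' ne; rewrite zvar_castvars.
  have occ k0 : (0 < occupied i1 i2 j1 j2 k0)%N -> (k0 < h)%N.
    rewrite /occupied; have := ltn_ord i2; have := ltn_ord j2.
    by case: ltnP => //; lia.
  have kh := occ _ (leq_ltn_trans (leq0n _) kc).
  have kh' := occ _ (leq_ltn_trans (leq0n _) kc').
  rewrite /zvar !(natseqE _ (Ordinal kh)) !(natseqE _ (Ordinal kh')).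
  apply: psep; rewrite ?E //.
  apply: contra ne => /eqP[-> e]; rewrite xpair_eqE eqxx /=.
  by move: e; case: (c); case: (c').
rewrite (star_efun tau h1 h2 h3 h4 eta_gt0 zreg).
rewrite /chainL /chainR /pairing_sum; apply: eq_bigr => c _.
by rewrite /top /top_at /useq castvars2 zvar_castvars.
Qed.

Lemma separatedL (i1 i2 j1 j2 : 'I_h) : L = Ladd (segment i1 i2) (segment j1 j2) ->
  (nu <= i2)%N -> (nu <= j2)%N ->
  separated sg (zvar p) i1 j1 nu.
Proof.
move=> E h2 h4 k k' c c' kn kn'; rewrite /present /both => pc pc' ne.
have kh : (k < h)%N by apply: leq_ltn_trans (ltn_ord nu).
have kh' : (k' < h)%N by apply: leq_ltn_trans (ltn_ord nu).
have occ k0 c0 (k0h : (k0 < h)%N) : (k0 <= nu)%N ->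
    ((i1 <= k0) || (j1 <= k0))%N && (c0 ==> (i1 <= k0) && (j1 <= k0))%N ->
    (c0 < L (Ordinal k0h))%N.
  move=> kn0; rewrite E /Ladd /segment /= !(leq_trans kn0) // !andbT.
  by case: c0 => /=; case: (i1 <= k0)%N => //=; case: (j1 <= k0)%N.
rewrite -(th_neq0 sg ehalf_neq0) -theta_th /zvar.
rewrite -[k]/(nat_of_ord (Ordinal kh)) -[k']/(nat_of_ord (Ordinal kh')) !natseqE.
apply: psep; [exact: occ|exact: occ|].
apply: contra ne => /eqP[-> e]; rewrite xpair_eqE eqxx /=.
by move: e; case: (c); case: (c').
Qed.

Lemma separatedR (i1 i2 j1 j2 : 'I_h) : L = Ladd (segment i1 i2) (segment j1 j2) ->
  (i1 <= nu)%N -> (j1 <= nu)%N -> (nu <= i2)%N -> (nu <= j2)%N ->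
  separated sg (fun k => zvar p (n - k)%N) (n - i2)%N (n - j2)%N (n - nu)%N.
Proof.
move=> E h1 h3 h2 h4 k k' c c' kn kn'; rewrite /present /both => pc pc' ne.
have kh : (n - k < h)%N by rewrite ltnS leq_subr.
have kh' : (n - k' < h)%N by rewrite ltnS leq_subr.
have nun : (nu <= n)%N by rewrite -ltnS.
have i2n : (i2 <= n)%N by rewrite -ltnS.
have j2n : (j2 <= n)%N by rewrite -ltnS.
have occ k0 c0 (k0h : (n - k0 < h)%N) : (k0 <= n - nu)%N ->
    ((n - i2 <= k0) || (n - j2 <= k0))%N && (c0 ==> (n - i2 <= k0) && (n - j2 <= k0))%N ->
    (c0 < L (Ordinal k0h))%N.
  move=> kn0; rewrite E /Ladd /segment /=.
  have -> : (i1 <= n - k0)%N by lia.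
  have -> : (j1 <= n - k0)%N by lia.
  have -> : (n - k0 <= i2)%N = (n - i2 <= k0)%N by lia.
  have -> : (n - k0 <= j2)%N = (n - j2 <= k0)%N by lia.
  by case: c0 => /=; case: (n - i2 <= k0)%N => //=; case: (n - j2 <= k0)%N.
rewrite -(th_neq0 sg ehalf_neq0) -theta_th /zvar.
rewrite -[(n - k)%N]/(nat_of_ord (Ordinal kh)) -[(n - k')%N]/(nat_of_ord (Ordinal kh')) !natseqE.
apply: psep; [exact: occ|exact: occ|].
apply: contra ne => /eqP[e1 e2]; rewrite xpair_eqE.
have -> : k = k' by lia.
by move: e2; rewrite eqxx /=; case: (c); case: (c').
Qed.

Lemma genericnu (i1 i2 j1 j2 : 'I_h) : L = Ladd (segment i1 i2) (segment j1 j2) ->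
  (i1 <= nu)%N -> (nu <= i2)%N -> (j1 <= nu)%N -> (nu <= j2)%N ->
  generic2 sg (zvar p nu).
Proof.
move=> E h1 h2 h3 h4; have hs := separatedL E h2 h4.
have hb : both i1 j1 nu by rewrite /both h1 h3.
by have [] := separated_generic hs hb (leqnn _).
Qed.

(** The parameter V of the exchange is the difference of the values of v, and that
    above nu the difference of the values of w. *)
Definition vdiff (i j : nat) := usum (useq p) i nu.+1 - usum (useq p) j nu.+1.
Definition wdiff (i j : nat) := usum (useq p) nu i.+1 - usum (useq p) nu j.+1.

Lemma exchL (i1 i2 j1 j2 : 'I_h) : L = Ladd (segment i1 i2) (segment j1 j2) ->
  (i1 <= nu)%N -> (nu <= i2)%N -> (j1 <= nu)%N -> (nu <= j2)%N -> i1 != j1 ->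
  exch sg ehalf tau (vdiff i1 j1) (qfac tau j1 i1)^-1 (zvar p nu) (chL p i1 j1) (chL p j1 i1).
Proof.
move=> E h1 h2 h3 h4 ne; have hs := separatedL E h2 h4.
have := @chain_exch _ sg ehalf sN ehalfD ehalf_neq0 fay tau (prefixL (useq p)) (zvar p)
  (fun=> 1) 1 (fun a => esym (mulr1 1)) (oner_neq0 _) i1 j1 nu ne h1 h3 hs.
have -> : prefixL (useq p) j1 - prefixL (useq p) i1 = vdiff i1 j1.
  rewrite /vdiff /prefixL (@usumB _ _ 0 i1 nu.+1) ?leqW //.
  by rewrite (@usumB _ _ 0 j1 nu.+1) ?leqW //; ring.
rewrite /qfac mulr1 divr1 ehalfN ehalf_2tau cexpN.
by case: ltngtP ne => //=; rewrite ?invrK // => /val_inj ->; rewrite eqxx.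
Qed.

(** The exponentials mu of the reversed edges have kappa = ehalf (- (4 * tau)), which
    turns the factor ehalf (2 * tau) of chain_exch into its inverse.  Since the
    reversed numbering also reverses the order of i2 and j2, both sides of nu end up
    with the same convention for q. *)
Lemma exchR (i1 i2 j1 j2 : 'I_h) : L = Ladd (segment i1 i2) (segment j1 j2) ->
  (i1 <= nu)%N -> (nu <= i2)%N -> (j1 <= nu)%N -> (nu <= j2)%N -> i2 != j2 ->
  exch sg ehalf tau (wdiff i2 j2) (qfac tau j2 i2)^-1 (zvar p nu) (chR p i2 j2) (chR p j2 i2).
Proof.
move=> E h1 h2 h3 h4 ne; have hs := separatedR E h1 h3 h2 h4.
have nun : (nu <= n)%N by rewrite -ltnS.
have i2n : (i2 <= n)%N by rewrite -ltnS.
have j2n : (j2 <= n)%N by rewrite -ltnS.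
have mus a : ehalf (- (2 * (a + 2 * tau))) = ehalf (- (2 * a)) * ehalf (- (4 * tau)).
  by rewrite -ehalfD; congr ehalf; ring.
have ne' : (n - i2 != n - j2)%N by move: ne; rewrite -val_eqE /=; lia.
have := @chain_exch _ sg ehalf sN ehalfD ehalf_neq0 fay tau (suffixR (n := n) (useq p))
  (fun k => zvar p (n - k)%N) (fun a => ehalf (- (2 * a))) _ mus (ehalf_neq0 _)
  _ _ _ ne' (leq_sub2l _ h2) (leq_sub2l _ h4) hs.
rewrite (subKn nun).
have -> : suffixR (n := n) (useq p) (n - j2)%N - suffixR (n := n) (useq p) (n - i2)%N = wdiff i2 j2.
  rewrite /wdiff /suffixR.
  have -> : (h - (n - j2) = j2.+1)%N by lia.
  have -> : (h - (n - i2) = i2.+1)%N by lia.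
  rewrite (@usumB _ _ nu j2.+1 h (leqW h4) (ltn_ord j2)).
  by rewrite (@usumB _ _ nu i2.+1 h (leqW h2) (ltn_ord i2)); ring.
have -> : (n - i2 < n - j2)%N = (j2 < i2)%N by lia.
have e4 : ehalf (- (4 * tau)) = ehalf (2 * tau) ^- 2.
  rewrite ehalfN; congr (_^-1); rewrite expr2 -ehalfD; congr ehalf; ring.
rewrite /qfac e4 ehalfN ehalf_2tau cexpN.
have c0 := cexp_neq0 (twopii * tau).
have a1 x : x != 0 -> x * x ^- 2 = x^-1 :> R[i] by move=> x0; field.
have a2 x : x != 0 -> x^-1 / x ^- 2 = (x^-1)^-1 :> R[i] by move=> x0; field.
rewrite (a1 _ c0) (a2 _ c0).
by case: ltngtP ne => //= /val_inj ->; rewrite eqxx.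
Qed.

Lemma symmL (i1 i2 j2 : 'I_h) : L = Ladd (segment i1 i2) (segment i1 j2) ->
  (i1 <= nu)%N -> (nu <= i2)%N -> (nu <= j2)%N ->
  forall c, chL p i1 i1 c = chL p i1 i1 (~~ c).
Proof.
move=> E h1 h2 h4; have hs := separatedL E h2 h4.
exact: (@chain_symm _ sg ehalf sN ehalfD ehalf_neq0 fay tau (prefixL (useq p)) (zvar p)
  (fun=> 1) _ _ h1 hs).
Qed.

Lemma symmR (i1 j1 i2 : 'I_h) : L = Ladd (segment i1 i2) (segment j1 i2) ->
  (i1 <= nu)%N -> (nu <= i2)%N -> (j1 <= nu)%N ->
  forall c, chR p i2 i2 c = chR p i2 i2 (~~ c).
Proof.
move=> E h1 h2 h3; have hs := separatedR E h1 h3 h2 h2.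
exact: (@chain_symm _ sg ehalf sN ehalfD ehalf_neq0 fay tau (suffixR (n := n) (useq p))
  (fun k => zvar p (n - k)%N) (fun a => ehalf (- (2 * a))) _ _ (leq_sub2l _ h2) hs).
Qed.

End AtPoint.

End Relations.

(** * The commutation relations *)
Section GeneratorRelations.
Context {R : realType} {n : nat}.
Local Notation h := n.+1.
Local Notation vars := (@vars R h).
Variables (eta tau : R[i]) (nu : 'I_h).
Hypothesis eta_gt0 : 0 < complex.Im eta.
Local Notation sg := (sigma eta).
Local Notation ef i1 i2 := (efun eta tau nu (i1 := i1) (i2 := i2)).
Local Notation mul a b L p := (@mulF R h eta tau a b L p).
Local Notation gen i1 i2 := (homF (ef i1 i2)).

Lemma qfacV (a b : 'I_h) : (qfac tau a b)^-1 = qfac tau b a.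
Proof. by rewrite /qfac cexpN; case: ltngtP => //; rewrite ?invrK ?invr1. Qed.

Lemma qfac_neq0 (a b : 'I_h) : qfac tau a b != 0.
Proof. by rewrite /qfac; case: ltngtP => _; rewrite ?cexp_neq0 ?oner_neq0. Qed.

Lemma LaddC (l l' : Lplus h) : Ladd l l' = Ladd l' l.
Proof. by apply/funext => i; rewrite /Ladd addnC. Qed.

Lemma Ladd_exchange (i1 i2 j1 j2 : 'I_h) :
  (i1 <= nu)%N -> (nu <= i2)%N -> (j1 <= nu)%N -> (nu <= j2)%N ->
  Ladd (segment i1 i2) (segment j1 j2) = Ladd (segment i1 j2) (segment j1 i2).
Proof.
move=> h1 h2 h3 h4; apply/funext => k; rewrite /Ladd /segment.
have [kn|kn] := leqP k nu.
  by rewrite !(leq_trans kn).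
by rewrite (leq_trans h1 (ltnW kn)) (leq_trans h3 (ltnW kn)) addnC.
Qed.

(** The two sides of nu enter the pairing symmetrically. *)
Lemma pairing_sumC (z A B T : bool -> R[i]) :
  pairing_sum sg ehalf tau z A B T = pairing_sum sg ehalf tau z B A T.
Proof. by apply: eq_bigr => c _; ring. Qed.

Section Degree.
Variables (i1 i2 j1 j2 : 'I_h).
Hypotheses (h1 : (i1 <= nu)%N) (h2 : (nu <= i2)%N) (h3 : (j1 <= nu)%N) (h4 : (nu <= j2)%N).
Variables (L : Lplus h) (p : vars L).
Hypothesis psep : separated_point eta p.
Local Notation U := (useq p).

Lemma usum0 x y : (x <= y)%N -> usum U x y = prefixL U y - prefixL U x.
Proof. exact: usumB. Qed.

(** exchange_pair, with r adjusted so that the arguments of the factor of colour nu are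
    those of the three products of generators. *)
Lemma relation_distinct (E : L = Ladd (segment i1 i2) (segment j1 j2)) :
  i1 != j1 -> i2 != j2 ->
  theta eta (vfun nu i1 p.2 - vfun nu j1 p.2) != 0 ->
  theta eta (wfun nu j2 p.2 - wfun nu i2 p.2 - 2 * tau) != 0 ->
  mul (gen i1 i2) (gen j1 j2) L p =
  theta eta (vfun nu i1 p.2 - vfun nu j1 p.2 - 2 * tau) *
  theta eta (wfun nu j2 p.2 - wfun nu i2 p.2) * qfac tau j1 i1 * qfac tau j2 i2 /
  (theta eta (vfun nu i1 p.2 - vfun nu j1 p.2) *
   theta eta (wfun nu j2 p.2 - wfun nu i2 p.2 - 2 * tau)) *
  mul (gen j1 j2) (gen i1 i2) L p +
  theta eta (- (2 * tau)) * qfac tau j2 i2 *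
  theta eta (wfun nu j2 p.2 - wfun nu i2 p.2 - vfun nu i1 p.2 + vfun nu j1 p.2) /
  (theta eta (vfun nu j1 p.2 - vfun nu i1 p.2) *
   theta eta (wfun nu j2 p.2 - wfun nu i2 p.2 - 2 * tau)) *
  mul (gen i1 j2) (gen j1 i2) L p.
Proof.
move=> ne1 ne2.
have E2 : L = Ladd (segment j1 j2) (segment i1 i2) by rewrite E LaddC.
have E3 : L = Ladd (segment i1 j2) (segment j1 i2) by rewrite E; exact: Ladd_exchange.
rewrite (mulF_homF _ _ _ _ _ E) (mulF_homF _ _ _ _ _ E2) (mulF_homF _ _ _ _ _ E3).
rewrite (star_at tau eta_gt0 psep E h1 h2 h3 h4) (star_at tau eta_gt0 psep E2 h3 h4 h1 h2).
rewrite (star_at tau eta_gt0 psep E3 h1 h4 h3 h2) !vfunE !wfunE -!/(useq p).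
set V := usum U i1 nu.+1 - usum U j1 nu.+1.
set W := usum U nu j2.+1 - usum U nu i2.+1.
rewrite !theta_th => nV nW.
pose r := usum U i1 j2.+1 - 2 * tau.
have hA := exchL tau eta_gt0 psep E h1 h2 h3 h4 ne1.
have ne2' : j2 != i2 by rewrite eq_sym.
have hB := exchR tau eta_gt0 psep E3 h1 h4 h3 h2 ne2'.
have g := genericnu psep E h1 h2 h3 h4.
rewrite qfacV in hB.
have qA : (qfac tau j1 i1)^-1 != 0 by rewrite invr_eq0 qfac_neq0.
have := exchange_pair (sigmaN eta_gt0) (@ehalfD R) (@ehalf_neq0 R) (sigma_three_term eta_gt0)
  r g nV nW qA hA hB.
rewrite invrK.
have u1 : usum U i1 i2.+1 = r + 2 * tau - W.
  rewrite /r /W !usum0 ?(leq_trans h1) ?leqW //; try lia; ring.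
have u2 : usum U j1 j2.+1 = r + 2 * tau - V.
  rewrite /r /V !usum0 ?leqW //; try lia; ring.
have u3 : usum U j1 i2.+1 = r + 2 * tau - V - W.
  rewrite /r /V /W !usum0 ?leqW //; try lia; ring.
have u4 : usum U i1 j2.+1 = r + 2 * tau by rewrite /r subrK.
have n1 : (i1 == j1 :> nat) = false by exact: negbTE.
have n2 : (i2 == j2 :> nat) = false by exact: negbTE.
have T1 c : th sg ehalf (zvar p nu c + r - W) * th sg ehalf (zvar p nu (~~ c) + r - V) =
    top_at eta tau nu p i1 i2 j1 j2 c.
  rewrite /top_at u1 u2 n1 n2; congr (th _ _ _ * th _ _ _); rewrite /=; ring.
have T2 c : th sg ehalf (zvar p nu c + r - V) * th sg ehalf (zvar p nu (~~ c) + r - W) =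
    top_at eta tau nu p j1 j2 i1 i2 c.
  rewrite /top_at u1 u2 [(_ == nat_of_ord i1)]eq_sym [(_ == nat_of_ord i2)]eq_sym n1 n2.
  by congr (th _ _ _ * th _ _ _); rewrite /=; ring.
have T3 c : th sg ehalf (zvar p nu c + r) * th sg ehalf (zvar p nu (~~ c) + r - V - W) =
    top_at eta tau nu p i1 j2 j1 i2 c.
  rewrite /top_at u3 u4 n1 [(_ == nat_of_ord i2)]eq_sym n2.
  by congr (th _ _ _ * th _ _ _); rewrite /=; ring.
rewrite (funext T1) (funext T2) (funext T3) => exchange; apply: etrans exchange _.
have -> : W - usum U i1 nu.+1 + usum U j1 nu.+1 = W - V by rewrite /V; ring.
by rewrite -[usum U j1 nu.+1 - _]opprB.
Qed.

Lemma relation_same_end (E : L = Ladd (segment i1 i2) (segment j1 i2)) :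
  i1 != j1 ->
  theta eta (vfun nu i1 p.2 - vfun nu j1 p.2 - 2 * tau) != 0 ->
  mul (gen i1 i2) (gen j1 i2) L p = qfac tau j1 i1 * mul (gen j1 i2) (gen i1 i2) L p.
Proof.
clear j2 h4 => ne1.
have E2 : L = Ladd (segment j1 i2) (segment i1 i2) by rewrite E LaddC.
rewrite (mulF_homF _ _ _ _ _ E) (mulF_homF _ _ _ _ _ E2).
rewrite (star_at tau eta_gt0 psep E h1 h2 h3 h2) (star_at tau eta_gt0 psep E2 h3 h2 h1 h2).
rewrite !vfunE -!/(useq p) theta_th => nV.
set V := usum U i1 nu.+1 - usum U j1 nu.+1 in nV.
pose r := usum U j1 i2.+1 - 2 * tau.
have hA := exchL tau eta_gt0 psep E h1 h2 h3 h2 ne1.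
have hB := symmR tau eta_gt0 psep E h1 h2 h3.
have g := genericnu psep E h1 h2 h3 h2.
have := exchange_same (sigmaN eta_gt0) (@ehalfD R) (@ehalf_neq0 R) (sigma_three_term eta_gt0)
  r g nV hA hB.
have u1 : usum U i1 i2.+1 = r + 2 * tau + V.
  rewrite /r /V !usum0 ?leqW //; try lia; ring.
have u2 : usum U j1 i2.+1 = r + 2 * tau by rewrite /r subrK.
have n1 : (i1 == j1 :> nat) = false by exact: negbTE.
have T1 c : th sg ehalf (zvar p nu c + r) * th sg ehalf (zvar p nu (~~ c) + r + V - 2 * tau) =
    top_at eta tau nu p j1 i2 i1 i2 c.
  rewrite /top_at u1 u2 eqxx [(_ == nat_of_ord i1)]eq_sym n1.
  by congr (th _ _ _ * th _ _ _); rewrite /=; ring.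
have T2 c : th sg ehalf (zvar p nu c + r + V) * th sg ehalf (zvar p nu (~~ c) + r - 2 * tau) =
    top_at eta tau nu p i1 i2 j1 i2 c.
  rewrite /top_at u1 u2 eqxx n1.
  by congr (th _ _ _ * th _ _ _); rewrite /=; ring.
rewrite (funext T1) (funext T2) => exchange.
apply/esym/(etrans (congr1 ( *%R (qfac tau j1 i1)) exchange)).
by rewrite mulVKf ?qfac_neq0.
Qed.

Lemma relation_same_start (E : L = Ladd (segment i1 i2) (segment i1 j2)) :
  i2 != j2 ->
  theta eta (wfun nu i2 p.2 - wfun nu j2 p.2 - 2 * tau) != 0 ->
  mul (gen i1 i2) (gen i1 j2) L p = qfac tau j2 i2 * mul (gen i1 j2) (gen i1 i2) L p.
Proof.
clear j1 h3 => ne2.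
have E2 : L = Ladd (segment i1 j2) (segment i1 i2) by rewrite E LaddC.
rewrite (mulF_homF _ _ _ _ _ E) (mulF_homF _ _ _ _ _ E2).
rewrite (star_at tau eta_gt0 psep E h1 h2 h1 h4) (star_at tau eta_gt0 psep E2 h1 h4 h1 h2).
rewrite !wfunE -!/(useq p) theta_th => nW.
set W := usum U nu i2.+1 - usum U nu j2.+1 in nW.
pose r := usum U i1 j2.+1 - 2 * tau.
have hB := exchR tau eta_gt0 psep E h1 h2 h1 h4 ne2.
have hA := symmL tau eta_gt0 psep E h1 h2 h4.
have g := genericnu psep E h1 h2 h1 h4.
have := exchange_same (sigmaN eta_gt0) (@ehalfD R) (@ehalf_neq0 R) (sigma_three_term eta_gt0)
  r g nW hB hA.
have u1 : usum U i1 i2.+1 = r + 2 * tau + W.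
  rewrite /r /W !usum0 ?leqW //; try lia; ring.
have u2 : usum U i1 j2.+1 = r + 2 * tau by rewrite /r subrK.
have n2 : (i2 == j2 :> nat) = false by exact: negbTE.
have T1 c : th sg ehalf (zvar p nu c + r) * th sg ehalf (zvar p nu (~~ c) + r + W - 2 * tau) =
    top_at eta tau nu p i1 j2 i1 i2 c.
  rewrite /top_at u1 u2 eqxx [(_ == nat_of_ord i2)]eq_sym n2.
  by congr (th _ _ _ * th _ _ _); rewrite /=; ring.
have T2 c : th sg ehalf (zvar p nu c + r + W) * th sg ehalf (zvar p nu (~~ c) + r - 2 * tau) =
    top_at eta tau nu p i1 i2 i1 j2 c.
  rewrite /top_at u1 u2 eqxx n2.
  by congr (th _ _ _ * th _ _ _); rewrite /=; ring.
rewrite (funext T1) (funext T2).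
have sC A T := pairing_sumC (zvar p nu) A (chainL eta tau nu p i1 i1) T.
rewrite (sC (chainR eta tau nu p j2 i2)) (sC (chainR eta tau nu p i2 j2)) => exchange.
apply/esym/(etrans (congr1 ( *%R (qfac tau j2 i2)) exchange)).
by rewrite mulVKf ?qfac_neq0.
Qed.

End Degree.

End GeneratorRelations.

Section CartanRelations.
Context {R : realType} {n : nat}.
Local Notation h := n.+1.
Local Notation vars := (@vars R h).
Variables (eta tau : R[i]) (nu : 'I_h).
Local Notation ef i1 i2 := (efun eta tau nu (i1 := i1) (i2 := i2)).
Local Notation gen i1 i2 := (homF (ef i1 i2)).

(** No colour occurs in both factors, so that the product has a single summand, with u
    shifted in the second factor. *)
Lemma mulF_efun_funF (i1 i2 : 'I_h) (c c' : 'rV[R[i]]_h -> R[i]) :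
  (i1 <= nu)%N -> (nu <= i2)%N ->
  (forall u : 'rV[R[i]]_h, c (\row_(i < h) (u 0 i - 2 * (pairing (segment i1 i2) i)%:~R * tau)) = c' u) ->
  mulF eta tau (gen i1 i2) (funF c) =F mulF eta tau (funF c') (gen i1 i2).
Proof.
move=> h1 h2 hc L; apply: mero_eq_everywhere => p.
rewrite mulF_funF; last by move=> *; exact: homF_efun_permvars.
have e0 : Ladd (segment i1 i2) Lzero = segment i1 i2.
  by apply/funext => i; rewrite /Ladd addn0.
have [E|ne] := pselect (L = Ladd (segment i1 i2) Lzero); last first.
  by rewrite mulF_homF_neq // homF_neq ?mulr0 //; rewrite -e0.
rewrite (mulF_homF _ _ _ _ _ E).
have E' : L = segment i1 i2 by rewrite E e0.
have -> : @homF R h _ (ef i1 i2) L p = ef i1 i2 (castvars E' p).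
  by rewrite /homF; case: pselect => // E1; rewrite (Prop_irrelevance E1 E').
rewrite (star_normal (gx := fun _ u => c u) eta tau (castvars E p) (segment_le1 i1 i2) _
  (fun q => efunE eta tau q h1 h2) (fun q => erefl (c q.2)) (efun_on_support eta tau h1 h2)) //.
rewrite (big_pred1 [ffun=> false]) => [|b]; last first.
  apply/forallP/eqP => [hb|-> i]; last by rewrite ffunE.
  apply/ffunP => i; rewrite ffunE; have := hb i; rewrite addn0 /segment.
  by case: (b i) => //=; case: (_ <= _ <= _)%N.
rewrite [X in _ * X]big1 => [|i _]; last by apply: big1 => j _; rewrite andbF.
rewrite mulr1 castvars2 hc mulrC; congr (_ * _).
rewrite (efunE eta tau (castvars E' p) h1 h2) castvars2.
suff -> : left_var (castvars E p) [ffun=> false] = (xv (castvars E' p))^~ 0%N by [].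
by apply/funext => i; rewrite /left_var ffunE !xv_castvars.
Qed.

(** The shift is the pairing of the segment with delta_i + ... + delta_nu: it counts the
    ends of the segment that are ends of this interval. *)
Lemma vfun_shift (i1 i2 i : 'I_h) (u : 'rV[R[i]]_h) : (i1 <= nu)%N -> (nu <= i2)%N -> (i <= nu)%N ->
  vfun nu i (\row_(i < h) (u 0 i - 2 * (pairing (segment i1 i2) i)%:~R * tau)) =
  vfun nu i u - 2 * tau * ((i1 == i)%:R + (i2 == nu)%:R).
Proof.
move=> h1 h2 h3; rewrite !vfunE usum_segment_shift ?(leq_trans h1) ?ltn_ord //.
rewrite sum_segment_pairing -!val_eqE /=.
have -> : ((i <= i1 < nu.+1)%N : nat)%:Z + (i <= i2 < nu.+1)%N%:Z -
    (i < i1 <= nu.+1)%N%:Z - (i <= i2.+1 < nu.+1)%N%:Z =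
    (i1 == i :> nat)%:Z + (i2 == nu :> nat)%:Z :> int by lia.
by rewrite rmorphD.
Qed.

Lemma wfun_shift (i1 i2 i : 'I_h) (u : 'rV[R[i]]_h) : (i1 <= nu)%N -> (nu <= i2)%N -> (nu <= i)%N ->
  wfun nu i (\row_(i < h) (u 0 i - 2 * (pairing (segment i1 i2) i)%:~R * tau)) =
  wfun nu i u - 2 * tau * ((i1 == nu)%:R + (i2 == i)%:R).
Proof.
move=> h1 h2 h3; rewrite !wfunE usum_segment_shift ?(leq_trans h1) ?ltn_ord //.
rewrite sum_segment_pairing -!val_eqE /=.
have -> : ((nu <= i1 < i.+1)%N : nat)%:Z + (nu <= i2 < i.+1)%N%:Z -
    (nu < i1 <= i.+1)%N%:Z - (nu <= i2.+1 < i.+1)%N%:Z =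
    (i1 == nu :> nat)%:Z + (i2 == i :> nat)%:Z :> int by lia.
by rewrite rmorphD.
Qed.

Lemma commF_funF (c d : 'rV[R[i]]_h -> R[i]) : commF eta tau (funF c) (funF d) =F zeroF.
Proof.
move=> L; apply: mero_eq_everywhere => p.
rewrite /commF /addF /scaleF !mulF_funF; try by move=> *; exact: permvars_funF.
rewrite /zeroF /funF /homF; case: pselect => E; last by rewrite !mulr0 addr0.
by rewrite !castvars2; ring.
Qed.

(** For i < j the difference contains u_i, which v_j does not; for j < i it contains
    - u_j. *)
Lemma affine_vdiff L (i j : 'I_h) (d : R[i]) : i != j -> (i <= nu)%N -> (j <= nu)%N ->
  affine_form (fun p : vars L => vfun nu i p.2 - vfun nu j p.2 + d).
Proof.
move=> ne hi hj.
pose c (k : 'I_h) : R[i] := (i <= k <= nu)%N%:R - (j <= k <= nu)%N%:R.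
rewrite (_ : (fun p => _) = fun p : vars L => \sum_(k < h) c k * p.2 0 k + d); last first.
  apply/funext => p; congr (_ + _); rewrite /vfun [X in X - _]big_mkcond [X in _ - X]big_mkcond -sumrB.
  apply: eq_bigr => k _; rewrite /c.
  by case: (i <= k <= nu)%N; case: (j <= k <= nu)%N => /=; ring.
have ne' : i != j :> nat by [].
apply: (@affine_udiff _ _ _ _ _ (if (i < j)%N then i else j)).
case: ltnP => hij; rewrite /c leqnn ?hi ?hj /=.
  by rewrite [(j <= i)%N]leqNgt hij subr0 oner_neq0.
have hji : (j < i)%N by rewrite ltn_neqAle eq_sym ne'.
by rewrite [(i <= j)%N]leqNgt hji /= sub0r oppr_eq0 oner_neq0.
Qed.

Lemma affine_wdiff L (i j : 'I_h) (d : R[i]) : i != j -> (nu <= i)%N -> (nu <= j)%N ->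
  affine_form (fun p : vars L => wfun nu i p.2 - wfun nu j p.2 + d).
Proof.
move=> ne hi hj.
pose c (k : 'I_h) : R[i] := (nu <= k <= i)%N%:R - (nu <= k <= j)%N%:R.
rewrite (_ : (fun p => _) = fun p : vars L => \sum_(k < h) c k * p.2 0 k + d); last first.
  apply/funext => p; congr (_ + _); rewrite /wfun [X in X - _]big_mkcond [X in _ - X]big_mkcond -sumrB.
  apply: eq_bigr => k _; rewrite /c.
  by case: (nu <= k <= i)%N; case: (nu <= k <= j)%N => /=; ring.
have ne' : i != j :> nat by [].
apply: (@affine_udiff _ _ _ _ _ (if (i < j)%N then j else i)).
case: ltnP => hij; rewrite /c leqnn ?hi ?hj /=.
  by rewrite [(j <= i)%N]leqNgt hij /= sub0r oppr_eq0 oner_neq0.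
have hji : (j < i)%N by rewrite ltn_neqAle eq_sym ne'.
by rewrite [(i <= j)%N]leqNgt hji /= subr0 oner_neq0.
Qed.

End CartanRelations.

Theorem proposition11 (R : realType) (h : nat) (nu : 'I_h) (eta tau : R[i])
    (heta : 0 < complex.Im eta) (hnu1 : (0 < nu)%N) (hnuh : (nu.+1 < h)%N) :
  let th := theta eta in
  let q : 'I_h -> 'I_h -> R[i] := qfac tau in
  let mul := mulF eta tau in
  let e (i1 i2 : 'I_h) : gradedfam R h := homF (@efun R h eta tau nu i1 i2) in
  let v (i : 'I_h) : gradedfam R h := funF (vfun nu i) in
  let w (i : 'I_h) : gradedfam R h := funF (wfun nu i) in
  forall i1 i1' i2 i2' : 'I_h,
    (i1 <= nu)%N -> (i1' <= nu)%N -> (nu <= i2)%N -> (nu <= i2')%N ->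
  (* e, v, w are elements of the algebra *)
  (inF (e i1 i2) /\ inF (v i1) /\ inF (w i2)) /\
  (i1 != i1' -> i2 != i2' ->
    mul (e i1 i2) (e i1' i2') =F
    addF
      (mul (funF (fun u =>
              th (vfun nu i1 u - vfun nu i1' u - 2 * tau) *
              th (wfun nu i2' u - wfun nu i2 u) * q i1' i1 * q i2' i2 /
              (th (vfun nu i1 u - vfun nu i1' u) *
               th (wfun nu i2' u - wfun nu i2 u - 2 * tau))))
           (mul (e i1' i2') (e i1 i2)))
      (mul (funF (fun u =>
              th (- (2 * tau)) * q i2' i2 *
              th (wfun nu i2' u - wfun nu i2 u - vfun nu i1 u + vfun nu i1' u) /
              (th (vfun nu i1' u - vfun nu i1 u) *
               th (wfun nu i2' u - wfun nu i2 u - 2 * tau))))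
           (mul (e i1 i2') (e i1' i2)))) /\
  mul (e i1 i2) (e i1' i2) =F scaleF (q i1' i1) (mul (e i1' i2) (e i1 i2)) /\
  mul (e i1 i2) (e i1 i2') =F scaleF (q i2' i2) (mul (e i1 i2') (e i1 i2)) /\
  (* Moving v past e shifts it by 2 tau times
     (delta_i1 + ... + delta_i2, delta_i + ... + delta_nu), which is 1 if i = i1
     and 0 otherwise when i2 <> nu, and one more when i2 = nu; likewise for w. *)
  (i2 != nu ->
    (i1 != i1' -> mul (e i1 i2) (v i1') =F mul (v i1') (e i1 i2)) /\
    mul (e i1 i2) (v i1) =F
      mul (funF (fun u => vfun nu i1 u - 2 * tau)) (e i1 i2)) /\
  (i2 = nu ->
    (i1 != i1' -> mul (e i1 i2) (v i1') =F
      mul (funF (fun u => vfun nu i1' u - 2 * tau)) (e i1 i2)) /\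
    mul (e i1 i2) (v i1) =F
      mul (funF (fun u => vfun nu i1 u - 4 * tau)) (e i1 i2)) /\
  (i1 != nu ->
    (i2 != i2' -> mul (e i1 i2) (w i2') =F mul (w i2') (e i1 i2)) /\
    mul (e i1 i2) (w i2) =F
      mul (funF (fun u => wfun nu i2 u - 2 * tau)) (e i1 i2)) /\
  (i1 = nu ->
    (i2 != i2' -> mul (e i1 i2) (w i2') =F
      mul (funF (fun u => wfun nu i2' u - 2 * tau)) (e i1 i2)) /\
    mul (e i1 i2) (w i2) =F
      mul (funF (fun u => wfun nu i2 u - 4 * tau)) (e i1 i2)) /\
  commF eta tau (v i1) (v i1') =F zeroF /\
  commF eta tau (w i2) (w i2') =F zeroF /\
  commF eta tau (v i1) (w i2) =F zeroF.
Proof.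
case: h nu hnu1 hnuh => [[]//|n] nu hnu1 hnuh.
move=> th q mul e v w i1 i1' i2 i2' h1 h1' h2 h2'.
have mul_fun c (a b : gradedfam R n.+1) L p : mul (funF c) (mul a b) L p = c p.2 * mul a b L p.
  by apply: mulF_funF => L' s p'; exact: mulF_permvars.
have mul_neq L p a1 a2 b1 b2 : L <> Ladd (segment a1 a2) (segment b1 b2) ->
    mul (e a1 a2) (e b1 b2) L p = 0.
  by move=> ne; exact: mulF_homF_neq.
split.
  split; first exact: efun_inF.
  by split; [exact: vfun_inF | exact: wfun_inF].
split.
  move=> ne1 ne2 L.
  have [E|ne] := pselect (L = Ladd (segment i1 i2) (segment i1' i2')); last first.
    apply: mero_eq_everywhere => p.
    have ne' : L <> Ladd (segment i1' i2') (segment i1 i2) by rewrite LaddC.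
    have ne'' : L <> Ladd (segment i1 i2') (segment i1' i2).
      by rewrite -(Ladd_exchange h1 h2 h1' h2').
    rewrite /addF !mul_fun (mul_neq _ _ _ _ _ _ ne) (mul_neq _ _ _ _ _ _ ne').
    by rewrite (mul_neq _ _ _ _ _ _ ne'') !mulr0 addr0.
  have ne2' : i2' != i2 by rewrite eq_sym.
  (* At the points of D the denominators of both coefficients are nonzero: those in v
     differ only by the sign of the argument of theta. *)
  have [D [oD dD hD]] := generic_set heta (affine_vdiff L 0 ne1 h1 h1')
    (affine_wdiff L (- (2 * tau)) ne2' h2' h2).
  exists D; split => // p /hD [psep hV hW]; rewrite addr0 in hV.
  rewrite /addF !mul_fun.
  exact: (relation_distinct heta h1 h2 h1' h2' psep E ne1 ne2 hV hW).
split.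
  have [<-|ne1] := eqVneq i1 i1'.
    by move=> L; apply: mero_eq_everywhere => p; rewrite /scaleF /q /qfac ltnn mul1r.
  move=> L; have [E|ne] := pselect (L = Ladd (segment i1 i2) (segment i1' i2)); last first.
    apply: mero_eq_everywhere => p.
    have ne' : L <> Ladd (segment i1' i2) (segment i1 i2) by rewrite LaddC.
    by rewrite /scaleF (mul_neq _ _ _ _ _ _ ne) (mul_neq _ _ _ _ _ _ ne') mulr0.
  have [D [oD dD hD]] := generic_set heta (affine_vdiff L (- (2 * tau)) ne1 h1 h1')
    (affine_vdiff L (- (2 * tau)) ne1 h1 h1').
  exists D; split => // p /hD [psep hV _].
  exact: (relation_same_end heta h1 h2 h1' psep E ne1 hV).
split.
  have [<-|ne2] := eqVneq i2 i2'.
    by move=> L; apply: mero_eq_everywhere => p; rewrite /scaleF /q /qfac ltnn mul1r.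
  move=> L; have [E|ne] := pselect (L = Ladd (segment i1 i2) (segment i1 i2')); last first.
    apply: mero_eq_everywhere => p.
    have ne' : L <> Ladd (segment i1 i2') (segment i1 i2) by rewrite LaddC.
    by rewrite /scaleF (mul_neq _ _ _ _ _ _ ne) (mul_neq _ _ _ _ _ _ ne') mulr0.
  have [D [oD dD hD]] := generic_set heta (affine_wdiff L (- (2 * tau)) ne2 h2 h2')
    (affine_wdiff L (- (2 * tau)) ne2 h2 h2').
  exists D; split => // p /hD [psep hW _].
  exact: (relation_same_start heta h1 h2 h2' psep E ne2 hW).
have four : 2 * tau * (1 + 1) = 4 * tau by ring.
split.
  move=> ne; split=> [ne1|]; apply: mulF_efun_funF => // u; rewrite vfun_shift //.
    by rewrite (negbTE ne1) (negbTE ne) addr0 mulr0 subr0.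
  by rewrite eqxx (negbTE ne) addr0 mulr1.
split.
  move=> eq2; split=> [ne1|]; apply: mulF_efun_funF => // u; rewrite vfun_shift //.
    by rewrite (negbTE ne1) eq2 eqxx add0r mulr1.
  by rewrite eq2 !eqxx four.
split.
  move=> ne; split=> [ne2|]; apply: mulF_efun_funF => // u; rewrite wfun_shift //.
    by rewrite (negbTE ne2) (negbTE ne) addr0 mulr0 subr0.
  by rewrite eqxx (negbTE ne) add0r mulr1.
split.
  move=> eq1; split=> [ne2|]; apply: mulF_efun_funF => // u; rewrite wfun_shift //.
    by rewrite (negbTE ne2) eq1 eqxx addr0 mulr1.
  by rewrite eq1 !eqxx four.
by split; [|split]; exact: commF_funF.
Qed.
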